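(* Let $\mathbb{S}=\{S^i:i\in I\}$ be a market of nonnegative semimartingales and let $T\in(0,\infty)$. Let $(\mathcal{K}_\alpha)_{\alpha\geq0}$ be one of the families $$(\mathcal{I}_\alpha(\mathbb{S}))_{\alpha\geq0},\ (\mathcal{I}^{\rm adm}_\alpha(\mathbb{S}))_{\alpha\geq0},\ (\mathcal{I}^{+}_\alpha(\mathbb{S}))_{\alpha\geq0},\ (\mathcal{P}_{{\rm sf},\alpha}(\mathbb{S}))_{\alpha\geq0},\ (\mathcal{P}^{\rm adm}_{{\rm sf},\alpha}(\mathbb{S}))_{\alpha\geq0},\ (\mathcal{P}^{+}_{{\rm sf},\alpha}(\mathbb{S}))_{\alpha\geq0}.$$ Set $\mathcal{B}_\alpha:=(\mathcal{K}_\alpha-L^0_+)\cap L^0_+$ for $\alpha\geq0$. Then the following statements are equivalent: (i) $\mathcal{K}_1$ satisfies NUPBR. (ii) $\mathcal{K}_1$ satisfies NAA$_1$. (iii) $\mathcal{K}_1$ satisfies NA$_1$. (iv) $\bigcap_{\alpha>0}\mathcal{B}_\alpha=\{0\}$.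
   Context: Let $(\Omega,\mathcal{F},(\mathcal{F}_t)_{t\in\mathbb{R}_+},\mathbb{P})$ be a stochastic basis satisfying the usual conditions with $\mathcal{F}_0$ $\mathbb{P}$-trivial; processes are identified up to indistinguishability. $I\neq\emptyset$ is an arbitrary index set and $(S^i)_{i\in I}$ are real-valued semimartingales with $S^i\geq0$. For an $\mathbb{R}^d$-valued semimartingale $X$, $L(X)$ is the set of (predictable) $X$-integrable processes in the sense of vector stochastic integration and $\delta\bullet X$ the stochastic integral (with $(\delta\bullet X)_0=0$). A strategy for $\mathbb{S}$ is a process $\delta=(\delta^i)_{i\in I}$ such that $F:=\{i\in I:\delta^i\neq0\}$ is finite and $\delta^F=(\delta^i)_{i\in F}\in L(S^F)$, $S^F=(S^i)_{i\in F}$; $\Delta(\mathbb{S})$ is the set of strategies. Put $\delta\bullet S:=\delta^F\bullet S^F$, $I^{\alpha,\delta}:=\alpha+\delta\bullet S$ and $S^\delta:=\sum_{i\in F}\delta^iS^i$. $\delta$ is self-financing if $S^\delta=S^\delta_0+\delta\bullet S$; $\Delta_{\rm sf}(\mathbb{S})$ is the set of self-financing strategies. A process $X$ is admissible if $X\geq-a$ for some constant $a\in\mathbb{R}_+$. For $\alpha\geq0$: $\mathbb{I}_\alpha(\mathbb{S}):=\{I^{\alpha,\delta}:\delta\in\Delta(\mathbb{S})\}$ and $\mathbb{P}_{{\rm sf},\alpha}(\mathbb{S}):=\{S^\delta:\delta\in\Delta_{\rm sf}(\mathbb{S}),\ S^\delta_0=\alpha\}$; superscript ''adm'' denotes the subset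 of admissible processes, superscript ''$+$'' the subset of processes $X\geq0$. The calligraphic families $\mathcal{I}_\alpha,\mathcal{I}^{\rm adm}_\alpha,\mathcal{I}^+_\alpha,\mathcal{P}_{{\rm sf},\alpha},\mathcal{P}^{\rm adm}_{{\rm sf},\alpha},\mathcal{P}^+_{{\rm sf},\alpha}$ consist of the terminal values $X_T$ of the processes $X$ in the corresponding family; they are subsets of $L^0=L^0(\Omega,\mathcal{F}_T,\mathbb{P})$, the space of a.s. equivalence classes of $\mathcal{F}_T$-measurable real random variables, which carries the a.s. order and the topology of convergence in probability; $L^0_+$ is the set of its nonnegative elements. With $\mathcal{B}:=\mathcal{B}_1$ and $p_{\mathcal{B}}(\xi):=\inf\{\alpha>0:\xi\in\alpha\mathcal{B}\}\in[0,\infty]$: $\mathcal{K}_1$ satisfies NUPBR if $\mathcal{B}$ is topologically bounded (for every neighborhood $U$ of zero there is $\alpha>0$ with $\mathcal{B}\subset\alpha U$); NAA$_1$ if $\mathcal{B}$ is sequentially bounded ($\alpha_n\xi_n\to0$ for all $(\xi_n)\subset\mathcal{B}$ and real $\alpha_n\to0$); NA$_1$ if $p_{\mathcal{B}}(\xi)>0$ for all $\xi\in L^0_+\setminus\{0\}$.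
   Formalization: The equivalence of (iv) with (i)–(iii) is stated for nonempty K_1; if K_1 is empty (e.g. all S^i = 0 and a self-financing family), (i)–(iii) hold vacuously while the intersection in (iv) is empty, not {0}. *)

(* Defs.v *)
From HB Require Import structures.
From mathcomp Require Import all_boot all_order all_algebra.
From mathcomp Require Import all_classical all_reals all_analysis.

Set Implicit Arguments.
Unset Strict Implicit.
Unset Printing Implicit Defensive.

Import Order.TTheory GRing.Theory Num.Theory.
Import numFieldNormedType.Exports.

Local Open Scope classical_set_scope.
Local Open Scope ring_scope.

(* The time set is [0, +oo[; values of a process or of a filtration at
   negative times are junk and never used. *)
Definition process (R : realType) (Omega : Type) := R -> Omega -> R.

(* Real functions measurable with respect to a sub-sigma-algebra G. *)
Definition sub_measurable (R : realType) (Omega : Type) (G : set (set Omega))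
    (f : Omega -> R) : Prop :=
  forall B : set R, measurable B -> G (f @^-1` B).

Section StochasticBasis.
Context {d : measure_display} {Omega : measurableType d} {R : realType}.
Variables (P : probability Omega R) (F : R -> set (set Omega)).

Implicit Types (X Y M A H : process R Omega) (tau : Omega -> \bar R).

Definition filtration : Prop :=
  (forall t, 0 <= t -> sigma_algebra setT (F t) /\ F t `<=` measurable) /\
  (forall s t, 0 <= s -> s <= t -> F s `<=` F t).

Definition usual_conditions : Prop :=
  (forall t, 0 <= t -> F t = \bigcap_(s in [set s | t < s]) F s) /\
  (forall N : set Omega, P.-negligible N -> F 0 N).

Definition trivial_sigma_algebra (G : set (set Omega)) : Prop :=
  forall A : set Omega, G A -> P A = 0%E \/ P A = 1%E.

Definition indist X Y : Prop :=
  {ae P, forall w, forall t, 0 <= t -> X t w = Y t w}.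

Definition bounded_below_by (c : R) X : Prop :=
  {ae P, forall w, forall t, 0 <= t -> c <= X t w}.

Definition adapted X : Prop := forall t, 0 <= t -> sub_measurable (F t) (X t).

Definition cadlag X : Prop := forall w,
  (forall t, 0 <= t -> X s w @[s --> t^'+] --> X t w) /\
  (forall t, 0 < t -> cvg (X s w @[s --> t^'-])).

Definition predictable_rectangles : set (set (R * Omega)) :=
  [set C | (exists2 A : set Omega, F 0 A & C = [set 0] `*` A) \/
           (exists s t (A : set Omega), [/\ 0 <= s, s < t, F s A & C = `]s, t] `*` A])].

Definition predictable H : Prop := forall B : set R, measurable B ->
  <<s `[0, +oo[ `*` setT, predictable_rectangles >>
    ((`[0, +oo[ `*` setT) `&` [set z | B (H z.1 z.2)]).

Definition stopping_time tau : Prop :=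
  (forall w, (0 <= tau w)%E) /\
  (forall t, 0 <= t -> F t [set w | (tau w <= t%:E)%E]).

Definition stopped X tau : process R Omega :=
  fun t w => X (fine (Order.min t%:E (tau w))) w.

Definition martingale M : Prop :=
  [/\ adapted M, cadlag M,
      forall t, 0 <= t -> P.-integrable setT (fun w => (M t w)%:E) &
      forall s t (A : set Omega), 0 <= s -> s <= t -> F s A ->
        (\int[P]_(w in A) (M t w)%:E = \int[P]_(w in A) (M s w)%:E)%E].

Definition local_martingale M : Prop :=
  [/\ adapted M, cadlag M &
      exists tau : nat -> Omega -> \bar R,
      [/\ forall n, stopping_time (tau n),
          forall n w, (tau n w <= tau n.+1 w)%E,
          {ae P, forall w, tau n w @[n --> \oo] --> +oo%E} &
          forall n, martingale (stopped M (tau n))]].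

Definition finite_variation A : Prop :=
  [/\ adapted A, cadlag A &
      forall w t, 0 <= t -> bounded_variation 0 t (fun s => A s w)].

Definition semimartingale X : Prop :=
  [/\ adapted X, cadlag X &
      exists M A, [/\ local_martingale M, finite_variation A,
        forall w, M 0 w = 0, forall w, A 0 w = 0 &
        indist X (fun t w => X 0 w + M t w + A t w)]].

(* Convergence in probability to 0. *)
Definition cvg0_in_probability (xi : nat -> Omega -> R) : Prop :=
  forall e : R, 0 < e ->
    P [set w | e <= `|xi n w|] @[n --> \oo] --> 0%E.

Definition bounded_process H : Prop :=
  exists c : R, forall t w, 0 <= t -> `|H t w| <= c.

(* J is the stochastic integral H |-> H . X of bounded predictable processes,
   specified by the properties that determine it up to indistinguishability:
   the explicit value on elementary integrands, linearity and dominated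
   convergence (Jacod-Shiryaev, Theorem I.4.31). *)
Definition integral_operator X (J : process R Omega -> process R Omega) : Prop :=
  [/\ forall H, predictable H -> bounded_process H ->
        adapted (J H) /\ cadlag (J H),
      forall f : Omega -> R, sub_measurable (F 0) f ->
        (exists c : R, forall w, `|f w| <= c) ->
        indist (J (fun t w => f w * (t == 0)%:R)) (fun=> fun=> 0),
      forall (f : Omega -> R) r s, 0 <= r -> r < s -> sub_measurable (F r) f ->
        (exists c : R, forall w, `|f w| <= c) ->
        indist (J (fun t w => f w * ((r < t) && (t <= s))%:R))
          (fun t w => f w * (X (Num.min s t) w - X (Num.min r t) w)),
      forall H K (a : R), predictable H -> bounded_process H ->
        predictable K -> bounded_process K ->
        indist (J (fun t w => a * H t w + K t w))
               (fun t w => a * J H t w + J K t w) &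
      forall (H : nat -> process R Omega) K (c : R),
        (forall n, predictable (H n)) -> predictable K ->
        (forall n t w, 0 <= t -> `|H n t w| <= c) ->
        (forall t w, 0 <= t -> H n t w @[n --> \oo] --> K t w) ->
        forall t, 0 <= t ->
          cvg0_in_probability (fun n w => J (H n) t w - J K t w)].

(* Vector integrands, indexed by a finite set E; the dimension d is #|E|. *)
Section VectorIntegral.
Variable (I : choiceType).
Implicit Types (delta S : I -> process R Omega) (E : set I).

(* Indicator process of {|delta^E| <= n}, for the maximum norm on R^E. *)
Definition trunc_indic E delta (n : nat) : process R Omega :=
  fun t w => \1_[set z : R * Omega | forall i, E i ->
                   `|delta i z.1 z.2| <= n%:R] (t, w).

(* delta^E \in L(S^E) with delta^E . S^E = Y.  The vector integral of an
   unbounded integrand is not a sum of scalar integrals: as in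
   Chou-Meyer-Stricker, Y is the semimartingale null at 0 such that
   1_{|delta| <= n} . Y = (delta 1_{|delta| <= n}) . S for all n, where the
   right-hand side has a bounded integrand and is the sum of the
   componentwise integrals. *)
Definition vector_integral E S delta Y : Prop :=
  [/\ forall i, E i -> predictable (delta i),
      semimartingale Y,
      {ae P, forall w, Y 0 w = 0} &
      exists (J : I -> process R Omega -> process R Omega)
             (JY : process R Omega -> process R Omega),
      [/\ forall i, E i -> integral_operator (S i) (J i),
          integral_operator Y JY &
          forall n, indist (JY (trunc_indic E delta n))
            (fun t w => \sum_(i \in E)
               J i (fun s v => delta i s v * trunc_indic E delta n s v) t w)]].

Definition strategy_support delta : set I :=
  [set i | ~ indist (delta i) (fun=> fun=> 0)].

Definition strategy_integral S delta Y : Prop :=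
  finite_set (strategy_support delta) /\
  vector_integral (strategy_support delta) S delta Y.

Definition portfolio S delta : process R Omega :=
  fun t w => \sum_(i \in strategy_support delta) delta i t w * S i t w.

Definition self_financing S delta : Prop :=
  exists2 Y, strategy_integral S delta Y &
    indist (portfolio S delta) (fun t w => portfolio S delta 0 w + Y t w).

Definition investments S (alpha : R) : set (process R Omega) :=
  [set X | exists delta Y, strategy_integral S delta Y /\
             indist X (fun t w => alpha + Y t w)].

Definition sf_portfolios S (alpha : R) : set (process R Omega) :=
  [set X | exists delta, [/\ self_financing S delta,
             {ae P, forall w, portfolio S delta 0 w = alpha} &
             indist X (portfolio S delta)]].

End VectorIntegral.

Definition admissible : set (process R Omega) :=
  [set X | exists2 a : R, 0 <= a & bounded_below_by (- a) X].

Definition nonneg_process : set (process R Omega) := [set X | bounded_below_by 0 X].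

(* Elements of L^0(Omega, G, P) are represented by G-measurable functions;
   terminal_values and dominated_claims are closed under a.s. equality. *)
Definition L0 (G : set (set Omega)) : set (Omega -> R) :=
  [set xi | sub_measurable G xi].

Definition L0plus (G : set (set Omega)) : set (Omega -> R) :=
  [set xi | L0 G xi /\ {ae P, forall w, 0 <= xi w}].

Definition L0zero (G : set (set Omega)) : set (Omega -> R) :=
  [set xi | L0 G xi /\ {ae P, forall w, xi w = 0}].

Definition terminal_values (T : R) (C : set (process R Omega)) : set (Omega -> R) :=
  [set xi | L0 (F T) xi /\ exists2 X, C X & {ae P, forall w, xi w = X T w}].

(* (K - L^0_+) \cap L^0_+ *)
Definition dominated_claims (G : set (set Omega)) (K : set (Omega -> R)) :
    set (Omega -> R) :=
  [set xi | exists k eta, [/\ K k, L0plus G eta & xi = (fun w => k w - eta w)]]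
  `&` L0plus G.

Definition scale_set (a : R) (B : set (Omega -> R)) : set (Omega -> R) :=
  [set xi | exists2 b, B b & xi = (fun w => a * b w)].

(* Neighborhoods of zero for the topology of convergence in probability. *)
Definition L0_nbhs0 (G : set (set Omega)) (U : set (Omega -> R)) : Prop :=
  exists2 e : R, 0 < e &
    [set xi | L0 G xi /\ (P [set w | (e <= `|xi w|)%R] < e%:E)%E] `<=` U.

Definition topologically_bounded (G : set (set Omega)) (B : set (Omega -> R)) :
    Prop :=
  forall U, L0_nbhs0 G U -> exists2 a : R, 0 < a & B `<=` scale_set a U.

Definition sequentially_bounded (B : set (Omega -> R)) : Prop :=
  forall (xi : nat -> Omega -> R) (a : nat -> R), (forall n, B (xi n)) ->
    a n @[n --> \oo] --> 0 -> cvg0_in_probability (fun n w => a n * xi n w).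

Definition gauge (B : set (Omega -> R)) (xi : Omega -> R) : \bar R :=
  ereal_inf [set a%:E | a in [set a : R | 0 < a /\ scale_set a B xi]].

Definition NUPBR (G : set (set Omega)) (K1 : set (Omega -> R)) : Prop :=
  topologically_bounded G (dominated_claims G K1).

Definition NAA1 (G : set (set Omega)) (K1 : set (Omega -> R)) : Prop :=
  sequentially_bounded (dominated_claims G K1).

Definition NA1 (G : set (set Omega)) (K1 : set (Omega -> R)) : Prop :=
  forall xi, (L0plus G `\` L0zero G) xi ->
    (0 < gauge (dominated_claims G K1) xi)%E.

Section Families.
Variable (I : choiceType).
Implicit Types (S : I -> process R Omega).

Definition K_I S (T alpha : R) := terminal_values T (investments S alpha).
Definition K_I_adm S (T alpha : R) :=
  terminal_values T (investments S alpha `&` admissible).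
Definition K_I_plus S (T alpha : R) :=
  terminal_values T (investments S alpha `&` nonneg_process).
Definition K_P S (T alpha : R) := terminal_values T (sf_portfolios S alpha).
Definition K_P_adm S (T alpha : R) :=
  terminal_values T (sf_portfolios S alpha `&` admissible).
Definition K_P_plus S (T alpha : R) :=
  terminal_values T (sf_portfolios S alpha `&` nonneg_process).

End Families.
End StochasticBasis.

(* Main.v *)
(* All six families are cones: a K_alpha + b K_beta is contained in
   K_(a alpha + b beta) for a, b >= 0.  For the vector integral this is proved
   on bounded integrands and then by dominated convergence: a monotone class
   argument on predictable rectangles shows that (H 1_{|delta| <= m}) . Y is the
   sum of the (H delta^i 1_{|delta| <= m}) . S^i for bounded predictable H;
   taking for H the truncation of the combined strategy times the truncation of
   the other strategy, the integrals can be added, and m tends to infinity.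
   Sums of local martingales are local martingales by optional stopping.

   Hence B_1 is a convex solid subset of L^0_+ and B_alpha = alpha B_1, and the
   equivalences become statements about such sets.  If B_1 is not bounded in
   probability, it contains n e g_n for some g_n with 0 <= g_n <= 1 and
   E g_n >= e; the g_n can be chosen as a Cauchy sequence in L^2 by convexity,
   so that they have a common positive lower bound on a set A of positive
   probability.  Then 1_A lies in alpha B_1 for all alpha > 0, which violates
   NA_1.  For (iv), 0 belongs to B_alpha because K_alpha contains a nonnegative
   element: a constant, or a buy-and-hold portfolio in an asset with a nonzero
   initial price. *)
Require Import Defs.
From HB Require Import structures.
From mathcomp Require Import all_boot all_order all_algebra.
From mathcomp Require Import all_classical all_reals all_analysis.
From mathcomp Require Import measurable_realfun ring lra.

Set Implicit Arguments.
Unset Strict Implicit.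
Unset Printing Implicit Defensive.

Import Order.TTheory GRing.Theory Num.Theory.
Import numFieldNormedType.Exports.

Local Open Scope classical_set_scope.
Local Open Scope ring_scope.

(** The specification fixes a stochastic integral only up to indistinguishability and no integral is
    constructed: each strategy brings its own operators, hidden under an existential. Operators of
    different strategies have to be identified before they can be added, and all identities between
    integrals rest on one principle: two operators that are linear and satisfy dominated convergence
    agree once they agree on predictable rectangles. Cancellation is the obstacle to adding
    strategies. A bound on the combination bounds neither strategy, which is why truncations of both
    are inserted; and the support of the combination may be smaller than the union of the supports,
    which leaves integrands that are evanescent but need not be zero. Their integrals vanish because
    null sets belong to F_0. [K 1 !=set0] guards (iv) for the portfolio families: if all prices
    start at 0, no self-financing portfolio has initial value 1, so NA_1 holds vacuously while the
    intersection is empty instead of {0}. *)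

(** * Functions measurable with respect to a sub-sigma-algebra *)

Section SubMeasurable.
Context {R : realType} {T : pointedType} (G : set (set T)).
Hypothesis sG : sigma_algebra setT G.
Implicit Types f g : T -> R.

(** A sigma-algebra coincides with the one it generates, so the closure properties of measurable
    functions on [g_sigma_algebraType G] carry over to [sub_measurable G]. *)
Lemma sub_measurableP f :
  sub_measurable G f <-> measurable_fun setT (f : g_sigma_algebraType G -> R).
Proof.
have GE (A : set T) : G A <-> measurable (A : set (g_sigma_algebraType G)).
  by rewrite -{1}(sigma_algebra_id sG).
split=> [mf _ B mB|mf B mB]; first by rewrite setTI; apply/GE; exact: mf.
by apply/GE; rewrite -[X in measurable X]setTI; exact: mf.
Qed.

Lemma sub_measurable_cst (c : R) : sub_measurable G (fun=> c).
Proof. by apply/sub_measurableP. Qed.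

Lemma sub_measurableD f g : sub_measurable G f -> sub_measurable G g ->
  sub_measurable G (fun w => f w + g w).
Proof.
by move=> /sub_measurableP mf /sub_measurableP mg; apply/sub_measurableP/measurable_funD.
Qed.

Lemma sub_measurableM f g : sub_measurable G f -> sub_measurable G g ->
  sub_measurable G (fun w => f w * g w).
Proof.
by move=> /sub_measurableP mf /sub_measurableP mg; apply/sub_measurableP/measurable_funM.
Qed.

Lemma sub_measurableZ (c : R) f : sub_measurable G f ->
  sub_measurable G (fun w => c * f w).
Proof. by apply: sub_measurableM; exact: sub_measurable_cst. Qed.

Lemma sub_measurableB f g : sub_measurable G f -> sub_measurable G g ->
  sub_measurable G (fun w => f w - g w).
Proof.
by move=> /sub_measurableP mf /sub_measurableP mg; apply/sub_measurableP/measurable_funB.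
Qed.

Lemma sub_measurable_norm f : sub_measurable G f ->
  sub_measurable G (fun w => `|f w|).
Proof.
by move=> /sub_measurableP mf; apply/sub_measurableP/measurableT_comp.
Qed.

Lemma sub_measurable_indic (A : set T) : G A -> sub_measurable G (\1_A : T -> R).
Proof.
move=> GA; apply/sub_measurableP; apply: measurable_indic.
by rewrite -(sigma_algebra_id sG) in GA.
Qed.

Lemma sub_measurable_sum (I : Type) (r : seq I) (Q : pred I) (f : I -> T -> R) :
  (forall i, Q i -> sub_measurable G (f i)) ->
  sub_measurable G (fun w => \sum_(i <- r | Q i) f i w).
Proof.
move=> mf; rewrite (_ : (fun _ => _) = \sum_(i <- r | Q i) f i); last first.
  by apply/funext => w; rewrite fct_sumE.
elim/big_ind : _ => //; first exact: sub_measurable_cst.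
by move=> x y; exact: sub_measurableD.
Qed.

Lemma sub_measurable_cvg (h : nat -> T -> R) f :
  (forall n, sub_measurable G (h n)) ->
  (forall w, h n w @[n --> \oo] --> f w) -> sub_measurable G f.
Proof.
move=> mh hf; apply/sub_measurableP.
apply: (@measurable_fun_cvg _ (g_sigma_algebraType G) R setT h) => //.
by move=> n; apply/sub_measurableP.
Qed.

Lemma sub_measurable_le f g : sub_measurable G f -> sub_measurable G g ->
  G [set w | f w <= g w].
Proof.
move=> mf mg.
have := sub_measurableB mf mg; move/(_ `]-oo, 0]%classic).
rewrite (_ : _ @^-1` _ = [set w | f w <= g w]); first by apply.
by apply/seteqP; split=> w /=; rewrite in_itv/= subr_le0.
Qed.

Lemma sub_measurable_lt f g : sub_measurable G f -> sub_measurable G g ->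
  G [set w | f w < g w].
Proof.
move=> mf mg.
have := sub_measurableB mf mg; move/(_ `]-oo, 0[%classic).
rewrite (_ : _ @^-1` _ = [set w | f w < g w]); first by apply.
by apply/seteqP; split=> w /=; rewrite in_itv/= subr_lt0.
Qed.

Lemma sub_sigma_setT : G setT.
Proof. by rewrite -(sigma_algebra_id sG); exact: (@measurableT _ (g_sigma_algebraType G)). Qed.

Lemma sub_sigma_setC A : G A -> G (~` A).
Proof. by case: sG => _ + _ => /[apply]; rewrite setTD. Qed.

Lemma sub_sigma_setI A B : G A -> G B -> G (A `&` B).
Proof.
rewrite -(sigma_algebra_id sG) => mA mB.
exact: (@measurableI _ (g_sigma_algebraType G)).
Qed.

Lemma sub_sigma_setD A B : G A -> G B -> G (A `\` B).
Proof. by move=> GA GB; rewrite setDE; apply: sub_sigma_setI => //; exact: sub_sigma_setC. Qed.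

Lemma sub_sigma_bigcap (A : nat -> set T) : (forall n, G (A n)) -> G (\bigcap_n A n).
Proof.
rewrite -(sigma_algebra_id sG) => mA.
by apply: (@bigcapT_measurable _ (g_sigma_algebraType G)).
Qed.

End SubMeasurable.

(** * Convergence in probability and cadlag processes *)

Section ConvergenceInProbability.
Context {d : measure_display} {Omega : measurableType d} {R : realType}.
Variable P : probability Omega R.
Implicit Types (f g : Omega -> R) (xi eta zeta : nat -> Omega -> R).

Lemma measurable_ge_norm f (e : R) : measurable_fun setT f ->
  measurable [set w | e <= `|f w|].
Proof.
move=> mf; rewrite -[X in measurable X]setTI.
by apply: measurable_fun_le => //; exact: measurableT_comp.
Qed.

Lemma le_probability_ae (A B : set Omega) : measurable A -> measurable B ->
  {ae P, forall w, A w -> B w} -> (P A <= P B)%E.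
Proof.
move=> mA mB AB; rewrite -(setUIDK A B).
apply: (@le_trans _ _ (P (A `&` B) + P (A `\` B))%E).
  by apply: measureU2; [exact: measurableI|exact: measurableD].
have -> : P (A `\` B) = 0%E.
  apply: measure_negligible; first exact: measurableD.
  apply: negligibleS AB => w [Aw Bw] /=; exact/not_implyP.
rewrite adde0; apply: le_measure; rewrite ?inE//.
exact: measurableI.
Qed.

Lemma cvg0_in_probability_dom (a b : R) xi eta zeta : 0 <= a -> 0 <= b ->
  (forall n, measurable_fun setT (xi n)) -> (forall n, measurable_fun setT (eta n)) ->
  (forall n, measurable_fun setT (zeta n)) ->
  (forall n, {ae P, forall w, `|zeta n w| <= a * `|xi n w| + b * `|eta n w|}) ->
  cvg0_in_probability P xi -> cvg0_in_probability P eta ->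
  cvg0_in_probability P zeta.
Proof.
move=> a0 b0 mx my mz le cx cy e e0.
(* If both variables stay below these thresholds, the bound on [zeta] stays below [e]; the [+ 1]
   allows [a] or [b] to be 0. *)
have ea : 0 < e / 2 / (a + 1) by rewrite !divr_gt0//; lra.
have eb : 0 < e / 2 / (b + 1) by rewrite !divr_gt0//; lra.
apply: (@squeeze_cvge _ _ _ _ (fun=> 0%E) _
  (fun n => P [set w | e / 2 / (a + 1) <= `|xi n w|]%R +
             P [set w | e / 2 / (b + 1) <= `|eta n w|]%R)%E).
- apply: nearW => n; rewrite measure_ge0/=.
  have m1 := measurable_ge_norm (e / 2 / (a + 1)) (mx n).
  have m2 := measurable_ge_norm (e / 2 / (b + 1)) (my n).
  apply: (@le_trans _ _ (P ([set w | e / 2 / (a + 1) <= `|xi n w|] `|`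
     [set w | e / 2 / (b + 1) <= `|eta n w|]))); last exact: measureU2.
  apply: le_probability_ae; first exact: measurable_ge_norm.
    exact: measurableU.
  apply: filterS (le n) => w H /= ez.
  have [|h1] := leP (e / 2 / (a + 1)) (`|xi n w|); first by left.
  have [|h2] := leP (e / 2 / (b + 1)) (`|eta n w|); first by right.
  exfalso.
  have : a * `|xi n w| <= a * (e / 2 / (a + 1)) by rewrite ler_wpM2l// ltW.
  have : b * `|eta n w| <= b * (e / 2 / (b + 1)) by rewrite ler_wpM2l// ltW.
  have -> : a * (e / 2 / (a + 1)) = e / 2 - (e / 2 / (a + 1)) by field; lra.
  have -> : b * (e / 2 / (b + 1)) = e / 2 - (e / 2 / (b + 1)) by field; lra.
  by lra.
- exact: cvg_cst.
- by rewrite -[X in _ --> X]adde0; apply: cvgeD => //; [exact: cx|exact: cy].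
Qed.

(** Uniqueness of limits in probability: along a constant sequence each probability of [|f| >= e]
    equals its own limit 0, and the levels 1/(n+1) exhaust the set where [f] is nonzero. *)
Lemma cvg0_in_probability_cst f : measurable_fun setT f ->
  cvg0_in_probability P (fun=> f) -> {ae P, forall w, f w = 0}.
Proof.
move=> mf cf.
have : {ae P, forall w, forall n : nat, `|f w| < n.+1%:R^-1}.
  apply: ae_foralln => n.
  have n0 : 0 < n.+1%:R^-1 :> R by rewrite invr_gt0.
  have /cvg_lim := cf _ n0.
  rewrite lim_cst// => /(_ (@ereal_hausdorff R)) P0.
  have E : ~` [set w | `|f w| < n.+1%:R^-1] = [set w | n.+1%:R^-1 <= `|f w|].
    by apply/seteqP; split=> w /=; [move/negP|move=> ?; apply/negP]; rewrite -leNgt.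
  rewrite /prop_near1 /nbhs /= /almost_everywhere E.
  by apply/negligibleP => //; exact: measurable_ge_norm.
apply: filterS => w H; apply/eqP; rewrite -normr_le0.
apply/ler_addgt0Pr => e e0; rewrite add0r.
apply: le_trans (ltW (H (Num.truncn e^-1))) _.
by rewrite -[leRHS]invrK lef_pV2 ?posrE ?invr_gt0//; apply/ltW/truncnS_gt.
Qed.

End ConvergenceInProbability.

Section Cadlag.
Context {d : measure_display} {Omega : measurableType d} {R : realType}.
Variable P : probability Omega R.
Implicit Types X Y : process R Omega.

Lemma cadlag0 : cadlag ((fun=> fun=> 0) : process R Omega).
Proof. by move=> w; split=> t t0; [exact: cvg_cst|exact: is_cvg_cst]. Qed.

(** The coefficients may depend on [w], which covers F_r-measurable factors and the subtraction of
    [X 0 w]. *)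
Lemma cadlag_lin (f g : Omega -> R) X Y : cadlag X -> cadlag Y ->
  cadlag (fun t w => f w * X t w + g w * Y t w).
Proof.
move=> cX cY w; have [X1 X2] := cX w; have [Y1 Y2] := cY w; split=> t t0.
  by apply: cvgD; apply: cvgM; [exact: cvg_cst|exact: X1|exact: cvg_cst|exact: Y1].
by apply: is_cvgD; apply: is_cvgM; [exact: is_cvg_cst|exact: X2|exact: is_cvg_cst|exact: Y2].
Qed.

Lemma cadlag_right X w t : cadlag X -> 0 <= t -> forall e, 0 < e ->
  exists2 dl, 0 < dl & forall s, t <= s -> s < t + dl -> `|X s w - X t w| < e.
Proof.
move=> cX t0 e e0; have [+ _] := cX w; move=> /(_ t t0) /cvgrPdist_lt /(_ e e0).
move=> /nbhs_ballP[dl /= dl0 H]; exists dl => // s.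
rewrite le_eqVlt => /predU1P[<- _|ts st]; first by rewrite subrr normr0.
rewrite distrC; apply: H => //=.
by rewrite /ball/= distrC gtr0_norm ?subr_gt0//; lra.
Qed.

(** Off one null set the processes agree at all rational times, and right continuity carries the
    agreement to every time. *)
Lemma cadlag_indist X Y : cadlag X -> cadlag Y ->
  (forall t, 0 <= t -> {ae P, forall w, X t w = Y t w}) -> indist P X Y.
Proof.
move=> cX cY XY.
(* [unpickle] enumerates the rationals, so that only countably many null sets are discarded. *)
have : {ae P, forall w, forall n : nat, forall q : rat, unpickle n = Some q ->
    0 <= (ratr q : R) -> X (ratr q) w = Y (ratr q) w}.
  apply: ae_foralln => n; case: (unpickle n) => [q|]; last exact: aeW.
  have [q0|q0] := leP 0 (ratr q : R).
    by apply: filterS (XY _ q0) => w H q' [<-].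
  by apply: aeW => w q' [<-]; rewrite leNgt q0.
apply: filterS => w H t t0.
apply/eqP; rewrite -subr_eq0; apply/negPn/negP => Z.
have e0 : 0 < `|X t w - Y t w| / 2 by rewrite divr_gt0// normr_gt0.
have [d1 d10 H1] := cadlag_right w cX t0 e0.
have [d2 d20 H2] := cadlag_right w cY t0 e0.
have : t < t + Num.min d1 d2 by rewrite ltrDl lt_min d10.
move=> /rat_in_itvoo[q]; rewrite in_itv/= => /andP[tq qt].
have {qt} : ratr q < t + d1 /\ ratr q < t + d2.
  by split; apply: lt_le_trans qt _; rewrite lerD2l ge_min lexx ?orbT.
move=> [q1 q2].
have := H (pickle q) q (pickleK q) (le_trans t0 (ltW tq)).
have := H1 _ (ltW tq) q1; have := H2 _ (ltW tq) q2 => h1 h2 h3.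
have : X t w - Y t w = (Y (ratr q) w - Y t w) - (X (ratr q) w - X t w).
  by rewrite h3; ring.
move=> h4; have : `|X t w - Y t w| < `|X t w - Y t w|.
  rewrite {1}h4; apply: le_lt_trans (ler_normB _ _) _.
  by rewrite [ltRHS]splitr ltrD.
by rewrite ltxx.
Qed.

Lemma indist_refl X : indist P X X.
Proof. exact: aeW. Qed.

Lemma indist_sym X Y : indist P X Y -> indist P Y X.
Proof. by apply: filterS => w H t t0; rewrite H. Qed.

Lemma indist_trans X Y Z : indist P X Y -> indist P Y Z -> indist P X Z.
Proof. by apply: filterS2 => w H H' t t0; rewrite H// H'. Qed.

Lemma indist_lin (f g : Omega -> R) X Y X' Y' : indist P X X' -> indist P Y Y' ->
  indist P (fun t w => f w * X t w + g w * Y t w)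
           (fun t w => f w * X' t w + g w * Y' t w).
Proof. by apply: filterS2 => w H H' t t0; rewrite H// H'. Qed.

Lemma indist_sum (I : Type) (r : seq I) (Q : pred I) (X Y : I -> process R Omega) :
  (forall i, Q i -> indist P (X i) (Y i)) ->
  indist P (fun t w => \sum_(i <- r | Q i) X i t w)
           (fun t w => \sum_(i <- r | Q i) Y i t w).
Proof.
move=> XY; elim: r => [|i r IH]; first by apply: aeW => w t t0; rewrite !big_nil.
case: (boolP (Q i)) => Qi.
  by apply: filterS2 (XY i Qi) IH => w H H' t t0; rewrite !big_cons Qi H// H'.
by apply: filterS IH => w H t t0; rewrite !big_cons (negbTE Qi) H.
Qed.

End Cadlag.

(** * Predictable integrands and stochastic integrals *)

Section Predictable.
Context {d : measure_display} {Omega : measurableType d} {R : realType}.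
Variable F : R -> set (set Omega).
Hypothesis hF : filtration F.
Implicit Types (H K X Y : process R Omega) (C : set (R * Omega)).

Let D0 : set (R * Omega) := `[0, +oo[ `*` setT.

Definition predictable_sets : set (set (R * Omega)) :=
  <<s D0, predictable_rectangles F >>.

(* Trace of the predictable sigma-algebra, extended to R * Omega. *)
Definition predictable_trace : set (set (R * Omega)) :=
  [set C | predictable_sets (D0 `&` C)].

Lemma predictable_trace_sigma : sigma_algebra setT predictable_trace.
Proof.
have [p0 pD pU] := smallest_sigma_algebra D0 (predictable_rectangles F).
split; rewrite /predictable_trace /=.
- by rewrite setI0.
- move=> A /= /pD; rewrite (_ : D0 `\` (D0 `&` A) = D0 `&` (setT `\` A))//.
  by rewrite setDIr setDv set0U setTD setDE.
- by move=> A /= pA; rewrite setI_bigcupr; exact: pU.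
Qed.

Lemma predictableP H :
  predictable F H <-> sub_measurable predictable_trace (fun z => H z.1 z.2).
Proof. by []. Qed.

Lemma predictable_setsD0 C : predictable_sets C -> C `<=` D0.
Proof.
have : sigma_algebra D0 [set A | A `<=` D0].
  split=> [//=|A _ /= z []//|A AD z [n _]]; exact: AD.
move=> sD; apply: (smallest_sub sD) => A [[B FB ->]|[s [t [B [s0 st _ ->]]]]] [u w].
  by move=> [/= -> _]; split=> //=; rewrite in_itv/= lexx.
by move=> [/=]; rewrite in_itv/= => /andP[su _] _; split=> //=;
  rewrite in_itv/= (le_trans s0 (ltW su)).
Qed.

Lemma predictable_setsI C C' :
  predictable_sets C -> predictable_trace C' -> predictable_sets (C `&` C').
Proof.
move=> pC pC'.
have : predictable_trace (C `&` C').
  apply: (sub_sigma_setI predictable_trace_sigma) => //.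
  by rewrite /predictable_trace/= (setIidr (predictable_setsD0 pC)).
by rewrite /predictable_trace/= setIA (setIidr (predictable_setsD0 pC)).
Qed.

Definition indicator_process C : process R Omega := fun t w => \1_C (t, w).

Lemma predictable_trace_sets C : predictable_sets C -> predictable_trace C.
Proof.
by move=> pC; rewrite /predictable_trace/= (setIidr (predictable_setsD0 pC)).
Qed.

Lemma predictable_indicator C : predictable_trace C ->
  predictable F (indicator_process C).
Proof.
move=> pC; apply/predictableP.
have := sub_measurable_indic (R := R) predictable_trace_sigma pC.
by congr sub_measurable; apply/funext => -[].
Qed.

Lemma bounded_indicator C : bounded_process (indicator_process C).
Proof.
exists 1 => t w _; rewrite /indicator_process indicE.
by case: (_ \in _); rewrite /= ?normr1 ?normr0 ?lexx ?ler01.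
Qed.

Lemma predictable_cst (c : R) : predictable F (fun=> fun=> c).
Proof. by apply/predictableP; exact: (sub_measurable_cst predictable_trace_sigma). Qed.

Lemma predictableD H K : predictable F H -> predictable F K ->
  predictable F (fun t w => H t w + K t w).
Proof.
by move=> /predictableP pH /predictableP pK;
  exact: (sub_measurableD predictable_trace_sigma pH pK).
Qed.

Lemma predictableM H K : predictable F H -> predictable F K ->
  predictable F (fun t w => H t w * K t w).
Proof.
by move=> /predictableP pH /predictableP pK;
  exact: (sub_measurableM predictable_trace_sigma pH pK).
Qed.

Lemma predictableZ (c : R) H : predictable F H -> predictable F (fun t w => c * H t w).
Proof. by apply: predictableM; exact: predictable_cst. Qed.

Lemma bounded_process_cst (c : R) : bounded_process ((fun=> fun=> c) : process R Omega).
Proof. by exists `|c|. Qed.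

Lemma bounded_processD H K : bounded_process H -> bounded_process K ->
  bounded_process (fun t w => H t w + K t w).
Proof.
move=> [a Ha] [b Kb]; exists (a + b) => t w t0.
by apply: le_trans (ler_normD _ _) _; rewrite lerD ?Ha ?Kb.
Qed.

Lemma bounded_processM H K : bounded_process H -> bounded_process K ->
  bounded_process (fun t w => H t w * K t w).
Proof.
move=> [a Ha] [b Kb]; exists (a * b) => t w t0.
by rewrite normrM ler_pM ?Ha ?Kb.
Qed.

Lemma bounded_processZ (c : R) H : bounded_process H ->
  bounded_process (fun t w => c * H t w).
Proof. by apply: bounded_processM; exact: bounded_process_cst. Qed.

(** Puts the indicators of the generating rectangles into the form of the elementary integrands of
    [integral_operator]. *)
Lemma rectangle0E (A : set Omega) :
  indicator_process ([set 0] `*` A) = (fun t w => \1_A w * (t == 0)%:R).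
Proof.
apply/funext => t; apply/funext => w; rewrite /indicator_process indicE in_setX/= indicE.
by rewrite mulrC; case: eqP => [->|t0]; rewrite ?(mem_set (erefl : [set 0] 0))/= ?mul1r//
  memNset ?mul0r.
Qed.

Lemma rectangleE r s (A : set Omega) : indicator_process (`]r, s] `*` A) =
  (fun t w => \1_A w * ((r < t) && (t <= s))%:R).
Proof.
apply/funext => t; apply/funext => w; rewrite /indicator_process indicE in_setX/= indicE.
by rewrite mulrC mem_setE in_itv/= -natrM mulnb.
Qed.

Lemma predictable_rectangle0 f : sub_measurable (F 0) f ->
  predictable F (fun t w => f w * (t == 0)%:R).
Proof.
move=> mf.
have s0 := (hF.1 _ (lexx 0)).1.
have sT := predictable_trace_sigma.
move=> B mB.
have GA (A : set Omega) : F 0 A -> predictable_trace ([set 0] `*` A).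
  by move=> FA; apply: predictable_trace_sets; apply: sub_sigma_algebra; left; exists A.
suff : predictable_trace [set z : R * Omega | B (f z.2 * (z.1 == 0)%:R)] by [].
(* The process is 0 off {0} x Omega. Hence the preimage of [B], or its complement when [B] contains
   0, is a rectangle over a set of F_0. *)
have [B0|B0] := pselect (B 0).
  rewrite (_ : [set z | _] = ~` ([set 0] `*` (f @^-1` (~` B)))).
    apply: (sub_sigma_setC sT); apply: GA.
    by apply: mf; exact: measurableC.
  apply/seteqP; split=> -[t w] /=.
    by move=> Bf [t0 nB]; apply: nB; rewrite t0 eqxx mulr1 in Bf.
  by move=> /not_andP[/eqP/negbTE->|/contrapT]; [rewrite mulr0|case: eqP; rewrite ?mulr1 ?mulr0].
rewrite (_ : [set z | _] = [set 0] `*` (f @^-1` B)); first by apply: GA; exact: mf.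
apply/seteqP; split=> -[t w] /=; last by move=> [-> ?]; rewrite eqxx mulr1.
by case: eqP => [->|_]; rewrite ?mulr1// mulr0.
Qed.

Lemma predictable_rectangle f r s : 0 <= r -> r < s -> sub_measurable (F r) f ->
  predictable F (fun t w => f w * ((r < t) && (t <= s))%:R).
Proof.
move=> r0 rs mf B mB.
have sr := (hF.1 _ r0).1.
have sT := predictable_trace_sigma.
have GA (A : set Omega) : F r A -> predictable_trace (`]r, s] `*` A).
  by move=> FA; apply: predictable_trace_sets; apply: sub_sigma_algebra; right; exists r, s, A.
suff : predictable_trace [set z : R * Omega | B (f z.2 * ((r < z.1) && (z.1 <= s))%:R)] by [].
have [B0|B0] := pselect (B 0).
  rewrite (_ : [set z | _] = ~` (`]r, s] `*` (f @^-1` (~` B)))).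
    apply: (sub_sigma_setC sT); apply: GA.
    by apply: mf; exact: measurableC.
  apply/seteqP; split=> -[t w] /=; rewrite in_itv/=.
    by move=> Bf [t0 nB]; apply: nB; rewrite t0 mulr1 in Bf.
  by move=> /not_andP[/negP/negbTE->|/contrapT]; [rewrite mulr0|case: (_ && _);
    rewrite ?mulr1 ?mulr0].
rewrite (_ : [set z | _] = `]r, s] `*` (f @^-1` B)); first by apply: GA; exact: mf.
apply/seteqP; split=> -[t w] /=; rewrite in_itv/=; last by move=> [-> ?]; rewrite mulr1.
by case: (_ && _); rewrite ?mulr1// mulr0.
Qed.

End Predictable.

(** * Stopped and adapted processes *)

Section Stopped.
Context {d : measure_display} {Omega : measurableType d} {R : realType}.
Variable F : R -> set (set Omega).
Hypothesis hF : filtration F.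
Implicit Types (X Y : process R Omega) (tau : Omega -> \bar R).

Lemma stoppedE X tau t w r : tau w = r%:E -> stopped X tau t w = X (Num.min t r) w.
Proof. by move=> taur; rewrite /stopped taur -EFin_min. Qed.

Lemma cadlag_stopped X tau : cadlag X -> (forall w, (0 <= tau w)%E) ->
  cadlag (stopped X tau).
Proof.
move=> cX tau0 w; have [X1 X2] := cX w.
case E : (tau w) (tau0 w) => [r| |] //= r0; last first.
  have -> : (fun s => stopped X tau s w) = (fun s => X s w).
    by apply/funext => s; rewrite /stopped E miney.
  by split=> t t0; [rewrite /stopped E miney; exact: X1|exact: X2].
have -> : (fun s => stopped X tau s w) = (fun s => X (Num.min s r) w).
  by apply/funext => s; exact: stoppedE.
split=> t t0.
  rewrite (stoppedE _ _ E); have [tr|rt] := ltP t r.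
    apply: cvg_trans (X1 _ t0); apply: near_eq_cvg.
    by near=> s; rewrite min_l//; near: s; exact: nbhs_right_le.
  apply: cvg_near_cst.
  near=> s; rewrite min_r//; apply: le_trans rt _.
  by near: s; exact: nbhs_right_ge.
have [tr|rt'] := leP t r.
  apply/cvg_ex; have /cvg_ex[l Xl] := X2 _ t0; exists l.
  apply: cvg_trans Xl; apply: near_eq_cvg.
  near=> s; rewrite min_l//; apply: le_trans tr.
  by near: s; exact: nbhs_left_le.
apply/cvg_ex; exists (X r w).
apply: cvg_near_cst.
by near=> s; rewrite min_r//; near: s; exact: nbhs_left_ge.
Unshelve. all: by end_near. Qed.

Lemma cadlag_min X s : cadlag X -> 0 <= s -> cadlag (fun t w => X (Num.min s t) w).
Proof.
move=> cX s0.
have -> : (fun (t : R) (w : Omega) => X (Num.min s t) w) = stopped X (fun=> s%:E).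
  by apply/funext => t; apply/funext => w; rewrite /stopped -EFin_min minC.
exact: cadlag_stopped.
Qed.

Lemma adapted_lin (f g : Omega -> R) X Y : sub_measurable (F 0) f ->
  sub_measurable (F 0) g -> adapted F X -> adapted F Y ->
  adapted F (fun t w => f w * X t w + g w * Y t w).
Proof.
move=> mf mg aX aY t t0; have sG := (hF.1 _ t0).1.
have F0t := hF.2 _ _ (lexx 0) t0.
apply: sub_measurableD => //; apply: sub_measurableM => //.
- by move=> B mB; apply/F0t/mf.
- exact: aX.
- by move=> B mB; apply/F0t/mg.
- exact: aY.
Qed.

Lemma adapted_min X s : adapted F X -> 0 <= s ->
  adapted F (fun t w => X (Num.min s t) w).
Proof.
move=> aX s0 t t0 B mB; have m0 : 0 <= Num.min s t by rewrite le_min s0.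
by apply: hF.2 (aX _ m0 _ mB) => //; rewrite ge_min lexx orbT.
Qed.

Lemma sub_measurable_measurable (f : Omega -> R) t : 0 <= t -> sub_measurable (F t) f ->
  measurable_fun setT f.
Proof. by move=> t0 mf _ B mB; rewrite setTI; apply: (hF.1 _ t0).2; exact: mf. Qed.

Lemma adapted_measurable X t : 0 <= t -> adapted F X -> measurable_fun setT (X t).
Proof. by move=> t0 aX; exact: sub_measurable_measurable (t0) (aX _ t0). Qed.

End Stopped.

(** * Operators on bounded predictable integrands, without an integrator *)

Section RegularOperators.
Context {d : measure_display} {Omega : measurableType d} {R : realType}.
Variables (P : probability Omega R) (F : R -> set (set Omega)).
Hypothesis hF : filtration F.
Implicit Types (H K X Y : process R Omega) (J L : process R Omega -> process R Omega).

(** The part of [integral_operator] that does not mention the integrator. This class is stable under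
    combinations, multiplication of the integrand and stopping, so both sides of an identity between
    integrals belong to it. *)
Definition regular_operator J : Prop :=
  [/\ forall H, predictable F H -> bounded_process H ->
        adapted F (J H) /\ cadlag (J H),
      forall H K (a : R), predictable F H -> bounded_process H ->
        predictable F K -> bounded_process K ->
        indist P (J (fun t w => a * H t w + K t w))
               (fun t w => a * J H t w + J K t w) &
      forall (H : nat -> process R Omega) K (c : R),
        (forall n, predictable F (H n)) -> predictable F K ->
        (forall n t w, 0 <= t -> `|H n t w| <= c) ->
        (forall t w, 0 <= t -> H n t w @[n --> \oo] --> K t w) ->
        forall t, 0 <= t ->
          cvg0_in_probability P (fun n w => J (H n) t w - J K t w)].

Lemma integral_regular X J : integral_operator P F X J -> regular_operator J.
Proof. by case=> ? _ _ ? ?; split. Qed.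

Local Notation P0 := ((fun=> fun=> 0) : process R Omega).

Lemma predictable0 : predictable F P0. Proof. exact: (predictable_cst 0). Qed.
Lemma bounded_process0 : bounded_process P0. Proof. exact (bounded_process_cst 0). Qed.
Hint Resolve predictable0 bounded_process0 : core.

Lemma bounded_limit (H : nat -> process R Omega) K (c : R) :
  (forall n t w, 0 <= t -> `|H n t w| <= c) ->
  (forall t w, 0 <= t -> H n t w @[n --> \oo] --> K t w) -> bounded_process K.
Proof.
move=> Hc HK; exists c => t w t0.
have /cvg_norm := HK t w t0; move=> cvK.
by apply: (cvgr_to_le cvK); apply: nearW => n; exact: Hc.
Qed.

Section OneOperator.
Variable J : process R Omega -> process R Omega.
Hypothesis rJ : regular_operator J.

Lemma regular_adapted H : predictable F H -> bounded_process H -> adapted F (J H).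
Proof. by case: rJ => A _ _ pH bH; case: (A _ pH bH). Qed.

Lemma regular_cadlag H : predictable F H -> bounded_process H -> cadlag (J H).
Proof. by case: rJ => A _ _ pH bH; case: (A _ pH bH). Qed.

Lemma regular_lin (a : R) H K : predictable F H -> bounded_process H ->
  predictable F K -> bounded_process K ->
  indist P (J (fun t w => a * H t w + K t w)) (fun t w => a * J H t w + J K t w).
Proof. by case: rJ => _ A _ *; exact: A. Qed.

Lemma regular0 : indist P (J P0) P0.
Proof.
have := regular_lin 1 predictable0 bounded_process0 predictable0 bounded_process0.
rewrite (_ : (fun _ _ => _ + _) = P0); last first.
  by apply/funext => t; apply/funext => w; rewrite mulr0 add0r.
by apply: filterS => w H t t0; have := H t t0; rewrite mul1r; lra.
Qed.

Lemma regularZ (a : R) H : predictable F H -> bounded_process H ->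
  indist P (J (fun t w => a * H t w)) (fun t w => a * J H t w).
Proof.
move=> pH bH; have := regular_lin a pH bH predictable0 bounded_process0.
rewrite (_ : (fun t w => a * H t w + 0) = (fun t w => a * H t w)); last first.
  by apply/funext => t; apply/funext => w; rewrite addr0.
by apply: filterS2 (regular0) => w H0 E t t0; rewrite E// H0// addr0.
Qed.

Lemma regularD H K : predictable F H -> bounded_process H ->
  predictable F K -> bounded_process K ->
  indist P (J (fun t w => H t w + K t w)) (fun t w => J H t w + J K t w).
Proof.
move=> pH bH pK bK; have := regular_lin 1 pH bH pK bK.
rewrite (_ : (fun t w => 1 * H t w + K t w) = (fun t w => H t w + K t w)); last first.
  by apply/funext => t; apply/funext => w; rewrite mul1r.
by apply: filterS => w E t t0; rewrite E// mul1r.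
Qed.

Lemma predictable_bounded_sum n (H : nat -> process R Omega) :
  (forall k, predictable F (H k)) -> (forall k, bounded_process (H k)) ->
  predictable F (fun t w => \sum_(k < n) H k t w) /\
  bounded_process (fun t w => \sum_(k < n) H k t w).
Proof.
move=> pH bH; elim: n => [|n [IH1 IH2]].
  by under [X in predictable _ X /\ _]eq_fun do under eq_fun do rewrite big_ord0;
     under [X in bounded_process X]eq_fun do under eq_fun do rewrite big_ord0.
rewrite (_ : (fun _ _ => _) = (fun t w => \sum_(k < n) H k t w + H n t w)); last first.
  by apply/funext => t; apply/funext => w; rewrite big_ord_recr.
by split; [exact: predictableD|exact: bounded_processD].
Qed.

Lemma regular_sum n (H : nat -> process R Omega) :
  (forall k, predictable F (H k)) -> (forall k, bounded_process (H k)) ->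
  indist P (J (fun t w => \sum_(k < n) H k t w)) (fun t w => \sum_(k < n) J (H k) t w).
Proof.
move=> pH bH; elim: n => [|n IH].
  rewrite (_ : (fun _ _ => _) = P0); last first.
    by apply/funext => t; apply/funext => w; rewrite big_ord0.
  by apply: filterS regular0 => w E t t0; rewrite E// big_ord0.
rewrite (_ : (fun _ _ => _) = (fun t w => \sum_(k < n) H k t w + H n t w)); last first.
  by apply/funext => t; apply/funext => w; rewrite big_ord_recr.
have [p b] := predictable_bounded_sum n pH bH.
apply: filterS2 IH (regularD p b (pH n) (bH n)) => w E1 E2 t t0.
by rewrite E2// E1// big_ord_recr.
Qed.

Lemma regular_measurable H t : predictable F H -> bounded_process H -> 0 <= t ->
  measurable_fun setT (J H t).
Proof. by move=> pH bH t0; apply: (adapted_measurable hF t0); exact: regular_adapted. Qed.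

(** At each fixed time [J (H n) t - J K t] is a.s. the constant sequence [- J K t], and it tends to
    0 in probability; cadlag paths then give indistinguishability. *)
Lemma regular_limit0 (H : nat -> process R Omega) K (c : R) :
  (forall n, predictable F (H n)) -> predictable F K ->
  (forall n t w, 0 <= t -> `|H n t w| <= c) ->
  (forall t w, 0 <= t -> H n t w @[n --> \oo] --> K t w) ->
  (forall n, indist P (J (H n)) P0) -> indist P (J K) P0.
Proof.
move=> pH pK Hc HK H0.
have bH n : bounded_process (H n) by exists c => t w; exact: Hc.
have bK : bounded_process K := bounded_limit Hc HK.
apply: cadlag_indist; [exact: regular_cadlag|exact: cadlag0|] => t t0.
have mH n : measurable_fun setT (J (H n) t) by exact: regular_measurable.
have mK : measurable_fun setT (J K t) by exact: regular_measurable.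
apply: cvg0_in_probability_cst => //.
case: rJ => _ _ /(_ H K c pH pK Hc HK t t0) cv.
apply: (@cvg0_in_probability_dom _ _ _ P 1 0 _ _ _ _ _ _ _ _ _ cv cv) => //.
- by move=> n; exact: measurable_funB.
- by move=> n; exact: measurable_funB.
- move=> n; apply: filterS (H0 n) => w E.
  by rewrite E// sub0r normrN mul1r mul0r addr0.
Qed.

(** * Operators that vanish on predictable rectangles *)

Hypothesis J0 : forall A, F 0 A ->
  indist P (J (fun t w => \1_A w * (t == 0)%:R)) P0.
Hypothesis Jrs : forall r s A, 0 <= r -> r < s -> F r A ->
  indist P (J (fun t w => \1_A w * ((r < t) && (t <= s))%:R)) P0.

Lemma regular_rectangle_null C : predictable_rectangles F C ->
  indist P (J (indicator_process C)) P0.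
Proof.
by move=> [[A FA ->]|[r [s [A [r0 rs FA ->]]]]]; rewrite ?rectangle0E ?rectangleE;
  [exact: J0|exact: Jrs].
Qed.

Let D0 : set (R * Omega) := `[0, +oo[ `*` setT.

(** The half-line is the top element of the lambda-system below but not a rectangle; it is the limit
    of {0} x Omega together with ]0, n+1] x Omega. *)
Lemma regular_null_halfline : indist P (J (indicator_process D0)) P0.
Proof.
have s0 := (hF.1 _ (lexx 0)).1.
have FT : F 0 setT := sub_sigma_setT s0.
pose C n : set (R * Omega) := ([set 0] `*` setT) `|` (`]0, n.+1%:R] `*` setT).
have CE n t w : indicator_process (C n) t w = indicator_process ([set 0] `*` setT) t w
     + indicator_process (`]0, n.+1%:R] `*` setT) t w.
  rewrite /indicator_process /C !indicE in_setU !in_setX !in_setT !andbT/=.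
  rewrite mem_setE in_itv/= (_ : (t \in [set 0]) = (t == 0)).
    by case: eqP => [->|_]; rewrite ?ltxx ?addr0 ?add0r.
  by apply/idP/eqP; rewrite inE.
have pR n : predictable_rectangles F (`]0, n.+1%:R] `*` setT).
  by right; exists 0, n.+1%:R, setT; split.
have pR0 : predictable_rectangles F ([set 0] `*` setT) by left; exists setT.
have pI C' : predictable_rectangles F C' -> predictable F (indicator_process C').
  move=> rC; apply: predictable_indicator; apply: predictable_trace_sets.
  exact: sub_sigma_algebra.
have CE' n : indicator_process (C n) = (fun t w => indicator_process ([set 0] `*` setT) t w
     + indicator_process (`]0, n.+1%:R] `*` setT) t w).
  by apply/funext => t; apply/funext => w.
have pC n : predictable F (indicator_process (C n)).
  by rewrite CE'; apply: predictableD; exact: pI.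
have pD : predictable F (indicator_process D0).
  apply: predictable_indicator; rewrite /predictable_trace/= setIid.
  have [p0 pD pU] := smallest_sigma_algebra D0 (predictable_rectangles F).
  by rewrite -[X in predictable_sets _ X]setD0; exact: pD.
apply: (@regular_limit0 (fun n => indicator_process (C n)) _ 1) => //.
- move=> n t w _; rewrite /indicator_process indicE.
  by case: (_ \in _); rewrite /= ?normr1 ?normr0 ?lexx ?ler01.
- move=> t w t0; apply: cvg_near_cst; near=> n.
  have tn : t <= n.+1%:R.
    apply: le_trans (ltW (truncnS_gt t)) _; rewrite ler_nat ltnS.
    by near: n; exact: nbhs_infty_ge.
  rewrite CE /indicator_process !indicE !in_setX !in_setT !andbT/= !mem_setE !in_itv/= t0 tn
    andbT.
  rewrite (_ : (t \in [set 0]) = (t == 0)); last by apply/idP/eqP; rewrite inE.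
  move: t0; rewrite le_eqVlt => /predU1P[<-|lt]; first by rewrite eqxx ltxx addr0.
  by rewrite lt gt_eqF// add0r.
- move=> n; rewrite CE'.
  apply: indist_trans (regularD _ _ _ _) _; [exact: pI|exact: bounded_indicator|exact:
    pI|exact: bounded_indicator|].
  apply: filterS2 (regular_rectangle_null pR0) (regular_rectangle_null (pR n)) => w E1 E2 t t0.
  by rewrite E1// E2// addr0.
Unshelve. all: by end_near. Qed.

Lemma rectangles_setI : setI_closed (predictable_rectangles F).
Proof.
have s0 := (hF.1 _ (lexx 0)).1.
have F00 : F 0 set0 by case: s0.
(* Disjoint rectangles meet in the empty set, which counts as {0} times the empty set. *)
have e0 : predictable_rectangles F set0.
  by left; exists set0 => //; rewrite setX0.
move=> _ _ [[A FA ->]|[r [s [A [r0 rs FA ->]]]]] [[B FB ->]|[u [v [B [u0 uv FB ->]]]]].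
- by left; exists (A `&` B); [exact: sub_sigma_setI|rewrite -setXI setIid].
- rewrite -setXI (_ : [set 0] `&` `]u, v] = set0) ?set0X//.
  by apply/seteqP; split=> // x [/= xE]; rewrite xE in_itv/= ltNge u0.
- rewrite -setXI (_ : `]r, s] `&` [set 0] = set0) ?set0X//.
  by apply/seteqP; split=> // x [/= + xE]; rewrite xE in_itv/= ltNge r0.
- have E : `]r, s]%classic `&` `]u, v]%classic = `]Num.max r u, Num.min s v]%classic.
    apply/seteqP; split=> x /=; rewrite !in_itv/= gt_max le_min.
      by move=> [/andP[-> ->] /andP[-> ->]].
    by move=> /andP[/andP[-> ->] /andP[-> ->]].
  rewrite -setXI E.
  have [lt|ge] := ltP (Num.max r u) (Num.min s v); last first.
    by rewrite set_itv_ge ?set0X// -leNgt.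
  right; exists (Num.max r u), (Num.min s v), (A `&` B).
  have m0 : 0 <= Num.max r u by rewrite le_max r0.
  split=> //; apply: (sub_sigma_setI (hF.1 _ m0).1).
    by apply: hF.2 FA => //; rewrite le_max lexx.
  by apply: hF.2 FB => //; rewrite le_max lexx orbT.
Qed.

(** Pi-lambda argument: rectangles are stable under intersection, linearity handles proper
    differences, and dominated convergence with bound 1 handles increasing unions. *)
Lemma regular_indicator_null C : predictable_sets F C ->
  indist P (J (indicator_process C)) P0.
Proof.
have [p0 pD pU] := smallest_sigma_algebra D0 (predictable_rectangles F).
have pD0 : predictable_sets F D0.
  by rewrite -[X in predictable_sets _ X]setD0; exact: pD.
have pI C' : predictable_sets F C' -> predictable F (indicator_process C').
  by move=> rC; apply: predictable_indicator; exact: predictable_trace_sets.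
pose D := [set C | predictable_sets F C /\ indist P (J (indicator_process C)) P0].
suff : predictable_sets F `<=` D by move=> sD /sD[].
apply: (lambda_system_subset rectangles_setI); last 2 first.
- by move=> X rX; split; [exact: sub_sigma_algebra|exact: regular_rectangle_null].
- by move=> X; exact: predictable_setsD0.
split.
- by move=> A [pA _]; exact: (predictable_setsD0 pA).
- by split=> //; exact: regular_null_halfline.
- move=> A B BA [pA A0] [pB B0].
  have pAB : predictable_sets F (A `\` B).
    rewrite setDE; apply: predictable_setsI => //.
    apply: (sub_sigma_setC (predictable_trace_sigma F)); exact: predictable_trace_sets.
  split => //.
  rewrite (_ : indicator_process _ = (fun t w
    => -1 * indicator_process B t w + indicator_process A t w)).
    apply: indist_trans (regular_lin _ _ _ _ _) _;
      [exact: pI|exact: bounded_indicator|exact: pI|exact: bounded_indicator|].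
    by apply: filterS2 A0 B0 => w E1 E2 t t0; rewrite E1// E2// mulr0 addr0.
  apply/funext => t; apply/funext => w; rewrite /indicator_process !indicE in_setD.
  have [/set_mem /BA /mem_set ->|nB] := boolP ((t, w) \in B).
    by rewrite /= mulr1 addNr.
  by rewrite /= andbT mulr0 add0r.
- move=> C' ndC DC.
  have pC n : predictable_sets F (C' n) by case: (DC n).
  have pUC : predictable_sets F (\bigcup_n C' n) by exact: pU.
  split => //.
  apply: (@regular_limit0 (fun n => indicator_process (C' n)) _ 1).
  + by move=> n; exact: pI.
  + exact: pI.
  + move=> n t w _; rewrite /indicator_process indicE.
    by case: (_ \in _); rewrite /= ?normr1 ?normr0 ?lexx ?ler01.
  + move=> t w t0.
    apply: cvg_near_cst; rewrite /indicator_process.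
    have [[N _ CN]|nC] := pselect ((\bigcup_n C' n) (t, w)).
      near=> n; rewrite !indicE !mem_set//; first by exists N.
      have /subsetPset : (C' N <= C' n)%O by apply: ndC; near: n; exact: nbhs_infty_ge.
      exact.
    near=> n; rewrite !indicE !memNset// => Cn; apply: nC; by exists n.
  + by move=> n; case: (DC n).
Unshelve. all: by end_near. Qed.

(* The sum counts the k with k.+1 <= x, so it is the floor of x in [0, n]. *)
Lemma sum_floor (x : R) n : 0 <= x <= n%:R ->
  x - 1 <= \sum_(k < n) (k.+1%:R <= x)%R%:R <= x.
Proof.
move=> /andP[x0 xn]; have /andP[fx xf] := truncn_itv x0.
have E : \sum_(k < n) (k.+1%:R <= x)%R%:R = (Num.truncn x)%:R :> R.
  have le : (Num.truncn x <= n)%N by rewrite -(ler_nat R) (le_trans fx).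
  under eq_bigr do rewrite -truncn_gt_nat.
  rewrite -natr_sum; congr _%:R.
  transitivity (\sum_(k < n | (k < Num.truncn x)%N) 1)%N.
    by rewrite [RHS]big_mkcond; apply: eq_bigr => k _; case: ltnP.
  by rewrite -(big_ord_widen _ (fun=> 1)%N le) sum1_card card_ord.
by rewrite E fx andbT lerBlDr -natr1 in xf *; exact: ltW.
Qed.

(** A bounded [H] is a uniform limit of finite combinations of indicators of its level sets: with
    mesh 2b/(n+1) the number of levels reached by [H + b] is a floor, so the error is at most one
    mesh. *)
Lemma regular_null H : predictable F H -> bounded_process H -> indist P (J H) P0.
Proof.
(* The shift by [b] brings [H + b] into [0, 2b]; the [+ 1] keeps the mesh positive. *)
move=> pH [c Hc]; pose b := `|c| + 1.
have b0 : 0 < b by rewrite /b ltr_wpDl.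
have Hb t w : 0 <= t -> 0 <= H t w + b <= 2 * b.
  move=> t0; have := Hc t w t0; rewrite ler_norml => /andP[h1 h2].
  by have := ler_norm c; rewrite /b; lra.
have sT := predictable_trace_sigma F.
have [p0 pD pU] := smallest_sigma_algebra D0 (predictable_rectangles F).
pose C n k : set (R * Omega) := D0 `&` [set z | 2 * b / n.+1%:R * k.+1%:R - b <= H z.1 z.2].
have pC n k : predictable_sets F (C n k).
  exact: (sub_measurable_le sT (sub_measurable_cst sT _) pH).
have pD0 : predictable_sets F D0.
  by rewrite -[X in predictable_sets _ X]setD0; exact: pD.
have pI C' : predictable_sets F C' -> predictable F (indicator_process C').
  by move=> rC; apply: predictable_indicator; exact: predictable_trace_sets.
(* The last term undoes the shift: on t >= 0 the indicator of [D0] is 1. *)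
pose G n : process R Omega := fun t w =>
  2 * b / n.+1%:R * (\sum_(k < n.+1) indicator_process (C n k) t w)
  + (- b) * indicator_process D0 t w.
have pbS n := predictable_bounded_sum n.+1 (fun k => pI _ (pC n k)) (fun k
  => bounded_indicator (C n k)).
have GE n t w : 0 <= t -> `|G n t w - H t w| <= 2 * b / n.+1%:R.
  move=> t0; pose x := (H t w + b) / (2 * b / n.+1%:R).
  have u0 : 0 < 2 * b / n.+1%:R by rewrite divr_gt0// mulr_gt0.
  have HE : H t w = 2 * b / n.+1%:R * x - b by rewrite /x mulrC divfK ?gt_eqF// addrK.
  have D0t : indicator_process D0 t w = 1.
    by rewrite /indicator_process indicE mem_set//; split=> //=; rewrite in_itv/= t0.
  have CE k : indicator_process (C n k) t w = (k.+1%:R <= x)%R%:R.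
    rewrite /indicator_process indicE; congr _%:R; congr nat_of_bool.
    rewrite /x ler_pdivlMr// [_ * (_ / _)]mulrC -lerBlDr.
    by apply/idP/idP => [/set_mem[]//|le]; apply/mem_set; split=> //; split=> //=;
      rewrite in_itv/= t0.
  have /sum_floor/andP[] : 0 <= x <= n.+1%:R.
    have /andP[h1 h2] := Hb t w t0.
    rewrite /x divr_ge0 ?(ltW u0)//= ler_pdivrMr//.
    by rewrite [leRHS]mulrC divfK.
  rewrite /G D0t mulr1 HE; under [in X in _ -> _ -> X]eq_bigr do rewrite CE.
  set S := \sum_(_ < _) _ => S1 S2.
  rewrite (_ : _ - _ = 2 * b / n.+1%:R * (S - x)); last by ring.
  rewrite normrM gtr0_norm// ler_piMr ?(ltW u0)//.
  by rewrite ler_norml; apply/andP; split; lra.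
apply: (@regular_limit0 G _ (`|c| + 2 * b)) => //.
- move=> n; apply: predictableD; apply: predictableZ; [exact: (pbS n).1|exact: pI].
- move=> n t w t0; have -> : G n t w = H t w + (G n t w - H t w) by ring.
  apply: le_trans (ler_normD _ _) _; rewrite lerD//.
    by apply: le_trans (Hc _ _ t0) _; exact: ler_norm.
  apply: le_trans (GE _ _ _ t0) _.
  by rewrite ler_pdivrMr// ler_peMr ?mulr_ge0 ?(ltW b0)// ler1n.
- move=> t w t0; apply/cvgrPdist_le => e e0; near=> n.
  rewrite distrC; apply: le_trans (GE _ _ _ t0) _.
  rewrite ler_pdivrMr// -ler_pdivrMl//; apply/ltW.
  apply: lt_le_trans (truncnS_gt _) _; rewrite ler_nat ltnS.
  by near: n; exact: nbhs_infty_ge.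
- move=> n.
  have [p1 b1] := pbS n.
  apply: indist_trans (regularD _ _ _ _) _.
  + exact: predictableZ.
  + exact: bounded_processZ.
  + by apply: predictableZ; exact: pI.
  + by apply: bounded_processZ; exact: bounded_indicator.
  have Z1 := regularZ (2 * b / n.+1%:R) p1 b1.
  have Z2 := regularZ (- b) (pI _ pD0) (bounded_indicator D0).
  have Z3 := regular_sum n.+1 (fun k => pI _ (pC n k)) (fun k => bounded_indicator (C n k)).
  have Z4 := regular_indicator_null pD0.
  have Z5 : {ae P, forall w, forall k t, 0 <= t -> J (indicator_process (C n k)) t w = 0}.
    by apply: ae_foralln => k; exact: regular_indicator_null (pC n k).
  near=> w => t t0.
  rewrite (near Z1 w)// (near Z2 w)// (near Z3 w)// (near Z4 w)// mulr0 addr0.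
  by rewrite big1 ?mulr0// => k _; rewrite (near Z5 w).
Unshelve. all: by end_near. Qed.

End OneOperator.
End RegularOperators.

(** * Closure properties and uniqueness of regular operators *)

Section RegularClosure.
Context {d : measure_display} {Omega : measurableType d} {R : realType}.
Variables (P : probability Omega R) (F : R -> set (set Omega)).
Hypothesis hF : filtration F.
Implicit Types (H K X Y : process R Omega) (J L : process R Omega -> process R Omega).

Local Notation P0 := ((fun=> fun=> 0) : process R Omega).
Local Notation regular := (regular_operator P F).

Lemma regular_combination (f g : Omega -> R) L1 L2 :
  sub_measurable (F 0) f -> (exists c, forall w, `|f w| <= c) ->
  sub_measurable (F 0) g -> (exists c, forall w, `|g w| <= c) ->
  regular L1 -> regular L2 ->
  regular (fun H t w => f w * L1 H t w + g w * L2 H t w).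
Proof.
move=> mf [cf fc] mg [cg gc] r1 r2.
have w0 : Omega := point.
have cf0 : 0 <= cf := le_trans (normr_ge0 _) (fc w0).
have cg0 : 0 <= cg := le_trans (normr_ge0 _) (gc w0).
have mf' := sub_measurable_measurable hF (lexx 0) mf.
have mg' := sub_measurable_measurable hF (lexx 0) mg.
split.
- move=> H pH bH; split.
    by apply: adapted_lin => //; [exact: (regular_adapted r1)|exact: (regular_adapted r2)].
  by apply: cadlag_lin; [exact: (regular_cadlag r1)|exact: (regular_cadlag r2)].
- move=> H K a pH bH pK bK.
  apply: filterS2 (regular_lin r1 a pH bH pK bK) (regular_lin r2 a pH bH pK bK) => w E1 E2 t t0.
  by rewrite E1// E2//; ring.
- move=> H K c pH pK Hc HK t t0.
  have bK : bounded_process K := bounded_limit Hc HK.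
  have bH n : bounded_process (H n) by exists c => u w; exact: Hc.
  have m1 H' (p : predictable F H') (b : bounded_process H') := regular_measurable hF r1 p b t0.
  have m2 H' (p : predictable F H') (b : bounded_process H') := regular_measurable hF r2 p b t0.
  case: r1 r2 => _ _ /(_ H K c pH pK Hc HK t t0) c1 [_ _ /(_ H K c pH pK Hc HK t t0) c2].
  apply: (@cvg0_in_probability_dom _ _ _ P cf cg _ _ _ _ _ _ _ _ _ c1 c2) => //.
  + by move=> n; apply: measurable_funB; exact: m1.
  + by move=> n; apply: measurable_funB; exact: m2.
  + by move=> n; apply: measurable_funB; apply: measurable_funD; apply: measurable_funM => //;
      (exact: m1 || exact: m2).
  + move=> n; apply: aeW => w.
    rewrite (_ : _ - _ = f w * (L1 (H n) t w - L1 K t w) + g w * (L2 (H n) t w - L2 K t w));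
      last by ring.
    by apply: le_trans (ler_normD _ _) _; rewrite !normrM lerD// ler_wpM2r.
Qed.

Lemma bounded_fun_cst (c : R) : exists c', forall w : Omega, `|c| <= c'.
Proof. by exists `|c|. Qed.

Lemma regular_combination_cst (a b : R) L1 L2 : regular L1 -> regular L2 ->
  regular (fun H t w => a * L1 H t w + b * L2 H t w).
Proof.
have s0 := (hF.1 _ (lexx 0)).1.
by apply: (@regular_combination (fun=> a) (fun=> b));
   (exact: sub_measurable_cst || exact: bounded_fun_cst).
Qed.

Lemma regular_operator0 : regular (fun=> P0).
Proof.
split.
- move=> H _ _; split; last exact: cadlag0.
  by move=> t t0; exact: (sub_measurable_cst (hF.1 _ t0).1).
- by move=> H K a _ _ _ _; apply: aeW => w t t0; rewrite mulr0 addr0.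
- move=> H K c _ _ _ _ t t0 e e0.
  rewrite (_ : (fun=> _) = (fun=> 0%E)); first exact: cvg_cst.
  apply/funext => n; rewrite -[RHS](measure0 P); congr (P _).
  by apply/seteqP; split=> // w /=; rewrite subrr normr0 leNgt e0.
Qed.

Lemma regular_big (I : eqType) (r : seq I) (L : I -> process R Omega -> process R Omega) :
  (forall i, i \in r -> regular (L i)) ->
  regular (fun H t w => \sum_(i <- r) L i H t w).
Proof.
elim: r => [|i r IH] rL.
  rewrite (_ : (fun _ _ _ => _) = (fun=> P0)); first exact: regular_operator0.
  by apply/funext => H; apply/funext => t; apply/funext => w; rewrite big_nil.
rewrite (_ : (fun _ _ _ => _) =
  (fun H t w => 1 * L i H t w + 1 * (\sum_(j <- r) L j H t w))); last first.
  by apply/funext => H; apply/funext => t; apply/funext => w; rewrite big_cons !mul1r.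
apply: regular_combination_cst; first by apply: rL; rewrite mem_head.
by apply: IH => j jr; apply: rL; rewrite in_cons jr orbT.
Qed.

(** Turns (H K) . X into an operator in [H]; the bound on [K] preserves domination. *)
Lemma regular_mul J K : predictable F K -> bounded_process K -> regular J ->
  regular (fun H => J (fun t w => H t w * K t w)).
Proof.
move=> pK bK rJ; split.
- move=> H pH bH; split; [apply: (regular_adapted rJ)|apply: (regular_cadlag rJ)];
    by [exact: predictableM|exact: bounded_processM].
- move=> H H' a pH bH pH' bH'.
  rewrite (_ : (fun t w => (a * H t w + H' t w) * K t w) =
     (fun t w => a * (H t w * K t w) + H' t w * K t w)).
    by apply: (regular_lin rJ); by [exact: predictableM|exact: bounded_processM].
  by apply/funext => t; apply/funext => w; ring.
- move=> H H' c pH pH' Hc HH' t t0; case: rJ => _ _; case: bK => cK Kc.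
  apply => //.
  + by move=> n; exact: predictableM.
  + exact: predictableM.
  + by move=> n u w u0; rewrite normrM; apply: ler_pM (Hc n u w u0) (Kc u w u0).
  + by move=> u w u0; apply: cvgM; [exact: HH'|exact: cvg_cst].
Qed.

(** This is the right-hand side of [integral_rectangle_mul], seen as an operator in its
    integrand. *)
Lemma regular_stop J (f : Omega -> R) r s : 0 <= r -> r <= s ->
  sub_measurable (F r) f -> (exists c, forall w, `|f w| <= c) -> regular J ->
  regular (fun H t w => f w * (J H (Num.min s t) w - J H (Num.min r t) w)).
Proof.
move=> r0 rs mf [cf fc] rJ.
have w0 : Omega := point.
have cf0 : 0 <= cf := le_trans (normr_ge0 _) (fc w0).
have s0 := le_trans r0 rs.
have mf' := sub_measurable_measurable hF r0 mf.
split.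
- move=> H pH bH; have cJ := regular_cadlag rJ pH bH; have aJ := regular_adapted rJ pH bH.
  split; last first.
    rewrite (_ : (fun _ _ => _) = (fun t w => f w * J H (Num.min s t) w
       + (- f w) * J H (Num.min r t) w)).
      by apply: cadlag_lin; exact: cadlag_min.
    by apply/funext => t; apply/funext => w; ring.
  move=> t t0; have sG := (hF.1 _ t0).1.
  (* For t <= r the increment vanishes, so it is enough that [f] is known at time [r]. *)
  have [tr|rt] := leP t r.
    rewrite (_ : (fun w => _) = (fun=> 0)); first exact: sub_measurable_cst.
    apply/funext => w; rewrite (min_r (le_trans tr rs)).
    by rewrite subrr mulr0.
  apply: (sub_measurableM sG).
    by move=> B mB; apply: hF.2 (mf B mB) => //; exact: ltW.
  by apply: (sub_measurableB sG);
    [apply: (@adapted_min _ _ _ F hF _ s)|rewrite -(min_l (ltW rt));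
      apply: (@adapted_min _ _ _ F hF _ r)].
- move=> H K a pH bH pK bK.
  apply: filterS (regular_lin rJ a pH bH pK bK) => w E t t0.
  by rewrite !E ?le_min ?r0 ?s0//; ring.
- move=> H K c pH pK Hc HK t t0.
  have bK : bounded_process K := bounded_limit Hc HK.
  have bH n : bounded_process (H n) by exists c => u w; exact: Hc.
  have ms0 : 0 <= Num.min s t by rewrite le_min s0.
  have mr0 : 0 <= Num.min r t by rewrite le_min r0.
  have m1 u H' (u0 : 0 <= u) (p : predictable F H') (b : bounded_process H') :=
    regular_measurable hF rJ p b u0.
  case: rJ => _ _ /(_ H K c pH pK Hc HK) cv.
  apply: (@cvg0_in_probability_dom _ _ _ P cf cf _ _ _ _ _ _ _ _ _ (cv _ ms0) (cv _ mr0)) => //.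
  + by move=> n; apply: measurable_funB; exact: m1.
  + by move=> n; apply: measurable_funB; exact: m1.
  + move=> n; apply: measurable_funB; apply: measurable_funM => //;
      by apply: measurable_funB; exact: m1.
  + move=> n; apply: aeW => w; set a := Num.min s t; set b := Num.min r t.
    rewrite (_ : _ - _ = f w * ((J (H n) a w - J K a w) - (J (H n) b w - J K b w))); last by ring.
    rewrite normrM -mulrDr ler_pM//.
    exact: ler_normB.
Qed.

(** The difference of the two operators is regular and vanishes on rectangles, hence on every
    bounded predictable integrand. The identities between integrals below are checked on rectangles
    through this lemma. *)
Lemma regular_unique L1 L2 : regular L1 -> regular L2 ->
  (forall A, F 0 A -> indist P (L1 (fun t w => \1_A w * (t == 0)%:R))
                               (L2 (fun t w => \1_A w * (t == 0)%:R))) ->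
  (forall r s A, 0 <= r -> r < s -> F r A ->
    indist P (L1 (fun t w => \1_A w * ((r < t) && (t <= s))%:R))
             (L2 (fun t w => \1_A w * ((r < t) && (t <= s))%:R))) ->
  forall H, predictable F H -> bounded_process H -> indist P (L1 H) (L2 H).
Proof.
move=> r1 r2 E0 Ers H pH bH.
have rL := regular_combination_cst 1 (-1) r1 r2.
have : indist P (fun t w => 1 * L1 H t w + -1 * L2 H t w) P0.
  apply: (regular_null hF rL) pH bH => [A FA|r s A r0 rs FA].
    by apply: filterS (E0 A FA) => w E t t0; rewrite E//; ring.
  by apply: filterS (Ers r s A r0 rs FA) => w E t t0; rewrite E//; ring.
by apply: filterS => w E t t0; have := E t t0; rewrite mul1r mulN1r; lra.
Qed.

(** That an operator ignores the junk values at negative times is not part of the specification; it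
    follows from dominated convergence along the constant sequence 0, which converges to [H] on t >=
    0. *)
Lemma regular_ext0 J H : regular J -> predictable F H ->
  (forall t w, 0 <= t -> H t w = 0) -> indist P (J H) P0.
Proof.
move=> rJ pH H0.
apply: (@regular_limit0 _ _ _ P F hF J rJ (fun=> P0) H 0) => //.
- by move=> _; exact: predictable_cst.
- by move=> n t w t0; rewrite normr0.
- by move=> t w t0; rewrite H0//; exact: cvg_cst.
- by move=> _; exact: (regular0 rJ).
Qed.

Lemma regular_ext J H K : regular J -> predictable F H -> bounded_process H ->
  predictable F K -> (forall t w, 0 <= t -> H t w = K t w) -> indist P (J H) (J K).
Proof.
move=> rJ pH [c Hc] pK HK.
have bH : bounded_process H by exists c.
have bK : bounded_process K by exists c => t w t0; rewrite -HK// Hc.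
have bN : bounded_process (fun t w => -1 * K t w) by exact: bounded_processZ.
have pN : predictable F (fun t w => -1 * K t w) by exact: predictableZ.
have D0 : indist P (J (fun t w => H t w + -1 * K t w)) P0.
  apply: regular_ext0 => //; first exact: predictableD.
  by move=> t w t0; rewrite HK//; ring.
apply: filterS3 D0 (regularD rJ pH bH pN bN) (regularZ rJ (-1) pK bK) => w e3 e2 e1 t t0.
by have := e3 t t0; rewrite e2// e1// mulN1r => /subr0_eq.
Qed.

End RegularClosure.

(** * Identities for integrals of bounded integrands *)

Section IntegralOperators.
Context {d : measure_display} {Omega : measurableType d} {R : realType}.
Variables (P : probability Omega R) (F : R -> set (set Omega)).
Hypothesis hF : filtration F.
Implicit Types (H K X Y : process R Omega) (J L : process R Omega -> process R Omega).

Local Notation P0 := ((fun=> fun=> 0) : process R Omega).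
Local Notation regular := (regular_operator P F).

Lemma bounded_indic (A : set Omega) : exists c : R, forall w, `|\1_A w| <= c.
Proof.
by exists 1 => w; rewrite indicE; case: (_ \in _); rewrite /= ?normr1 ?normr0 ?lexx ?ler01.
Qed.

Lemma bounded_funM (f g : Omega -> R) : (exists c, forall w, `|f w| <= c) ->
  (exists c, forall w, `|g w| <= c) -> exists c, forall w, `|f w * g w| <= c.
Proof. by move=> [a fa] [b gb]; exists (a * b) => w; rewrite normrM ler_pM. Qed.

(** Identifies the operators that two strategies bring along for the same asset; both have the same
    explicit values on rectangles. *)
Lemma integral_unique X J J' : integral_operator P F X J ->
  integral_operator P F X J' ->
  forall H, predictable F H -> bounded_process H -> indist P (J H) (J' H).
Proof.
move=> iJ iJ'; have rJ := integral_regular iJ; have rJ' := integral_regular iJ'.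
case: iJ iJ' => _ J0 Jrs _ _ [_ J0' Jrs' _ _].
apply: (regular_unique hF rJ rJ') => [A FA|r s A r0 rs FA].
  have mA := sub_measurable_indic (R := R) (hF.1 _ (lexx 0)).1 FA.
  apply: indist_trans (J0 _ mA (bounded_indic A)) _.
  exact/indist_sym/(J0' _ mA (bounded_indic A)).
have mA := sub_measurable_indic (R := R) (hF.1 _ r0).1 FA.
apply: indist_trans (Jrs _ _ _ r0 rs mA (bounded_indic A)) _.
exact/indist_sym/(Jrs' _ _ _ r0 rs mA (bounded_indic A)).
Qed.

(** With [f] fixed, the left-hand side is a regular operator in [K]. At the indicator of {0} x A the
    product is again elementary, with integral 0; at that of ]r, s] x A the product is 0. *)
Lemma integral_rectangle0_mul X J (f : Omega -> R) K :
  integral_operator P F X J ->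
  sub_measurable (F 0) f -> (exists c, forall w, `|f w| <= c) ->
  predictable F K -> bounded_process K ->
  indist P (J (fun t w => f w * (t == 0)%:R * K t w)) P0.
Proof.
move=> iJ mf bf pK bK; have rJ := integral_regular iJ.
have pf := predictable_rectangle0 hF mf.
have bf' : bounded_process (fun t w => f w * (t == 0)%:R).
  case: bf => c fc; exists c => t w _; rewrite normrM; case: eqP; rewrite ?normr1 ?mulr1//.
  by rewrite normr0 mulr0 (le_trans _ (fc w)).
rewrite (_ : (fun t w => _) = (fun t w => K t w * (f w * (t == 0)%:R))); last first.
  by apply/funext => t; apply/funext => w; rewrite mulrC.
apply: (regular_null hF (regular_mul pf bf' rJ)) pK bK => [A FA|r s A r0 rs FA].
  have mA := sub_measurable_indic (R := R) (hF.1 _ (lexx 0)).1 FA.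
  rewrite (_ : (fun t w => _) = (fun t w => \1_A w * f w * (t == 0)%:R)).
    case: iJ => _ J0 _ _ _; apply: J0; first exact: (sub_measurableM (hF.1 _ (lexx 0)).1).
    by apply: bounded_funM => //; exact: bounded_indic.
  by apply/funext => t; apply/funext => w; case: eqP; rewrite ?mulr1 ?mulr0.
rewrite (_ : (fun t w => _) = P0); first exact: (regular0 rJ).
apply/funext => t; apply/funext => w; case: eqP => [->|]; last by rewrite !mulr0.
by rewrite ltNge r0 mulr0 mul0r.
Qed.

(** Both sides are regular operators in [K], and on rectangles each is an explicit increment of
    [X]. *)
Lemma integral_rectangle_mul X J (f : Omega -> R) r s K :
  integral_operator P F X J -> 0 <= r -> r < s ->
  sub_measurable (F r) f -> (exists c, forall w, `|f w| <= c) ->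
  predictable F K -> bounded_process K ->
  indist P (J (fun t w => f w * ((r < t) && (t <= s))%:R * K t w))
    (fun t w => f w * (J K (Num.min s t) w - J K (Num.min r t) w)).
Proof.
move=> iJ r0 rs mf bf pK bK; have rJ := integral_regular iJ.
have s0 : 0 <= s := le_trans r0 (ltW rs).
have pf := predictable_rectangle hF r0 rs mf.
have bf' : bounded_process (fun t w => f w * ((r < t) && (t <= s))%:R).
  case: bf => c fc; exists c => t w _; rewrite normrM; case: (_ && _); rewrite ?normr1 ?mulr1//.
  by rewrite normr0 mulr0 (le_trans _ (fc w)).
rewrite (_ : (fun t w => _ * _ * _) = (fun t w => K t w * (f w * ((r < t) && (t <= s))%:R)));
  last first.
  by apply/funext => t; apply/funext => w; rewrite mulrC.
apply: (regular_unique hF (regular_mul pf bf' rJ) (regular_stop hF r0 (ltW rs) mf bf rJ)) pK bK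
  => [A FA|u v A u0 uv FA].
  have mA := sub_measurable_indic (R := R) (hF.1 _ (lexx 0)).1 FA.
  rewrite (_ : (fun t w => _ * (f w * _)) = P0).
    case: iJ => _ J0 _ _ _.
    apply: filterS2 (regular0 rJ) (J0 _ mA (bounded_indic A)) => w E1 E2 t t0.
    by rewrite E1// !E2 ?le_min ?s0 ?r0// subrr mulr0.
  apply/funext => t; apply/funext => w; case: eqP => [->|]; last by rewrite mulr0 mul0r.
  by rewrite ltNge r0 !mulr0.
have mA := sub_measurable_indic (R := R) (hF.1 _ u0).1 FA.
case: iJ => _ _ Jrs _ _.
have E1 := Jrs _ _ _ u0 uv mA (bounded_indic A).
(* The product of the two indicators lives on ]max r u, min s v]. If this interval is empty, one of
   the two intervals precedes the other and the increments on the right-hand side cancel. *)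
have [lt|ge] := ltP (Num.max r u) (Num.min s v).
  rewrite (_ : (fun t w => _ * (f w * _)) = (fun t w => (\1_A w * f w) *
      ((Num.max r u < t) && (t <= Num.min s v))%:R)); last first.
    apply/funext => t; apply/funext => w; rewrite gt_max le_min.
    by case: (r < t); case: (u < t); case: (t <= s); case: (t <= v); rewrite /= ?(mulr0, mul0r,
      mulr1).
  have m0 : 0 <= Num.max r u by rewrite le_max r0.
  have mAf : sub_measurable (F (Num.max r u)) (fun w => \1_A w * f w).
    apply: (sub_measurableM (hF.1 _ m0).1) => B mB.
      by apply: hF.2 (mA B mB) => //; rewrite le_max lexx orbT.
    by apply: hF.2 (mf B mB) => //; rewrite le_max lexx.
  have E2 := Jrs _ _ _ m0 lt mAf (bounded_funM (bounded_indic A) bf).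
  apply: filterS2 E1 E2 => w e1 e2 t t0.
  rewrite e2// !e1 ?le_min ?s0 ?r0//.
  move: lt; rewrite gt_max !lt_min => /andP[/andP[_ rv] /andP[us _]].
  rewrite !minA [Num.min v s]minC (min_l (ltW us)) (min_r (ltW rv)).
  have [ru|ur] := leP r u; rewrite ?(min_r ru) ?(min_l (ltW ur)); ring.
rewrite (_ : (fun t w => _ * (f w * _)) = P0); last first.
  apply/funext => t; apply/funext => w.
  case: (boolP ((r < t) && (t <= s))) => [/andP[rt ts]|_]; last by rewrite !mulr0.
  case: (boolP ((u < t) && (t <= v))) => [/andP[ut tv]|_]; last by rewrite mulr0 mul0r.
  have : Num.max r u < Num.min s v.
    by rewrite (@lt_le_trans _ _ t)// ?gt_max ?le_min ?rt ?ut ?ts ?tv.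
  by rewrite ltNge ge.
apply: filterS2 (regular0 rJ) E1 => w e0 e1 t t0.
rewrite e0// !e1 ?le_min ?s0 ?r0// !minA.
move: ge; rewrite ge_min !le_max (leNgt s r) rs (leNgt v u) uv/= orbF => /orP[su|vr].
  have vs := le_trans su (ltW uv); have ru := le_trans (ltW rs) su.
  rewrite (min_r vs) (min_r su) (min_r (le_trans ru (ltW uv))) (min_r ru).
  by ring.
have vs := le_trans vr (ltW rs).
rewrite (min_l vs) (min_l (le_trans (ltW uv) vs)) (min_l vr) (min_l (le_trans (ltW uv) vr)).
by ring.
Qed.

(* H . (K . Y) = (H K) . Y when K . Y is a sum of integrals. *)
Lemma integral_assoc (I : eqType) (r : seq I) (S : I -> process R Omega)
    (J : I -> process R Omega -> process R Omega)
    Y (JY : process R Omega -> process R Omega) K (D : I -> process R Omega) :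
  (forall i, i \in r -> integral_operator P F (S i) (J i)) ->
  integral_operator P F Y JY ->
  predictable F K -> bounded_process K ->
  (forall i, i \in r -> predictable F (D i) /\ bounded_process (D i)) ->
  indist P (JY K) (fun t w => \sum_(i <- r) J i (D i) t w) ->
  forall H, predictable F H -> bounded_process H ->
  indist P (JY (fun t w => H t w * K t w))
    (fun t w => \sum_(i <- r) J i (fun s v => H s v * D i s v) t w).
Proof.
move=> iJ iY pK bK pD E.
have rL2 : regular (fun H t w => \sum_(i <- r) J i (fun s v => H s v * D i s v) t w).
  apply: (regular_big hF (L := fun i H => J i (fun s v => H s v * D i s v))) => i ir.
  by apply: regular_mul; [exact: (pD i ir).1|exact: (pD i ir).2|exact: integral_regular (iJ i
    ir)].
apply: (regular_unique hF (regular_mul pK bK (integral_regular iY)) rL2) => [A FA|u v A u0 uv FA].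
  have mA := sub_measurable_indic (R := R) (hF.1 _ (lexx 0)).1 FA.
  apply: indist_trans (integral_rectangle0_mul iY mA (bounded_indic A) pK bK) _.
  have : indist P (fun t w => \sum_(i <- r) J i (fun s v => \1_A v * (s == 0)%:R * D i s v) t w)
      (fun t w => \sum_(i <- r) 0).
    rewrite big_seq; under eq_fun do under eq_fun do rewrite big_seq.
    apply: (@indist_sum _ _ _ P _ _ _ _ (fun=> P0)) => i ir.
    by apply: integral_rectangle0_mul (iJ i ir) _ _ _ _ => //;
      [exact: bounded_indic|exact: (pD i ir).1|exact: (pD i ir).2].
  by apply: filterS => w E' t t0; rewrite E'// big1.
have mA := sub_measurable_indic (R := R) (hF.1 _ u0).1 FA.
apply: indist_trans (integral_rectangle_mul iY u0 uv mA (bounded_indic A) pK bK) _.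
have : indist P (fun t w => \sum_(i <- r) J i (fun s x
  => \1_A x * ((u < s) && (s <= v))%:R * D i s x) t w)
    (fun t w => \sum_(i <- r) \1_A w * (J i (D i) (Num.min v t) w - J i (D i) (Num.min u t) w)).
  under eq_fun do under eq_fun do rewrite big_seq.
  under [X in indist _ _ X]eq_fun do under eq_fun do rewrite big_seq.
  apply: indist_sum => i ir.
  by apply: integral_rectangle_mul (iJ i ir) _ _ _ _ _ _ => //;
    [exact: bounded_indic|exact: (pD i ir).1|exact: (pD i ir).2].
have v0 : 0 <= v := le_trans u0 (ltW uv).
apply: filterS2 E => w e1 e2 t t0.
by rewrite e2// !e1 ?le_min ?v0 ?u0// -mulr_sumr sumrB.
Qed.

Hypothesis hU : usual_conditions P F.

(** By completeness F_0 contains the null set [N] off which [H] vanishes, so the indicator of [N] is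
    predictable and [H] equals [H] times it. The operator that inserts this factor is null on
    rectangles, whose coefficient becomes a.s. 0. *)
Lemma integral_evanescent X J H : integral_operator P F X J ->
  predictable F H -> bounded_process H -> indist P H P0 -> indist P (J H) P0.
Proof.
move=> iJ pH bH H0; have rJ := integral_regular iJ.
pose N := ~` [set w | forall t, 0 <= t -> H t w = 0].
have nN : P.-negligible N by exact: H0.
have FN : F 0 N := hU.2 N nN.
have s0 := (hF.1 _ (lexx 0)).1.
have mN := sub_measurable_indic (R := R) s0 FN.
pose K : process R Omega := fun=> \1_N.
have bK : bounded_process K.
  by have [c Nc] := bounded_indic N; exists c => t w _; exact: Nc.
have pK : predictable F K.
  have E : K = fun t w => \1_(setT `*` N) (t, w).
    by apply/funext => t; apply/funext => w; rewrite /K !indicE in_setX in_setT.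
  rewrite E; apply: predictable_indicator; rewrite /predictable_trace /=.
  rewrite (_ : _ `&` _ = ([set 0] `*` N) `|` \bigcup_n (`]0, n.+1%:R]%classic `*` N)).
    have [p0 pD pU] := smallest_sigma_algebra (`[0,
      +oo[ `*` [set: Omega]) (predictable_rectangles F).
    rewrite -bigcup2E; apply: (pU) => -[|[|n]] //=.
      by apply: sub_sigma_algebra; left; exists N.
    by apply: pU => n; apply: sub_sigma_algebra; right; exists 0, n.+1%:R, N; split.
  apply/seteqP; split=> -[t w] /=; rewrite !in_itv/= andbT.
    move=> [[t0 _] [_ Nw]]; move: t0; rewrite le_eqVlt => /predU1P[<-|t0]; first by left.
    right; exists (Num.truncn t) => //; split=> //=; rewrite in_itv/= t0/=.
    exact/ltW/truncnS_gt.
  move=> [[-> ?]//|[n _ [/=]]]; rewrite in_itv/= => /andP[t0 _] Nw.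
  by split=> //; split=> //; exact: ltW.
have HK t w : 0 <= t -> H t w = H t w * K t w.
  move=> t0; rewrite /K indicE; have [|nNw] := boolP (w \in N); first by rewrite mulr1.
  by rewrite mulr0; move/negP: nNw; rewrite inE => /contrapT /(_ t t0).
apply: indist_trans (regular_ext hF rJ pH bH (predictableM pH pK) HK) _.
apply: (regular_null hF (regular_mul pK bK rJ)) pH bH => [A FA|r s A r0 rs FA].
  have mA := sub_measurable_indic (R := R) s0 FA.
  rewrite (_ : (fun t w => _) = (fun t w => \1_A w * \1_N w * (t == 0)%:R)).
    case: iJ => _ J0 _ _ _; apply: J0; first exact: (sub_measurableM s0).
    exact: bounded_funM (bounded_indic A) (bounded_indic N).
  by apply/funext => t; apply/funext => w; rewrite /K; ring.
have mA := sub_measurable_indic (R := R) (hF.1 _ r0).1 FA.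
rewrite (_ : (fun t w => _) = (fun t w => \1_A w * \1_N w * ((r < t) && (t <= s))%:R)).
  case: iJ => _ _ Jrs _ _.
  have mAN : sub_measurable (F r) (fun w => \1_A w * \1_N w : R).
    apply: (sub_measurableM (hF.1 _ r0).1) => // B mB.
    exact: hF.2 (mN B mB).
  have E := Jrs _ _ _ r0 rs mAN (bounded_funM (bounded_indic A) (bounded_indic N)).
  apply: indist_trans E _.
  by apply: filterS H0 => w H0w t t0; rewrite [\1_N w]indicE memNset ?mulr0 ?mul0r//.
by apply/funext => t; apply/funext => w; rewrite /K; ring.
Qed.

End IntegralOperators.

(** * Optional stopping and sums of semimartingales *)

Section Expectation.
Context {d : measure_display} {Omega : measurableType d} {R : realType}.
Variable P : probability Omega R.
Implicit Types f g h : Omega -> R.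

Local Notation L1 f := (P.-integrable setT (EFin \o f)).
Local Notation E f := (Rintegral P setT f).

Lemma L1_measurable f : L1 f -> measurable_fun setT f.
Proof. by move=> /measurable_int/measurable_EFinP. Qed.

Lemma L1_dominated f g : measurable_fun setT f -> L1 g ->
  (forall w, `|f w| <= `|g w|) -> L1 f.
Proof.
move=> mf ig fg; apply: le_integrable ig => //; first exact/measurable_EFinP.
by move=> w _; rewrite /= lee_fin.
Qed.

Lemma L1_cst (c : R) : L1 (fun=> c).
Proof. exact: finite_measure_integrable_cst. Qed.

Lemma L1_bounded f (c : R) : measurable_fun setT f -> (forall w, `|f w| <= c) -> L1 f.
Proof.
move=> mf fc; apply: (L1_dominated mf (L1_cst c)) => w.
by apply: le_trans (fc w) _; exact: ler_norm.
Qed.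

Lemma L1D f g : L1 f -> L1 g -> L1 (fun w => f w + g w).
Proof. exact: (integrableD measurableT). Qed.

Lemma L1B f g : L1 f -> L1 g -> L1 (fun w => f w - g w).
Proof. exact: (integrableB measurableT). Qed.

Lemma L1Z (c : R) f : L1 f -> L1 (fun w => c * f w).
Proof. exact: (integrableZl measurableT). Qed.

Lemma L1_indicM (A : set Omega) f : measurable A -> L1 f -> L1 (fun w => \1_A w * f w).
Proof.
move=> mA lf; apply: (L1_dominated _ lf) => [|w].
  by apply: measurable_funM; [exact: measurable_indic|exact: L1_measurable].
by rewrite normrM indicE; case: (_ \in _); rewrite /= ?normr1 ?normr0 ?mul1r ?mul0r.
Qed.

Lemma meanD f g : L1 f -> L1 g -> E (fun w => f w + g w) = E f + E g.
Proof. by move=> lf lg; rewrite RintegralD. Qed.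

Lemma meanB f g : L1 f -> L1 g -> E (fun w => f w - g w) = E f - E g.
Proof. by move=> lf lg; rewrite RintegralB. Qed.

Lemma meanZ (c : R) f : L1 f -> E (fun w => c * f w) = c * E f.
Proof. by move=> lf; rewrite RintegralZl. Qed.

Lemma le_mean f g : L1 f -> L1 g -> (forall w, f w <= g w) -> E f <= E g.
Proof. by move=> lf lg fg; apply: le_Rintegral. Qed.

Lemma mean_cst (c : R) : E (fun=> c) = c.
Proof. by rewrite Rintegral_cst// [X in fine X](probability_setT P) mulr1. Qed.

Lemma L1_sum n (f : nat -> Omega -> R) : (forall k, L1 (f k)) ->
  L1 (fun w => \sum_(k < n) f k w).
Proof.
move=> lf; elim: n => [|n IH].
  by under eq_fun do rewrite big_ord0; exact: L1_cst.
by under eq_fun do rewrite big_ord_recr; exact: L1D.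
Qed.

Lemma mean_sum n (f : nat -> Omega -> R) : (forall k, L1 (f k)) ->
  E (fun w => \sum_(k < n) f k w) = \sum_(k < n) E (f k).
Proof.
move=> lf; elim: n => [|n IH].
  by rewrite big_ord0 -[RHS](mean_cst 0); apply: eq_Rintegral => w _; rewrite big_ord0.
rewrite big_ord_recr/= -IH -meanD//; last exact: L1_sum.
by apply: eq_Rintegral => w _; rewrite big_ord_recr.
Qed.

Lemma integral_set_mean (A : set Omega) f : measurable A -> L1 f ->
  (\int[P]_(w in A) (f w)%:E)%E = (E (fun w => \1_A w * f w))%:E.
Proof.
move=> mA lf; rewrite integral_mkcond /Rintegral fineK; last first.
  by apply: integrable_fin_num => //; exact: L1_indicM.
by apply: eq_integral => w _; rewrite /patch indicE; case: (_ \in _); rewrite /= ?mul1r ?mul0r.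
Qed.

Lemma mean_dominated_cvg (h : nat -> Omega -> R) f g :
  (forall n, measurable_fun setT (h n)) -> L1 g ->
  (forall n w, `|h n w| <= g w) -> (forall w, h n w @[n --> \oo] --> f w) ->
  E (h n) @[n --> \oo] --> E f.
Proof.
move=> mh lg hg hf.
have mf : measurable_fun setT f by apply: (@measurable_fun_cvg _ _ _ _ h).
have lf : L1 f.
  apply: (L1_dominated mf lg) => w.
  have /cvg_norm cv := hf w.
  apply: (cvgr_to_le cv); apply: nearW => n.
  by apply: le_trans (hg n w) _; exact: ler_norm.
apply/fine_cvg; rewrite fineK; last exact: integrable_fin_num.
apply: (@dominated_cvg _ _ _ _ _ measurableT (fun n => EFin \o h n) (EFin \o f) (EFin \o g))
  => //.
- by move=> n; exact/measurable_EFinP.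
- by move=> w _; apply: cvg_EFin; [exact: nearW|exact: hf].
- by move=> n w _; rewrite /= lee_fin.
Qed.

(** A convex substitute for the tail |x| 1_{|x| > c}: by Jensen's inequality the excess of a
    conditional expectation is bounded in mean by that of the conditioned variable, and small mean
    excess still expresses uniform integrability. *)
Definition excess (c x : R) := Num.max 0 (`|x| - c).

Lemma excess_ge0 c x : 0 <= excess c x.
Proof. by rewrite /excess le_max lexx. Qed.

Lemma excess_le c x : 0 <= c -> excess c x <= `|x|.
Proof. by move=> c0; rewrite /excess ge_max normr_ge0 gerBl. Qed.

Lemma measurable_excess c f : measurable_fun setT f -> measurable_fun setT (fun w
  => excess c (f w)).
Proof.
move=> mf; apply: (measurable_maxr (f := fun=> 0)) => //.
by apply: measurable_funB => //; exact: measurableT_comp.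
Qed.

Lemma L1_excess c f : 0 <= c -> L1 f -> L1 (fun w => excess c (f w)).
Proof.
move=> c0 lf; apply: (L1_dominated _ lf) => [|w]; first exact/measurable_excess/L1_measurable.
by rewrite ger0_norm ?excess_ge0// excess_le.
Qed.

Lemma excess_cvg0 f : L1 f -> E (fun w => excess n%:R (f w)) @[n --> \oo] --> (0 : R).
Proof.
move=> lf; rewrite -[X in _ --> X](mean_cst 0).
apply: (@mean_dominated_cvg _ _ (fun w => `|f w|)).
- by move=> n; exact/measurable_excess/L1_measurable.
- exact: integrable_norm.
- by move=> n w; rewrite ger0_norm ?excess_ge0// excess_le.
- move=> w; apply: cvg_near_cst; near=> n.
  rewrite /excess max_l// subr_le0.
  apply: le_trans (ltW (truncnS_gt _)) _; rewrite ler_nat.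
  by near: n; exact: nbhs_infty_ge.
Unshelve. all: by end_near. Qed.

Lemma dist_clamp (c x : R) : 0 <= c ->
  `|x - Num.max (- c) (Num.min c x)| = excess c x.
Proof.
move=> c0; rewrite /excess; have [cx|xc] := leP c x.
  rewrite (max_r (x := - c)); last by lra.
  by rewrite ger0_norm ?(ger0_norm (x := x)) ?max_r; lra.
have [h|h] := leP x (- c).
  by rewrite ler0_norm ?(ler0_norm (x := x)) ?max_r; lra.
have [x0|x0] := leP 0 x.
  by rewrite subrr normr0 max_l// ger0_norm; lra.
by rewrite subrr normr0 max_l// ltr0_norm; lra.
Qed.

Lemma norm_clamp (c x : R) : 0 <= c -> `|Num.max (- c) (Num.min c x)| <= c.
Proof.
by move=> c0; rewrite ler_norml le_max lexx/= ge_max ge_min lexx/= andbT; lra.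
Qed.

(* A sequence whose excesses are controlled by those of one integrable
   function is uniformly integrable. *)
Lemma uniformly_integrable_limit (h : nat -> Omega -> R) f g :
  (forall n, L1 (h n)) -> L1 g ->
  (forall n (c : R), 0 <= c ->
    E (fun w => excess c (h n w)) <= E (fun w => excess c (g w))) ->
  (forall w, h n w @[n --> \oo] --> f w) ->
  L1 f /\ forall A, measurable A -> (forall n, E (fun w => \1_A w * h n w) = 0) ->
    E (fun w => \1_A w * f w) = 0.
Proof.
move=> lh lg hg hf.
have mh n := L1_measurable (lh n).
have mf : measurable_fun setT f by apply: (@measurable_fun_cvg _ _ _ _ h).
have ex0 k : (fun w => excess 0 (k w)) = (fun w => `|k w|) :> (Omega -> R).
  by apply/funext => w; rewrite /excess subr0 max_r.
(* At level 0 the excess is the absolute value, so the means of [|h n|] are bounded and Fatou's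
   lemma applies. *)
have lf : L1 f.
  apply/integrableP; split; first exact/measurable_EFinP.
  apply: (@le_lt_trans _ _ (limn_einf (fun n => \int[P]_w `|(h n w)%:E|)%E)).
    apply: (@le_trans _ _ (\int[P]_w limn_einf (fun n => `|(h n w)%:E|))%E); last first.
      by apply: fatou => // n; do 2 apply: measurableT_comp => //.
    rewrite le_eqVlt; apply/orP; left; apply/eqP; apply: eq_integral => w _.
    have cv : (`|(h n w)%:E| @[n --> \oo] --> `|(f w)%:E|)%E.
      by apply: cvg_abse; apply: cvg_EFin; [exact: nearW|exact: hf].
    rewrite is_cvg_limn_einfE; last by apply/cvg_ex; exists `|(f w)%:E|%E.
    exact/esym/cvg_lim.
  apply: (@le_lt_trans _ _ (E (fun w => `|g w|))%:E); last exact: ltry.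
  rewrite limn_einf_lim; apply: lime_le; [exact: is_cvg_einfs|apply: nearW => n].
  apply: (@le_trans _ _ (\int[P]_w `|(h n w)%:E|)%E).
    by apply: ereal_inf_lbound; exists n => /=.
  have := hg n 0 (lexx 0); rewrite !ex0 -lee_fin; apply: le_trans.
  rewrite /Rintegral fineK//; apply: integrable_fin_num => //.
  by have := integrable_norm (lh n).
split=> // A mA h0.
apply/eqP; rewrite -normr_eq0 eq_le normr_ge0 andbT.
apply/ler_addgt0Pr => e e0; rewrite add0r.
have e3 : 0 < e / 3 by rewrite divr_gt0.
(* One level makes the mean excesses of [f] and [g], hence of all [h n], small; the variables
   clamped at this level converge by bounded convergence. *)
have [N0 /= cf] : exists N0 : nat, E (fun w => excess N0%:R (f w)) <= e / 3 /\
    E (fun w => excess N0%:R (g w)) <= e / 3.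
  have /cvgrPdist_le/(_ _ e3) [n1 _ c1] := excess_cvg0 lf.
  have /cvgrPdist_le/(_ _ e3) [n2 _ c2] := excess_cvg0 lg.
  exists (maxn n1 n2); have := c1 _ (leq_maxl n1 n2); have := c2 _ (leq_maxr n1 n2).
  rewrite /= !sub0r !normrN => h2 h1.
  by split; [apply: le_trans h1|apply: le_trans h2]; exact: ler_norm.
case: cf => cf cg; set c : R := N0%:R in cf cg.
have c0 : 0 <= c by rewrite /c.
pose phi x : R := Num.max (- c) (Num.min c x).
have mphi (k : Omega -> R) : measurable_fun setT k -> measurable_fun setT (fun w => phi (k w)).
  move=> mk; rewrite /phi; apply: (measurable_maxr (f := fun=> - c) (g := fun w
    => Num.min c (k w))) => //.
  exact: (measurable_minr (f := fun=> c) (g := k)).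
have lphi (k : Omega -> R) : measurable_fun setT k -> L1 (fun w => phi (k w)).
  by move=> mk; apply: (L1_bounded (c := c)); [exact: mphi|move=> w; exact: norm_clamp].
have cphi : E (fun w => `|phi (f w) - phi (h n w)|) @[n --> \oo] --> (0 : R).
  rewrite -[X in _ --> X](mean_cst 0).
  apply: (@mean_dominated_cvg _ _ (fun=> c + c)).
  + by move=> n; apply: measurableT_comp => //; apply: measurable_funB; exact: mphi.
  + exact: L1_cst.
  + move=> n w; rewrite normr_id; apply: le_trans (ler_normB _ _) _.
    by rewrite lerD// norm_clamp.
  + move=> w; rewrite -[X in _ --> X](normr0 R) -(subrr (phi (f w))).
    apply: cvg_norm; apply: cvgB; first exact: cvg_cst.
    have cphi : {for f w, continuous phi}.
      apply: (@continuous_max _ _ (fun=> - c)); first exact: cst_continuous.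
      by apply: (@continuous_min _ _ (fun=> c)); [exact: cst_continuous|exact: cvg_id].
    exact: cvg_comp (hf w) cphi.
have /cvgrPdist_le/(_ _ e3) [n _ /(_ n (leqnn n))] := cphi.
rewrite sub0r normrN => /(le_trans (ler_norm _)) cn.
have lA k : L1 k -> L1 (fun w => \1_A w * k w) by exact: L1_indicM.
rewrite -[X in `|X|]subr0 -(h0 n) -meanB//; [|exact: lA|exact: lA].
apply: (@le_trans _ _ (E (fun w => `|\1_A w * f w - \1_A w * h n w|))).
  by apply: le_normr_Rintegral => //; apply: L1B; exact: lA.
have lef : L1 (fun w => excess c (f w)) by exact: L1_excess.
have leh : L1 (fun w => excess c (h n w)) by exact: L1_excess.
have lph : L1 (fun w => `|phi (f w) - phi (h n w)|).
  by apply: integrable_norm; apply: L1B; exact: lphi.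
(* The difference [f - h n] is split at the two clamped values; by [dist_clamp] the outer parts are
   excesses. *)
apply: (@le_trans _ _ (E (fun w => excess c (f w) + `|phi (f w) - phi (h n w)| + excess c (h n
  w)))).
  apply: le_mean => [||w].
  - by apply: integrable_norm; apply: L1B; exact: lA.
  - by apply: L1D => //; exact: L1D.
  rewrite -mulrBr normrM.
  have le1 : `|\1_A w| <= 1 :> R.
    by rewrite indicE; case: (_ \in _); rewrite /= ?normr1 ?normr0 ?lexx ?ler01.
  apply: (@le_trans _ _ `|f w - h n w|); first by rewrite ler_piMl.
  rewrite -!dist_clamp// -/(phi (f w)) -/(phi (h n w)).
  rewrite (distrC (h n w) (phi (h n w))).
  rewrite (_ : f w - h n w = (f w - phi (f w)) + (phi (f w) - phi (h n w)) + (phi (h n w) - h n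
    w)); last by ring.
  by apply: le_trans (ler_normD _ _) _; rewrite lerD2r ler_normD.
rewrite meanD//; last exact: L1D.
rewrite meanD//.
rewrite (_ : e = e / 3 + e / 3 + e / 3); last by field.
by rewrite lerD ?lerD// (le_trans (hg n c c0)).
Qed.

(* Jensen's inequality for x |-> max(0, |x| - c), where f = E[g | G]. *)
Lemma excess_jensen (G : set (set Omega)) f g (c : R) (B : set Omega) :
  sigma_algebra setT G -> G `<=` measurable -> sub_measurable G f ->
  L1 f -> L1 g -> 0 <= c ->
  (forall A, G A -> E (fun w => \1_A w * f w) = E (fun w => \1_A w * g w)) ->
  G B -> E (fun w => \1_B w * excess c (f w)) <= E (fun w => \1_B w * excess c (g w)).
Proof.
move=> sG Gm mf lf lg c0 fg GB.
have mc c' := sub_measurable_cst (R := R) sG c'.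
pose Bp := B `&` [set w | c < f w]; pose Bn := B `&` [set w | f w < - c].
have GBp : G Bp by apply: (sub_sigma_setI sG) => //; exact: sub_measurable_lt (mc c) mf.
have GBn : G Bn by apply: (sub_sigma_setI sG) => //; exact: sub_measurable_lt mf (mc (- c)).
have lA A k : G A -> L1 k -> L1 (fun w => \1_A w * k w).
  by move=> GA lk; apply: L1_indicM => //; exact: Gm.
have l1 A : G A -> L1 (fun w => \1_A w : R).
  by move=> GA; under eq_fun do rewrite -[\1_A _]mulr1; exact/lA/L1_cst.
(* [Q k] is affine in [k] and plays the role of a tangent at [f]: it equals the excess on [B] for k
   = f and lies below it for k = g. Its mean depends on [k] only through integrals over [Bp] and
   [Bn], which belong to [G]. *)
pose Q k := fun w => (\1_Bp w * k w - \1_Bn w * k w) - c * (\1_Bp w + \1_Bn w) : R.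
have lQ k : L1 k -> L1 (Q k).
  move=> lk; apply: L1B; first by apply: L1B; exact: lA.
  by apply: L1Z; apply: L1D; exact: l1.
have EQ k : L1 k -> E (Q k) = E (fun w => \1_Bp w * k w) - E (fun w => \1_Bn w * k w)
    - E (fun w => c * (\1_Bp w + \1_Bn w)).
  move=> lk; rewrite meanB; [|by apply: L1B; exact: lA|by apply: L1Z; apply: L1D; exact: l1].
  by rewrite meanB//; exact: lA.
have -> : (fun w => \1_B w * excess c (f w)) = Q f.
  apply/funext => w; rewrite /Q !indicE !in_setI.
  have [wB|wB] := boolP (w \in B); last by rewrite /= !mul0r; ring.
  rewrite /= !mul1r /excess.
  have -> : (w \in [set w | c < f w]) = (c < f w) by apply/idP/idP; rewrite inE.
  have -> : (w \in [set w | f w < - c]) = (f w < - c) by apply/idP/idP; rewrite inE.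
  have [h|h] := ltP c (f w).
    have -> : (f w < - c) = false by apply/negbTE; rewrite -leNgt; lra.
    by rewrite gtr0_norm ?max_r/=; lra.
  have [h'|h'] := ltP (f w) (- c).
    by rewrite ltr0_norm ?max_r/=; lra.
  rewrite max_l; first by rewrite /=; ring.
  by rewrite subr_le0 ler_norml; lra.
rewrite EQ// !fg// -EQ//.
apply: le_mean; [exact: lQ|exact/lA/L1_excess|] => w.
rewrite /Q !indicE !in_setI.
have [wB|wB] := boolP (w \in B); last by rewrite /= !mul0r; lra.
rewrite /= !mul1r /excess.
have -> : (w \in [set w | c < f w]) = (c < f w) by apply/idP/idP; rewrite inE.
have -> : (w \in [set w | f w < - c]) = (f w < - c) by apply/idP/idP; rewrite inE.
have [h|h] := ltP c (f w).
  have -> : (f w < - c) = false by apply/negbTE; rewrite -leNgt; lra.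
  by rewrite le_max; apply/orP; right; have := ler_norm (g w); rewrite /=; lra.
have [h'|h'] := ltP (f w) (- c).
  by rewrite le_max; apply/orP; right; have := ler_norm (- g w); rewrite normrN /=; lra.
by rewrite le_max; apply/orP; left; rewrite /=; lra.
Qed.

End Expectation.

(** * Optional stopping by discretisation from the right *)

Section OptionalStopping.
Context {d : measure_display} {Omega : measurableType d} {R : realType}.
Variables (P : probability Omega R) (F : R -> set (set Omega)).
Hypothesis hF : filtration F.
Implicit Types (M X Y : process R Omega) (tau sigma : Omega -> \bar R).

Local Notation L1 f := (P.-integrable setT (EFin \o f)).
Local Notation E f := (Rintegral P setT f).

Lemma martingale_expectation M s t (A : set Omega) : martingale P F M ->
  0 <= s -> s <= t -> F s A ->
  E (fun w => \1_A w * M s w) = E (fun w => \1_A w * M t w).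
Proof.
move=> [_ _ iM mM] s0 st FA; have t0 := le_trans s0 st.
have mA : measurable A by apply: (hF.1 _ s0).2.
apply: EFin_inj; rewrite -!integral_set_mean//; [|exact: iM|exact: iM].
by rewrite (mM s t).
Qed.

Section Grid.
Variables (s t : R) (n : nat) (sigma : Omega -> \bar R).
Hypotheses (s0 : 0 <= s) (st : s <= t) (hs : stopping_time F sigma).

Definition grid (j : nat) : R := s + (t - s) * j%:R / n.+1%:R.

(* First grid index whose time is at or after sigma; n.+1 if there is none. *)
Definition grid_index (w : Omega) : nat :=
  find (fun j => sigma w <= (grid j)%:E)%E (iota 0 n.+1).

Lemma grid0 : grid 0 = s. Proof. by rewrite /grid mulr0 mul0r addr0. Qed.

Lemma gridN : grid n.+1 = t.
Proof. by rewrite /grid mulfK ?pnatr_eq0// addrC subrK. Qed.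

Lemma gridS j : grid j.+1 = grid j + (t - s) / n.+1%:R.
Proof. by rewrite /grid -natr1; field; rewrite nat1r pnatr_eq0. Qed.

Lemma grid_le i j : (i <= j)%N -> grid i <= grid j.
Proof.
move=> ij; rewrite /grid lerD2l ler_wpM2r ?invr_ge0//.
by rewrite ler_wpM2l ?subr_ge0// ler_nat.
Qed.

Lemma grid_ge_s j : s <= grid j.
Proof. by rewrite -{1}grid0 grid_le. Qed.

Lemma grid_le_t j : (j <= n.+1)%N -> grid j <= t.
Proof. by move=> jn; rewrite -gridN grid_le. Qed.

Lemma grid_index_le w : (grid_index w <= n.+1)%N.
Proof. by rewrite -[X in (_ <= X)%N](size_iota 0 n.+1); exact: find_size. Qed.

Lemma grid_indexP w j : (j < n.+1)%N -> (grid_index w <= j)%N = (sigma w <= (grid j)%:E)%E.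
Proof.
move=> jn; apply/idP/idP => [kj|sj].
  have kn : (grid_index w < n.+1)%N := leq_ltn_trans kj jn.
  have := @nth_find _ 0%N (fun j => sigma w <= (grid j)%:E)%E (iota 0 n.+1).
  rewrite has_find size_iota => /(_ kn); rewrite nth_iota// add0n => /le_trans; apply.
  by rewrite lee_fin grid_le.
rewrite leqNgt; apply/negP => jk.
have := @before_find _ 0%N (fun j => sigma w <= (grid j)%:E)%E (iota 0 n.+1) j jk.
by rewrite nth_iota// add0n sj.
Qed.

(** Rounding [sigma] up to the grid makes the rounded index known at its own grid time. The index
    n.+1 stands for the time [t] itself, and for j = n.+1 the event is the whole space. *)
Lemma grid_index_measurable_le j : (j <= n.+1)%N ->
  F (grid j) [set w | (grid_index w <= j)%N].
Proof.
move=> jn; have g0 := le_trans s0 (grid_ge_s j).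
move: jn; rewrite leq_eqVlt => /predU1P[->|jn].
  rewrite (_ : [set w | _] = setT); first exact: (sub_sigma_setT (hF.1 _ (le_trans s0
    (grid_ge_s _))).1).
  by apply/seteqP; split=> // w _; exact: grid_index_le.
rewrite (_ : [set w | _] = [set w | (sigma w <= (grid j)%:E)%E]); first exact: hs.2.
by apply/seteqP; split=> w /=; rewrite grid_indexP.
Qed.

Lemma grid_index_measurable j : (j <= n.+1)%N ->
  F (grid j) [set w | grid_index w = j].
Proof.
have g0 i := le_trans s0 (grid_ge_s i).
case: j => [|j] jn.
  rewrite (_ : [set w | _] = [set w | (grid_index w <= 0)%N]);
    first exact: grid_index_measurable_le.
  by apply/seteqP; split=> w /=; [move=> ->|rewrite leqn0 => /eqP].
rewrite (_ : [set w | _] = [set w | (grid_index w <= j.+1)%N] `\` [set w | (grid_index w <=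
  j)%N]).
  apply: (sub_sigma_setD (hF.1 _ (g0 _)).1); first exact: grid_index_measurable_le.
  apply: hF.2 (grid_index_measurable_le (ltnW jn)) => //.
  exact: grid_le.
apply/seteqP; split=> w /=; first by move=> ->; rewrite ltnn.
by move=> [h1 /negP]; rewrite -ltnNge => h2; apply/eqP; rewrite eqn_leq h1.
Qed.

Lemma sum_grid_index (G : nat -> Omega -> R) w :
  \sum_(j < n.+2) \1_[set w | grid_index w = j] w * G j w = G (grid_index w) w.
Proof.
have kn : (grid_index w < n.+2)%N by rewrite ltnS grid_index_le.
rewrite (bigD1 (Ordinal kn))//= indicE mem_set// mul1r big1 ?addr0// => i ik.
rewrite indicE memNset ?mul0r// => /= ki.
by move/eqP: ik; apply; exact: val_inj.
Qed.

(** The rounded time lies within one mesh to the right of [sigma] clamped to [s, t], the side on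
    which paths are continuous. *)
Lemma grid_index_near w (v := Num.max s (fine (Order.min t%:E (sigma w)))) :
  v <= grid (grid_index w) <= v + (t - s) / n.+1%:R.
Proof.
have sg0 := hs.1 w.
have t0 := le_trans s0 st.
have mfin : Order.min t%:E (sigma w) \is a fin_num.
  rewrite fin_numE -ltNye -ltey; apply/andP; split.
    by rewrite lt_min ltNyr/= (lt_le_trans _ sg0)// ltNyr.
  by rewrite gt_min ltry.
have vE : (fine (Order.min t%:E (sigma w)))%:E = Order.min t%:E (sigma w) by rewrite fineK.
have h0 : 0 <= (t - s) / n.+1%:R by rewrite divr_ge0 ?subr_ge0.
apply/andP; split.
  rewrite /v ge_max grid_ge_s /= -lee_fin vE ge_min.
  have := grid_index_le w; rewrite leq_eqVlt => /predU1P[->|kn].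
    by rewrite gridN lexx.
  by rewrite -(grid_indexP _ kn) leqnn orbT.
case E : (grid_index w) => [|j]; first by rewrite grid0 /v (le_trans (y := v))// ?lerDl//
  le_max lexx.
rewrite gridS lerD2r /v le_max; apply/orP; right.
have jn : (j < n.+1)%N by rewrite -ltnS -E ltnS grid_index_le.
have : ~~ (sigma w <= (grid j)%:E)%E by rewrite -grid_indexP// E ltnn.
rewrite -ltNge => gs.
rewrite -lee_fin vE le_min lee_fin grid_le_t/=; last exact: ltnW.
exact: ltW.
Qed.

End Grid.

Section StoppedMartingale.
Variables (M : process R Omega) (sigma : Omega -> \bar R).
Hypotheses (mM : martingale P F M) (hs : stopping_time F sigma).

(** The rounded stopping time has finitely many values, so the martingale property can be used on
    each of its level sets separately. *)
Let discrete s t n : Omega -> R := fun w =>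
  M (grid s t n (grid_index s t n sigma w)) w - M s w.

Let increment s t : Omega -> R := fun w => stopped M sigma t w - stopped M sigma s w.

Let M_L1 t : 0 <= t -> L1 (M t). Proof. by case: mM => _ _ + _; exact. Qed.

Let cell s t n j : set Omega := [set w | grid_index s t n sigma w = j].

Let cell_F s t n j : 0 <= s -> s <= t -> (j < n.+2)%N -> F (grid s t n j) (cell s t n j).
Proof. by move=> s0 st jn; exact: grid_index_measurable. Qed.

Let clip n j := minn j n.+1.

Let cellc_F s t n j : 0 <= s -> s <= t ->
  F (grid s t n (clip n j)) (cell s t n (clip n j)).
Proof. by move=> s0 st; apply: cell_F => //; rewrite ltnS geq_minr. Qed.

(* Summation lemmas need a total family of summands; clip changes nothing for j < n.+2. *)
Let discreteE s t n (phi : R -> R) : (fun w => phi (discrete s t n w)) = (fun w =>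
  \sum_(j < n.+2) \1_(cell s t n (clip n j)) w * phi (M (grid s t n (clip n j)) w - M s w)).
Proof.
apply/funext => w.
rewrite /discrete -(sum_grid_index s t n sigma (fun j w => phi (M (grid s t n j) w - M s w))).
by apply: eq_bigr => j _; rewrite /clip (minn_idPl _)//; exact: (ltn_ord j).
Qed.

Let gridc_le s t n j : 0 <= s -> s <= t ->
  [/\ 0 <= grid s t n (clip n j), s <= grid s t n (clip n j) & grid s t n (clip n j) <= t].
Proof.
move=> s0 st; have sg := grid_ge_s n st (clip n j).
by split=> //; [exact: le_trans sg|apply: grid_le_t => //; exact: geq_minr].
Qed.

Let cellc_measurable s t n j : 0 <= s -> s <= t -> measurable (cell s t n (clip n j)).
Proof.
move=> s0 st; have [g0 _ _] := gridc_le n j s0 st.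
by apply: (hF.1 _ g0).2; exact: cellc_F.
Qed.

Let dM_L1 s t : 0 <= s -> 0 <= t -> L1 (fun w => M t w - M s w).
Proof. by move=> s0 t0; apply: L1B; exact: M_L1. Qed.

Let discrete_L1 s t n : 0 <= s -> s <= t -> L1 (discrete s t n).
Proof.
move=> s0 st; rewrite (discreteE s t n id : discrete s t n = _).
apply: (@L1_sum _ _ _ P _ (fun j w => \1_(cell s t n (clip n j)) w * (M (grid s t n (clip n j))
  w - M s w))) => j.
apply: L1_indicM; first exact: cellc_measurable.
by apply: dM_L1 => //; case: (gridc_le n j s0 st).
Qed.

Let discrete_measurable s t n : 0 <= s -> s <= t -> sub_measurable (F t) (discrete s t n).
Proof.
move=> s0 st; rewrite (discreteE s t n id : discrete s t n = _).
have t0 := le_trans s0 st; have sG := (hF.1 _ t0).1.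
apply: (sub_measurable_sum sG) => j _.
have [g0 sg gt] := gridc_le n j s0 st.
have aM u : 0 <= u -> u <= t -> sub_measurable (F t) (M u).
  by move=> u0 ut B mB; apply: hF.2 ut _ _ => //; case: mM => aM _ _ _; exact: aM.
apply: (sub_measurableM sG).
  apply: (sub_measurable_indic sG); apply: hF.2 (cellc_F n j s0 st) => //.
by apply: (sub_measurableB sG); exact: aM.
Qed.

Let discrete_cvg s t w : 0 <= s -> s <= t ->
  discrete s t n w @[n --> \oo] --> increment s t w.
Proof.
move=> s0 st; have t0 := le_trans s0 st.
pose v := Num.max s (fine (Order.min t%:E (sigma w))).
(* If [sigma] is at most [s], then [v] is [s] and both increments vanish. *)
have incE : increment s t w = M v w - M s w.
  rewrite /increment /stopped /v; have sg0 := hs.1 w.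
  case E : (sigma w) sg0 => [r| |]// r0; last first.
    by rewrite !miney/= (max_r st).
  rewrite -!EFin_min/=.
  have [sr|rs] := leP s r; first by rewrite (max_r (y := Num.min t r))// le_min st.
  by rewrite (min_r (le_trans (ltW rs) st)) (max_l (ltW rs)) !subrr.
rewrite incE /discrete; apply: cvgB; last exact: cvg_cst.
have cM : cadlag M by case: mM.
have v0 : 0 <= v by rewrite /v le_max s0.
apply/cvgrPdist_lt => e e0.
have [dl dl0 H] := cadlag_right w cM v0 e0.
near=> n.
have /andP[h1 h2] := grid_index_near n s0 st hs w.
rewrite distrC; apply: H => //; apply: le_lt_trans h2 _.
rewrite ltrD2l ltr_pdivrMr// mulrC -ltr_pdivrMr//.
apply: lt_le_trans (truncnS_gt _) _; rewrite ler_nat ltnS.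
by near: n; exact: nbhs_infty_ge.
Unshelve. all: by end_near. Qed.

Let martingale_increment s u t (A : set Omega) : 0 <= s -> s <= u -> u <= t -> F u A ->
  E (fun w => \1_A w * (M u w - M s w)) = E (fun w => \1_A w * (M t w - M s w)).
Proof.
move=> s0 su ut FA; have u0 := le_trans s0 su; have t0 := le_trans u0 ut.
have mA : measurable A by apply: (hF.1 _ u0).2.
have EE x : 0 <= x -> E (fun w => \1_A w * (M x w - M s w)) =
    E (fun w => \1_A w * M x w) - E (fun w => \1_A w * M s w).
  move=> x0; rewrite -meanB; [|by apply: L1_indicM => //; exact: M_L1..].
  by apply: eq_Rintegral => w _; rewrite mulrBr.
by rewrite !EE// (martingale_expectation mM u0 ut FA).
Qed.

(** On the cell of index j the increment [M (grid j) - M s] is the conditional expectation of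
    [M t - M s], so Jensen's inequality applies cell by cell. The bound does not depend on [n],
    which gives uniform integrability. *)
Let discrete_excess s t n (c : R) : 0 <= s -> s <= t -> 0 <= c ->
  E (fun w => excess c (discrete s t n w)) <= E (fun w => excess c (M t w - M s w)).
Proof.
move=> s0 st c0; have t0 := le_trans s0 st.
have sumE : (fun w => excess c (M t w - M s w)) = (fun w =>
    \sum_(j < n.+2) \1_(cell s t n (clip n j)) w * excess c (M t w - M s w)).
  apply/funext => w; rewrite -[LHS](sum_grid_index s t n sigma (fun j w
    => excess c (M t w - M s w))).
  by apply: eq_bigr => j _; rewrite /clip (minn_idPl _)//; exact: (ltn_ord j).
rewrite (discreteE s t n (excess c)) sumE.
have L j x : 0 <= x -> L1 (fun w => \1_(cell s t n (clip n j)) w * excess c (M x w - M s w)).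
  move=> x0; apply: L1_indicM; first exact: cellc_measurable.
  by apply: L1_excess => //; exact: dM_L1.
rewrite (@mean_sum _ _ _ P _ (fun j w => \1_(cell s t n (clip n j)) w * excess c (M (grid s t n
  (clip n j)) w - M s w))); last first.
  by move=> j; apply: L; case: (gridc_le n j s0 st).
rewrite (@mean_sum _ _ _ P _ (fun j w => \1_(cell s t n (clip n j)) w * excess c (M t w - M s
  w))); last first.
  by move=> j; exact: L.
apply: ler_sum => j _.
have [g0 sg gt] := gridc_le n j s0 st.
apply: (@excess_jensen _ _ _ P (F (grid s t n (clip n j)))) => //.
- exact: (hF.1 _ g0).1.
- exact: (hF.1 _ g0).2.
- apply: (sub_measurableB (hF.1 _ g0).1); case: mM => aM _ _ _; first exact: aM.
  by move=> B mB; apply: hF.2 sg _ _ => //; exact: aM.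
- exact: dM_L1.
- exact: dM_L1.
- by move=> A FA; exact: martingale_increment.
- exact: cellc_F.
Qed.

(** On the part of [A] in each cell, an event known at the grid time, the martingale property
    replaces the value at the grid time by [M t]. The cells partition the space, and what remains is
    the mean of [M t - M s] over [A]. *)
Let discrete_mean s t n (A : set Omega) : 0 <= s -> s <= t -> F s A ->
  E (fun w => \1_A w * discrete s t n w) = 0.
Proof.
move=> s0 st FA; have t0 := le_trans s0 st.
have gF j : F (grid s t n (clip n j)) (A `&` cell s t n (clip n j)).
  have [g0 sg gt] := gridc_le n j s0 st.
  by apply: (sub_sigma_setI (hF.1 _ g0).1); [exact: hF.2 FA|exact: cellc_F].
have mAc j : measurable (A `&` cell s t n (clip n j)).
  by have [g0 _ _] := gridc_le n j s0 st; apply: (hF.1 _ g0).2.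
have indI j (w : Omega) : \1_(A `&` cell s t n (clip n j)) w
  = \1_A w * \1_(cell s t n (clip n j)) w :> R.
  by rewrite !indicE in_setI -natrM mulnb.
have L j x : 0 <= x -> L1 (fun w => \1_(A `&` cell s t n (clip n j)) w * (M x w - M s w)).
  by move=> x0; apply: L1_indicM => //; exact: dM_L1.
have -> : (fun w => \1_A w * discrete s t n w) = (fun w => \sum_(j < n.+2)
    \1_(A `&` cell s t n (clip n j)) w * (M (grid s t n (clip n j)) w - M s w)).
  apply/funext => w; have /= /(congr1 (@^~ w)) -> := discreteE s t n id.
  by rewrite mulr_sumr; apply: eq_bigr => j _; rewrite indI mulrA.
rewrite (@mean_sum _ _ _ P _ (fun j w => \1_(A `&` cell s t n (clip n j)) w * (M (grid s t n
  (clip n j)) w - M s w))); last first.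
  by move=> j; apply: L; case: (gridc_le n j s0 st).
under eq_bigr => j _.
  have [g0 sg gt] := gridc_le n j s0 st.
  rewrite (martingale_increment s0 sg gt (gF j)); over.
rewrite -(@mean_sum _ _ _ P n.+2 (fun j w => \1_(A `&` cell s t n (clip n j)) w * (M t w - M s
  w))); last first.
  by move=> j; exact: L.
have -> : (fun w => \sum_(j < n.+2) \1_(A `&` cell s t n (clip n j)) w * (M t w - M s w)) =
    (fun w => \1_A w * (M t w - M s w)).
  apply/funext => w.
  rewrite -(sum_grid_index s t n sigma (fun j w => \1_A w * (M t w - M s w))).
  by apply: eq_bigr => j _; rewrite indI /clip (minn_idPl _) ?mulrA;
    [rewrite [\1_A w * _]mulrC|exact: (ltn_ord j)].
(* With u = s the increment [M u - M s] is identically 0. *)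
rewrite -(martingale_increment s0 (lexx s) st FA).
by rewrite -[RHS](mean_cst P 0); apply: eq_Rintegral => w _; rewrite subrr mulr0.
Qed.

(** The discretised increments converge pointwise to those of the stopped process. Adaptedness
    passes to the limit directly, integrability and vanishing means over sets of F_s by uniform
    integrability. *)
Lemma martingale_stopped : martingale P F (stopped M sigma).
Proof.
have lim s t : 0 <= s -> s <= t -> L1 (increment s t) /\
    forall A, measurable A -> (forall n, E (fun w => \1_A w * discrete s t n w) = 0) ->
    E (fun w => \1_A w * increment s t w) = 0.
  move=> s0 st; have t0 := le_trans s0 st.
  apply: (@uniformly_integrable_limit _ _ _ P (discrete s t) _ (fun w => M t w - M s w)).
  - by move=> n; exact: discrete_L1.
  - exact: dM_L1.
  - by move=> n c c0; exact: discrete_excess.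
  - by move=> w; exact: discrete_cvg.
have stop0 w : stopped M sigma 0 w = M 0 w by rewrite /stopped min_l ?(hs.1 w).
have stopE t : stopped M sigma t = (fun w => increment 0 t w + M 0 w).
  by apply/funext => w; rewrite /increment stop0 subrK.
have aM : adapted F M by case: mM.
have intM t : 0 <= t -> L1 (stopped M sigma t).
  move=> t0; rewrite stopE; apply: L1D; last exact: M_L1.
  exact: (lim 0 t (lexx 0) t0).1.
split.
- move=> t t0; have sG := (hF.1 _ t0).1; rewrite stopE.
  apply: (sub_measurableD sG).
    apply: (sub_measurable_cvg sG (h := discrete 0 t)).
      by move=> n; exact: discrete_measurable.
    by move=> w; exact: discrete_cvg.
  by move=> B mB; apply: hF.2 t0 _ _ => //; exact: aM.
- by apply: cadlag_stopped; [case: mM|exact: hs.1].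
- exact: intM.
- move=> s t A s0 st FA; have t0 := le_trans s0 st.
  have mA : measurable A by apply: (hF.1 _ s0).2.
  rewrite !integral_set_mean//; [|exact: intM..].
  congr EFin; apply/eqP; rewrite -subr_eq0 -meanB; [|by apply: L1_indicM => //; exact: intM..].
  apply/eqP; rewrite -[RHS]((lim s t s0 st).2 A mA).
    by apply: eq_Rintegral => w _; rewrite -mulrBr.
  by move=> n; exact: discrete_mean.
Qed.

End StoppedMartingale.

(** * Combinations of martingales, local martingales and semimartingales *)

Lemma martingale_lin (a b : R) M N : martingale P F M -> martingale P F N ->
  martingale P F (fun t w => a * M t w + b * N t w).
Proof.
move=> mM mN; have [aM cM iM eM] := mM; have [aN cN iN eN] := mN.
have s0 := (hF.1 _ (lexx 0)).1.
have iMN t : 0 <= t -> L1 (fun w => a * M t w + b * N t w).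
  by move=> t0; apply: L1D; apply: L1Z; [exact: iM|exact: iN].
split.
- by apply: (adapted_lin hF (f := fun=> a) (g := fun=> b)) => //; exact: sub_measurable_cst.
- exact: (cadlag_lin (fun=> a) (fun=> b)).
- exact: iMN.
- move=> s t A s0' st FA; have t0 := le_trans s0' st.
  have mA : measurable A by apply: (hF.1 _ s0').2.
  rewrite !integral_set_mean//; [|exact: iMN..].
  have EE x : 0 <= x -> E (fun w => \1_A w * (a * M x w + b * N x w)) =
     a * E (fun w => \1_A w * M x w) + b * E (fun w => \1_A w * N x w).
    move=> x0; have lM := L1_indicM mA (iM x x0); have lN := L1_indicM mA (iN x x0).
    rewrite -!meanZ// -meanD; [|exact: L1Z|exact: L1Z].
    by apply: eq_Rintegral => w _; ring.
  by rewrite !EE// (martingale_expectation mM s0' st FA) (martingale_expectation mN s0' st FA).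
Qed.

Lemma stopping_time_min tau sigma : stopping_time F tau -> stopping_time F sigma ->
  stopping_time F (fun w => Order.min (tau w) (sigma w)).
Proof.
move=> [t0 tF] [s0 sF]; split=> [w|t tt0]; first by rewrite le_min t0 s0.
have sG := (hF.1 _ tt0).1.
rewrite (_ : [set w | _] = ~` (~` [set w | (tau w <= t%:E)%E] `&` ~` [set w | (sigma w <=
  t%:E)%E])).
  by apply: (sub_sigma_setC sG); apply: (sub_sigma_setI sG); apply: (sub_sigma_setC sG);
    [exact: tF|exact: sF].
rewrite setCI !setCK; apply/seteqP; split=> w /=; rewrite ge_min.
  by move/orP.
by move=> h; apply/orP.
Qed.

Lemma stopped_min M tau sigma : (forall w, (0 <= tau w)%E) -> (forall w, (0 <= sigma w)%E) ->
  stopped M (fun w => Order.min (tau w) (sigma w)) = stopped (stopped M tau) sigma.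
Proof.
move=> t0 s0; apply/funext => t; apply/funext => w; rewrite /stopped; congr (M _ w).
congr fine; rewrite fineK; first by rewrite minAC minA.
rewrite fin_numE -ltNye -ltey; apply/andP; split.
  by rewrite lt_min ltNyr/= (lt_le_trans _ (s0 w))// ltNyr.
by rewrite gt_min ltry.
Qed.

(** The minimum of the two localizing sequences localizes both: stopping there means stopping once
    more a process that is already a martingale. *)
Lemma local_martingale_lin (a b : R) M N : local_martingale P F M -> local_martingale P F N ->
  local_martingale P F (fun t w => a * M t w + b * N t w).
Proof.
move=> [aM cM [tau [ts tm tc tM]]] [aN cN [sg [ss sm sc sN]]].
have s0 := (hF.1 _ (lexx 0)).1.
split.
- by apply: (adapted_lin hF (f := fun=> a) (g := fun=> b)) => //; exact: sub_measurable_cst.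
- exact: (cadlag_lin (fun=> a) (fun=> b)).
exists (fun n w => Order.min (tau n w) (sg n w)); split.
- by move=> n; exact: stopping_time_min.
- by move=> n w; rewrite le_min !ge_min tm sm orbT.
- apply: filterS2 tc sc => w /cvgeyPge tc /cvgeyPge sc; apply/cvgeyPge => A.
  near=> n; rewrite le_min; apply/andP; split; near: n; [exact: tc|exact: sc].
- move=> n; have t0 := (ts n).1; have g0 := (ss n).1.
  rewrite (_ : stopped _ _ = (fun t w => a * stopped M (fun w => Order.min (tau n w) (sg n w)) t w
     + b * stopped N (fun w => Order.min (tau n w) (sg n w)) t w)) //.
  apply: martingale_lin; first by rewrite stopped_min//; exact: martingale_stopped.
  rewrite (_ : (fun w => _) = (fun w => Order.min (sg n w) (tau n w))).
    by rewrite stopped_min//; exact: martingale_stopped.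
  by apply/funext => w; rewrite minC.
Unshelve. all: by end_near. Qed.

Lemma finite_variation_lin (a b : R) X Y : finite_variation F X -> finite_variation F Y ->
  finite_variation F (fun t w => a * X t w + b * Y t w).
Proof.
move=> [aX cX vX] [aY cY vY]; have s0 := (hF.1 _ (lexx 0)).1.
split.
- by apply: (adapted_lin hF (f := fun=> a) (g := fun=> b)) => //; exact: sub_measurable_cst.
- exact: (cadlag_lin (fun=> a) (fun=> b)).
move=> w t t0.
move: t0; rewrite le_eqVlt => /predU1P[<-|t0]; first exact: bounded_variationxx.
have scale (k : R) (f : R -> R) : bounded_variation 0 t f -> bounded_variation 0 t (fun s
  => k * f s).
  move=> [B hB]; exists (`|k| * B) => _ [r rt <-].
  rewrite /variation; under eq_bigr do rewrite -mulrBr normrM.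
  by rewrite -mulr_sumr ler_wpM2l//; apply: hB; exists r.
by apply: bounded_variationD => //; apply: scale; [apply: vX|apply: vY]; exact: ltW.
Qed.

Lemma semimartingale_lin (a b : R) X Y : semimartingale P F X -> semimartingale P F Y ->
  semimartingale P F (fun t w => a * X t w + b * Y t w).
Proof.
move=> [aX cX [M [A [lM vA M0 A0 XE]]]] [aY cY [N [B [lN vB N0 B0 YE]]]].
have s0 := (hF.1 _ (lexx 0)).1.
split.
- by apply: (adapted_lin hF (f := fun=> a) (g := fun=> b)) => //; exact: sub_measurable_cst.
- exact: (cadlag_lin (fun=> a) (fun=> b)).
exists (fun t w => a * M t w + b * N t w), (fun t w => a * A t w + b * B t w); split.
- exact: local_martingale_lin.
- exact: finite_variation_lin.
- by move=> w; rewrite M0 N0 !mulr0 addr0.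
- by move=> w; rewrite A0 B0 !mulr0 addr0.
- apply: filterS2 XE YE => w e1 e2 t t0; rewrite e1// e2//; ring.
Qed.

End OptionalStopping.

(** * Linearity of vector stochastic integrals *)

Section StrategyIntegrals.
Context {d : measure_display} {Omega : measurableType d} {R : realType}.
Variables (P : probability Omega R) (F : R -> set (set Omega)).
Hypotheses (hF : filtration F) (hU : usual_conditions P F).
Variable I : choiceType.
Implicit Types (H K X Y : process R Omega) (S delta : I -> process R Omega) (E U : set I).

Local Notation P0 := ((fun=> fun=> 0) : process R Omega).

Local Notation elements A := (finmap.enum_fset (fset_set A)).

Lemma in_fset_setP E i : finite_set E -> (i \in elements E) <-> E i.
Proof.
by move=> fE; split => [|Ei]; rewrite in_fset_set//; [move/set_mem|apply/mem_set].
Qed.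

Lemma integral_operator_lin (a b : R) X Y (J J' : process R Omega -> process R Omega) :
  integral_operator P F X J -> integral_operator P F Y J' ->
  integral_operator P F (fun t w => a * X t w + b * Y t w)
    (fun H t w => a * J H t w + b * J' H t w).
Proof.
move=> iJ iJ'.
have [r1 r2 r3] := regular_combination_cst hF a b (integral_regular iJ) (integral_regular iJ').
case: iJ iJ' => _ J0 Jrs _ _ [_ J0' Jrs' _ _].
split=> //.
- move=> f mf bf; apply: filterS2 (J0 f mf bf) (J0' f mf bf) => w E1 E2 t t0.
  by rewrite E1// E2// !mulr0 addr0.
- move=> f r s r0 rs mf bf.
  apply: filterS2 (Jrs f r s r0 rs mf bf) (Jrs' f r s r0 rs mf bf) => w E1 E2 t t0.
  by rewrite E1// E2//; ring.
Qed.

Lemma predictable_trunc E delta n : finite_set E -> (forall i, E i -> predictable F (delta i)) ->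
  predictable F (trunc_indic E delta n).
Proof.
move=> fE pd; apply: predictable_indicator.
have sT := predictable_trace_sigma F.
rewrite (_ : [set z | _] = [set z : R * Omega | forall i,
  i \in elements E -> `|delta i z.1 z.2| <= n%:R]).
  have : forall i, i \in elements E -> predictable F (delta i).
    by move=> i /(in_fset_setP _ fE); exact: pd.
  elim: (elements E) => [_|i r IH pr].
    rewrite (_ : [set z | _] = setT); first exact: sub_sigma_setT.
    by apply/seteqP; split=> // z _ i.
  rewrite (_ : [set z | _] = [set z | `|delta i z.1 z.2| <= n%:R] `&`
     [set z : R * Omega | forall i, i \in r -> `|delta i z.1 z.2| <= n%:R]).
    apply: (sub_sigma_setI sT).
      apply: (sub_measurable_le sT _ (sub_measurable_cst sT _)).
      by apply: (sub_measurable_norm sT); apply: pr; rewrite mem_head.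
    by apply: IH => j jr; apply: pr; rewrite in_cons jr orbT.
  apply/seteqP; split=> z /=.
    by move=> h; split=> [|j jr]; apply: h; rewrite in_cons ?eqxx// jr orbT.
  by move=> [h1 h2] j; rewrite in_cons => /predU1P[->//|]; exact: h2.
apply/seteqP; split=> z /= h i; first by move=> /(in_fset_setP _ fE); exact: h.
by move=> Ei; apply: h; exact/(in_fset_setP _ fE).
Qed.

Lemma bounded_trunc E delta n : bounded_process (trunc_indic E delta n).
Proof. exact: bounded_indicator. Qed.

Lemma trunc_indic_le1 E delta n t w : `|trunc_indic E delta n t w| <= 1.
Proof.
by rewrite /trunc_indic indicE; case: (_ \in _); rewrite /= ?normr1 ?normr0 ?lexx ?ler01.
Qed.

Lemma norm_mul_trunc E delta n i t w : E i ->
  `|delta i t w * trunc_indic E delta n t w| <= n%:R.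
Proof.
move=> Ei; rewrite normrM /trunc_indic indicE.
have [/set_mem/= h|_] := boolP (_ \in _); last by rewrite normr0 mulr0.
by rewrite normr1 mulr1; exact: h.
Qed.

Lemma bounded_mul_trunc E delta n i : E i ->
  bounded_process (fun t w => delta i t w * trunc_indic E delta n t w).
Proof. by move=> Ei; exists n%:R => t w _; exact: norm_mul_trunc. Qed.

Lemma trunc_cvg1 E delta t w : finite_set E ->
  trunc_indic E delta n t w @[n --> \oo] --> (1 : R).
Proof.
move=> fE; apply: cvg_near_cst; near=> n.
rewrite /trunc_indic indicE mem_set// => i Ei /=.
have ir : i \in (elements E) by apply/(in_fset_setP _ fE).
apply: (@le_trans _ _ (\sum_(j <- elements E) `|delta j t w|)).
  rewrite (big_rem i)//= lerDl; exact: sumr_ge0.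
apply: le_trans (ltW (truncnS_gt _)) _; rewrite ler_nat.
by near: n; exact: nbhs_infty_ge.
Unshelve. all: by end_near. Qed.

(** Strategies with different supports have to be added over one common finite set; the extra
    summands only need to be evanescent. *)
Lemma indist_fsum E U (X Y : I -> process R Omega) : finite_set U -> E `<=` U ->
  (forall i, E i -> indist P (X i) (Y i)) ->
  (forall i, U i -> ~ E i -> indist P (Y i) P0) ->
  indist P (fun t w => \sum_(i \in E) X i t w)
           (fun t w => \sum_(i <- elements U) Y i t w).
Proof.
move=> fU EU XY Y0.
pose Z i : process R Omega := if pselect (E i) then X i else P0.
have -> : (fun t w => \sum_(i \in E) X i t w) = (fun t w => \sum_(i <- elements U) Z i t w).
  apply/funext => t; apply/funext => w.
  rewrite -fsbig_finite// -(fsbig_widen E U)//.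
    by apply: eq_fsbigr => i /set_mem Ei; rewrite /Z; case: pselect.
  by move=> i [_ nE]; rewrite /Z /=; case: pselect.
under eq_fun do under eq_fun do rewrite big_seq.
under [X in indist _ _ X]eq_fun do under eq_fun do rewrite big_seq.
apply: indist_sum => i /(in_fset_setP _ fU) Ui.
rewrite /Z; case: pselect => Ei; first exact: XY.
exact/indist_sym/Y0.
Qed.

(** Off the support a component is only evanescent and need not be predictable; replacing it by an
    exact 0 makes every component predictable. *)
Definition restrict_strategy delta : I -> process R Omega :=
  fun i => if pselect (strategy_support P delta i) then delta i else P0.

Lemma restrict_strategy_in delta i : strategy_support P delta i ->
  restrict_strategy delta i = delta i.
Proof. by rewrite /restrict_strategy; case: pselect. Qed.

Lemma restrict_strategy_out delta i : ~ strategy_support P delta i ->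
  restrict_strategy delta i = P0.
Proof. by rewrite /restrict_strategy; case: pselect. Qed.

Definition combine_strategies (a b : R) delta delta' : I -> process R Omega :=
  fun i t w => a * restrict_strategy delta i t w + b * restrict_strategy delta' i t w.

(** Equality may fail, since the two strategies can cancel. *)
Lemma support_combine (a b : R) delta delta' :
  strategy_support P (combine_strategies a b delta delta') `<=`
  strategy_support P delta `|` strategy_support P delta'.
Proof.
move=> i; apply: contra_notP => /not_orP[n1 n2]; apply: aeW => w t t0.
by rewrite /combine_strategies !restrict_strategy_out// !mulr0 addr0.
Qed.

Lemma predictable_restrict delta i :
  (forall i, strategy_support P delta i -> predictable F (delta i)) ->
  predictable F (restrict_strategy delta i).
Proof.
move=> pd; rewrite /restrict_strategy; case: pselect => Ei; first exact: pd.
exact: (predictable_cst 0).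
Qed.

Lemma bounded_restrict_trunc delta n i :
  bounded_process (fun t w => restrict_strategy delta i t w *
    trunc_indic (strategy_support P delta) delta n t w).
Proof.
have [Ei|nEi] := pselect (strategy_support P delta i).
  by rewrite restrict_strategy_in//; exact: bounded_mul_trunc.
rewrite restrict_strategy_out//; exists 0 => t w _; by rewrite mul0r normr0.
Qed.

(** Brings the integrals of different strategies to a common form: one index set [U], one family of
    operators [J] and an arbitrary bounded factor [H]. It combines [integral_assoc] with uniqueness
    of the operators. *)
Lemma truncated_integral S delta Y U (J : I -> process R Omega -> process R Omega)
    (J' : I -> process R Omega -> process R Omega) (JY : process R Omega -> process R Omega) n H :
  let E := strategy_support P delta in
  finite_set U -> E `<=` U -> (forall i, U i -> integral_operator P F (S i) (J i)) ->
  (forall i, E i -> integral_operator P F (S i) (J' i)) ->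
  (forall i, E i -> predictable F (delta i)) ->
  integral_operator P F Y JY ->
  indist P (JY (trunc_indic E delta n))
    (fun t w => \sum_(i \in E) J' i (fun s v => delta i s v * trunc_indic E delta n s v) t w) ->
  predictable F H -> bounded_process H ->
  indist P (JY (fun t w => H t w * trunc_indic E delta n t w))
    (fun t w => \sum_(i <- elements U)
       J i (fun s v => H s v * (restrict_strategy delta i s v * trunc_indic E delta n s v)) t w).
Proof.
move=> E fU EU iJ iJ' pd iY JYE pH bH.
have fE : finite_set E := sub_finite_set EU fU.
have pT := predictable_trunc n fE pd.
have inU i : i \in elements U -> U i by move/(in_fset_setP _ fU).
have pD i : predictable F (fun s v => restrict_strategy delta i s v * trunc_indic E delta n s v).
  by apply: predictableM => //; exact: predictable_restrict.
have bD i := bounded_restrict_trunc delta n i.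
apply: (@integral_assoc _ _ _ P F hF _ (elements U) S J Y JY _
  (fun i s v => restrict_strategy delta i s v * trunc_indic E delta n s v)) => //.
- by move=> i /inU; exact: iJ.
- exact: bounded_trunc.
- apply: indist_trans JYE _; apply: indist_fsum => // i Ei.
    rewrite -(restrict_strategy_in Ei).
    by apply: (integral_unique hF (iJ' i Ei) (iJ i (EU i Ei))); [exact: pD|exact: bD].
  move=> nEi; rewrite restrict_strategy_out//.
  apply: (regular_ext0 hF (integral_regular (iJ i Ei))).
    by have := pD i; rewrite restrict_strategy_out.
  by move=> t w _; rewrite mul0r.
Qed.

(** The level [n] bounds the combined strategy but neither [delta] nor [delta'], so these are
    truncated at an independent level [m], where everything is bounded and can be added. As [m]
    grows, [dl i * T] stays bounded by [n] for [i] in [E], so bounded convergence removes the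
    auxiliary truncations. *)
Lemma strategy_integral_combine (a b : R) S delta delta' Y Y' :
  strategy_integral P F S delta Y -> strategy_integral P F S delta' Y' ->
  strategy_integral P F S (combine_strategies a b delta delta')
    (fun t w => a * Y t w + b * Y' t w).
Proof.
move=> [fE1 [pd1 sY1 Y10 [J1 [JY1 [iJ1 iY1 JE1]]]]] [fE2 [pd2 sY2 Y20 [J2 [JY2 [iJ2 iY2 JE2]]]]].
set E1 := strategy_support P delta in fE1 pd1 JE1 iJ1.
set E2 := strategy_support P delta' in fE2 pd2 JE2 iJ2.
set dl := combine_strategies a b delta delta'.
set E := strategy_support P dl.
have EU : E `<=` E1 `|` E2 by exact: support_combine.
have fU : finite_set (E1 `|` E2) by rewrite finite_setU.
have fE : finite_set E := sub_finite_set EU fU.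
(* One operator per asset. For assets held by both strategies, [truncated_integral] identifies it
   with [J1 i] and with [J2 i]. *)
pose J i := if pselect (E1 i) then J1 i else J2 i.
have iJ i : (E1 `|` E2) i -> integral_operator P F (S i) (J i).
  by rewrite /J; case: pselect => [e _|ne [//|e]]; [exact: iJ1|exact: iJ2].
have pdl i : predictable F (dl i).
  by apply: predictableD; apply: predictableZ; exact: predictable_restrict.
have iY := integral_operator_lin a b iY1 iY2.
split=> //; split.
- by move=> i _; exact: pdl.
- exact: semimartingale_lin.
- by apply: filterS2 Y10 Y20 => w -> ->; rewrite !mulr0 addr0.
exists J, (fun H t w => a * JY1 H t w + b * JY2 H t w); split=> //.
  by move=> i Ei; apply: iJ; exact: EU.
move=> n.
pose T := trunc_indic E dl n.
pose T1 m := trunc_indic E1 delta m.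
pose T2 m := trunc_indic E2 delta' m.
have pT : predictable F T by apply: predictable_trunc.
have pT1 m : predictable F (T1 m) by exact: predictable_trunc.
have pT2 m : predictable F (T2 m) by exact: predictable_trunc.
pose G m : process R Omega := fun t w => T1 m t w * T2 m t w.
have pG m : predictable F (G m) by exact: predictableM.
have bT : bounded_process T by exact: bounded_trunc.
have bT1 m : bounded_process (T1 m) by exact: bounded_trunc.
have bT2 m : bounded_process (T2 m) by exact: bounded_trunc.
have G1 m t w : `|G m t w| <= 1.
  by rewrite normrM -[leRHS]mulr1 ler_pM// trunc_indic_le1.
have trunc_step m : indist P
    (fun t w => a * JY1 (fun s v => G m s v * T s v) t w + b * JY2 (fun s v
      => G m s v * T s v) t w)
    (fun t w => \sum_(i \in E) J i (fun s v => G m s v * (dl i s v * T s v)) t w).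
  (* The truncation of the other strategy goes into the bounded factor [H], so that the integrals
     against [Y] and [Y'] get the same integrand [G m * T]. *)
  have e1 := truncated_integral (n := m) (H := fun s v => T s v * T2 m s v) fU
    (fun i h => or_introl h) iJ iJ1 pd1 iY1 (JE1 m) (predictableM pT (pT2 m)) (bounded_processM
      bT (bT2 m)).
  have e2 := truncated_integral (n := m) (H := fun s v => T s v * T1 m s v) fU
    (fun i h => or_intror h) iJ iJ2 pd2 iY2 (JE2 m) (predictableM pT (pT1 m)) (bounded_processM
      bT (bT1 m)).
  have f1 : (fun s v => T s v * T2 m s v * trunc_indic E1 delta m s v) = (fun s v
    => G m s v * T s v).
    by apply/funext => s; apply/funext => v; rewrite /G /T1; ring.
  have f2 : (fun s v => T s v * T1 m s v * trunc_indic E2 delta' m s v) = (fun s v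
    => G m s v * T s v).
    by apply/funext => s; apply/funext => v; rewrite /G /T2; ring.
  rewrite -/E1 -/E2 f1 f2 in e1 e2.
  apply: indist_trans (indist_lin (fun=> a) (fun=> b) e1 e2) _.
  apply: indist_sym.
  pose A1 i : process R Omega := fun s v => T s v * T2 m s v * (restrict_strategy delta i s v *
    T1 m s v).
  pose A2 i : process R Omega := fun s v => T s v * T1 m s v * (restrict_strategy delta' i s v
    * T2 m s v).
  have pA1 i : predictable F (A1 i).
    by do 2 apply: predictableM => //; [exact: predictable_restrict].
  have pA2 i : predictable F (A2 i).
    by do 2 apply: predictableM => //; [exact: predictable_restrict].
  have bA1 i : bounded_process (A1 i).
    by apply: bounded_processM; [exact: bounded_processM|exact: bounded_restrict_trunc].
  have bA2 i : bounded_process (A2 i).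
    by apply: bounded_processM; [exact: bounded_processM|exact: bounded_restrict_trunc].
  have AE i : (fun s v => G m s v * (dl i s v * T s v)) = (fun s v
    => a * A1 i s v + b * A2 i s v).
    by apply/funext => s; apply/funext => v; rewrite /G /A1 /A2 /dl /combine_strategies; ring.
  have pA i : predictable F (fun s v => a * A1 i s v + b * A2 i s v).
    by apply: predictableD; exact: predictableZ.
  have bA i : bounded_process (fun s v => a * A1 i s v + b * A2 i s v).
    by apply: bounded_processD; exact: bounded_processZ.
  have JA i : (E1 `|` E2) i -> indist P (J i (fun s v => a * A1 i s v + b * A2 i s v))
      (fun t w => a * J i (A1 i) t w + b * J i (A2 i) t w).
    move=> Ui; have rJ := integral_regular (iJ i Ui).
    have pB : predictable F (fun s v => b * A2 i s v) by exact: predictableZ.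
    have bB : bounded_process (fun s v => b * A2 i s v) by exact: bounded_processZ.
    apply: filterS2 (regular_lin rJ a (pA1 i) (bA1 i) pB bB) (regularZ rJ b (pA2 i) (bA2 i)).
    by move=> w h1 h2 t t0; rewrite h1// h2.
  under eq_fun do under eq_fun do under eq_fsbigr do rewrite AE.
  have -> : (fun t w => a * (\sum_(i <- elements (E1 `|` E2)) J i (A1 i) t w)
        + b * (\sum_(i <- elements (E1 `|` E2)) J i (A2 i) t w)) =
      (fun t w => \sum_(i <- elements (E1 `|` E2)) (a * J i (A1 i) t w + b * J i (A2 i) t w)).
    by apply/funext => t; apply/funext => w; rewrite big_split/= -!mulr_sumr.
  apply: (indist_fsum (X := fun i => J i (fun s v => a * A1 i s v + b * A2 i s v))
    (Y := fun i t w => a * J i (A1 i) t w + b * J i (A2 i) t w)) => //.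
    by move=> i Ei; apply: JA; exact: EU.
  (* Here cancellation makes the combined integrand evanescent although its two parts need not
     be. *)
  move=> i Ui nEi; apply: indist_trans (indist_sym (JA i Ui)) _.
  apply: (integral_evanescent hF hU (iJ i Ui)); [exact: pA|exact: bA|].
  rewrite -AE; have /contrapT z := nEi; apply: filterS z => w h t t0.
  by rewrite h// mul0r mulr0.
have rE : regular_operator P F (fun H t w => \sum_(i <- elements E) J i (fun s v
  => H s v * (dl i s v * T s v)) t w).
  apply: (regular_big hF (L := fun i H => J i (fun s v => H s v * (dl i s v * T s v)))) => i.
  move/(in_fset_setP _ fE) => Ei.
  apply: (regular_mul (K := fun s v => dl i s v * T s v)); first exact: predictableM.
    exact: bounded_mul_trunc.
  exact: integral_regular (iJ i (EU i Ei)).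
have rY := regular_mul pT bT (integral_regular iY).
(* The difference of the two sides of the claim, as an operator in an additional factor: it is null
   at every [G m] by [trunc_step], hence at their limit 1. *)
have rD := regular_combination_cst hF 1 (-1) rY rE.
have one : forall X : process R Omega, (fun s v => 1 * X s v) = X.
  by move=> X; apply/funext => s; apply/funext => v; rewrite mul1r.
have : indist P (fun t w => 1 * (a * JY1 (fun s v => 1 * T s v) t w + b * JY2 (fun s v
  => 1 * T s v) t w)
   + -1 * (\sum_(i <- elements E) J i (fun s v => 1 * (dl i s v * T s v)) t w)) P0.
  apply: (regular_limit0 hF rD (H := G) (K := fun=> fun=> 1) (c := 1)) => //.
  - exact: predictable_cst.
  - by move=> t w _; rewrite -[X in _ --> X](mulr1 1); apply: cvgM; exact: trunc_cvg1.
  - move=> m; apply: filterS (trunc_step m) => w h t t0.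
    by rewrite h// fsbig_finite//=; ring.
apply: filterS => w h t t0; have := h t t0; rewrite one.
rewrite mul1r mulN1r => /subr0_eq ->; rewrite fsbig_finite//=.
by apply: eq_bigr => i _; rewrite (one (fun s v => dl i s v * T s v)).
Qed.

Lemma portfolio_combine (a b : R) S delta delta' :
  finite_set (strategy_support P delta) -> finite_set (strategy_support P delta') ->
  indist P (portfolio P S (combine_strategies a b delta delta'))
    (fun t w => a * portfolio P S delta t w + b * portfolio P S delta' t w).
Proof.
move=> f1 f2.
set E1 := strategy_support P delta; set E2 := strategy_support P delta'.
have fU : finite_set (E1 `|` E2) by rewrite finite_setU.
set dl := combine_strategies a b delta delta'.
have e : indist P (portfolio P S dl) (fun t w
  => \sum_(i <- elements (E1 `|` E2)) dl i t w * S i t w).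
  apply: (indist_fsum (X := fun i t w => dl i t w * S i t w) (Y := fun i t w
    => dl i t w * S i t w)) => //.
  - exact: support_combine.
  - by move=> i _; exact: indist_refl.
  - move=> i _ /contrapT z; apply: filterS z => w h t t0; by rewrite h// mul0r.
have e' dt : finite_set (strategy_support P dt) -> strategy_support P dt `<=` E1 `|` E2 ->
    indist P (portfolio P S dt) (fun t w => \sum_(i <- elements (E1 `|` E2)) restrict_strategy
      dt i t w * S i t w).
  move=> fdt sdt.
  apply: (indist_fsum (X := fun i t w => dt i t w * S i t w) (Y := fun i t w
    => restrict_strategy dt i t w * S i t w)) => //.
    by move=> i Ei; rewrite restrict_strategy_in//; exact: indist_refl.
  by move=> i _ nEi; rewrite restrict_strategy_out//; apply: aeW => w t t0; rewrite mul0r.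
apply: indist_trans e _; apply: indist_sym.
apply: indist_trans (indist_lin (fun=> a) (fun=> b) (e' delta f1 _) (e' delta' f2 _)) _.
- by move=> i; left.
- by move=> i; right.
apply: aeW => w t t0; rewrite !mulr_sumr -big_split/=; apply: eq_bigr => i _.
by rewrite /dl /combine_strategies; ring.
Qed.

End StrategyIntegrals.

(** * Convex solid sets in L^0 *)

Section BoundednessInProbability.
Context {d : measure_display} {Omega : measurableType d} {R : realType}.
Variables (P : probability Omega R) (G : set (set Omega)).
Hypotheses (sG : sigma_algebra setT G) (Gm : G `<=` measurable).
Implicit Types (B K : set (Omega -> R)) (xi zeta : Omega -> R).

Local Notation L1 f := (P.-integrable setT (EFin \o f)).
Local Notation E f := (Rintegral P setT f).

Lemma L0_measurable xi : L0 G xi -> measurable_fun setT xi.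
Proof. by move=> mx _ Y mY; rewrite setTI; apply/Gm/mx. Qed.

Lemma topologically_sequentially B : B `<=` L0 G ->
  topologically_bounded P G B -> sequentially_bounded P B.
Proof.
move=> BL tB xi a Bxi a0 e e0.
have mset (x : R) f : L0 G f -> measurable [set w | x <= `|f w|].
  by move=> Lf; apply: measurable_ge_norm; exact: L0_measurable.
have mS n : measurable [set w | e <= `|a n * xi n w|].
  by apply: (mset e (fun w => a n * xi n w)); apply: (sub_measurableZ sG); exact: BL.
apply/fine_cvgP; split; first by apply: nearW => n; exact: fin_num_measure.
apply/cvgrPdist_lt => e' e'0.
(* A basic neighborhood of zero uses a single parameter for the size and for the probability, so [m]
   has to serve both. *)
pose m := Num.min e e'; have m0 : 0 < m by rewrite lt_min e0.
have [c c0 Bc] : exists2 c : R, 0 < c & B `<=` scale_set c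
    [set xi | L0 G xi /\ (P [set w | (m <= `|xi w|)%R] < m%:E)%E].
  by apply: tB; exists m.
have ic0 : 0 < c^-1 by rewrite invr_gt0.
move/cvgrPdist_lt/(_ _ ic0) : a0; apply: filterS => n; rewrite sub0r normrN => an.
have [b [Lb Pb] xE] := Bc _ (Bxi n).
rewrite sub0r normrN ger0_norm ?fine_ge0// /comp.
rewrite -lte_fin fineK ?fin_num_measure//.
apply: (@le_lt_trans _ _ (P [set w | m <= `|b w|])); last first.
  by apply: lt_le_trans Pb _; rewrite lee_fin ge_min lexx orbT.
apply: le_measure; rewrite ?inE.
- exact: mS.
- exact: mset.
move=> w /=; rewrite xE mulrA normrM => h.
apply: (@le_trans _ _ e); first by rewrite ge_min lexx.
apply: le_trans h _; rewrite ler_piMl// normrM (gtr0_norm c0).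
by rewrite -ler_pdivlMr// div1r ltW.
Qed.

(** If no multiple (n+1) [U] contains [B], there are elements of [B] that stay outside a fixed
    neighborhood after division by n+1, against sequential boundedness with the null sequence
    1/(n+1). *)
Lemma sequentially_topologically B : B `<=` L0 G ->
  sequentially_bounded P B -> topologically_bounded P G B.
Proof.
move=> BL sB U [e e0 eU]; apply: contrapT => nU.
have H n : exists xi, B xi /\ (e%:E <= P [set w | (e <= `|n.+1%:R^-1 * xi w|)%R])%E.
  apply: contrapT => nH; apply: nU; exists n.+1%:R => // xi Bxi.
  exists (fun w => n.+1%:R^-1 * xi w); last first.
    by apply/funext => w; rewrite mulrA mulfV ?mul1r// pnatr_eq0.
  apply: eU; split; first by apply: (sub_measurableZ sG); exact: BL.
  rewrite ltNge; apply/negP => h; apply: nH; by exists xi.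
have [xi hxi] := choice H.
have := sB xi (fun n => n.+1%:R^-1) (fun n => (hxi n).1) cvg_harmonic e e0.
move=> /fine_cvgP[_ /cvgrPdist_lt /(_ e e0) [N _ /(_ N (leqnn N))]].
rewrite /= sub0r normrN ger0_norm ?fine_ge0// -lte_fin fineK ?fin_num_measure//; last first.
  apply: measurable_ge_norm; apply: L0_measurable; apply: (sub_measurableZ sG).
  exact: BL (hxi N).1.
by rewrite ltNge (hxi N).2.
Qed.

Lemma dominated_claims_L0 K : dominated_claims P G K `<=` L0 G.
Proof. by move=> xi [_ []]. Qed.

Lemma dominated_claims_solid K xi zeta : dominated_claims P G K xi -> L0 G zeta ->
  {ae P, forall w, 0 <= zeta w <= xi w} -> dominated_claims P G K zeta.
Proof.
move=> [[k [eta [Kk [Leta eta0] xE]]] [Lxi xi0]] Lz z; split; last first.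
  by split=> //; apply: filterS z => w /andP[].
exists k, (fun w => eta w + (xi w - zeta w)); split=> //.
  split; first by apply: (sub_measurableD sG) => //; exact: (sub_measurableB sG).
  by apply: filterS2 eta0 z => w h /andP[_ h']; rewrite addr_ge0// subr_ge0.
by apply/funext => w; rewrite xE; ring.
Qed.

Lemma dominated_claims_convex K (a b : R) : 0 <= a -> 0 <= b ->
  (forall k l, K k -> K l -> K (fun w => a * k w + b * l w)) ->
  forall xi zeta, dominated_claims P G K xi -> dominated_claims P G K zeta ->
  dominated_claims P G K (fun w => a * xi w + b * zeta w).
Proof.
move=> a0 b0 cK xi zeta [[k [eta [Kk [Le e0] ->]]] [Lx x0]] [[l [th [Kl [Lt t0] ->]]] [Lz z0]].
split; last first.
  split; first by apply: (sub_measurableD sG); exact: (sub_measurableZ sG).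
  by apply: filterS2 x0 z0 => w h1 h2; rewrite addr_ge0// mulr_ge0.
exists (fun w => a * k w + b * l w), (fun w => a * eta w + b * th w); split.
- exact: cK.
- split; first by apply: (sub_measurableD sG); exact: (sub_measurableZ sG).
  by apply: filterS2 e0 t0 => w h1 h2; rewrite addr_ge0// mulr_ge0.
- by apply/funext => w; ring.
Qed.

Lemma gauge_not_gt0 B xi : ~ (0 < gauge B xi)%E ->
  forall e : R, 0 < e -> exists a : R, [/\ 0 < a, a < e & scale_set a B xi].
Proof.
move=> /negP; rewrite -leNgt => g0 e e0.
have : (gauge B xi < e%:E)%E by rewrite (le_lt_trans g0)// lte_fin.
by move=> /ereal_inf_lt[_ [a [a0 sa] <-]]; rewrite lte_fin => ae; exists a.
Qed.

(** If the gauge of [xi] is 0, then [xi] is a_n b_n with a_n below 1/(n+1) and b_n in the set of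
    dominated claims. So the constant sequence [xi] tends to 0 in probability. *)
Lemma sequentially_NA1 K : sequentially_bounded P (dominated_claims P G K) -> NA1 P G K.
Proof.
move=> sB xi [[Lxi xi0] nz]; apply: contrapT => /gauge_not_gt0 g0.
have H n : exists ab : R * (Omega -> R), [/\ 0 < ab.1, ab.1 < n.+1%:R^-1,
    dominated_claims P G K ab.2 & xi = (fun w => ab.1 * ab.2 w)].
  have n0 : 0 < n.+1%:R^-1 :> R by rewrite invr_gt0.
  by have [a [a0 an [b Bb xE]]] := g0 _ n0; exists (a, b).
have [ab hab] := choice H.
apply: nz; split=> //.
apply: cvg0_in_probability_cst; first exact: L0_measurable.
have xiE : (fun=> xi) = (fun n w => (ab n).1 * (ab n).2 w).
  by apply/funext => n; case: (hab n).
rewrite xiE; apply: (sB (fun n => (ab n).2) (fun n => (ab n).1)) => [n|].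
  by case: (hab n).
apply: (@squeeze_cvgr _ _ _ _ (fun=> 0) (fun n => n.+1%:R^-1)).
- by apply: nearW => n; case: (hab n) => h1 h2 _ _; rewrite (ltW h1) (ltW h2).
- exact: cvg_cst.
- exact: cvg_harmonic.
Qed.

Lemma mean_indic (A : set Omega) : measurable A -> E (\1_A) = fine (P A).
Proof. by move=> mA; rewrite /Rintegral integral_indic// setIT. Qed.

(* Almost minimisers of E[g^2] over a decreasing sequence of convex sets form
   a Cauchy sequence in L^2, by the parallelogram identity. *)
Lemma convex_L2_cauchy (C : nat -> set (Omega -> R)) (dl : nat -> R) :
  (forall n, C n !=set0) -> (forall m n, (m <= n)%N -> C n `<=` C m) ->
  (forall n g, C n g -> measurable_fun setT g /\ forall w, 0 <= g w <= 1) ->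
  (forall n g h, C n g -> C n h -> C n (fun w => (g w + h w) / 2)) ->
  (forall n, 0 < dl n) -> (forall m n, (m <= n)%N -> dl n <= dl m) ->
  exists g : nat -> Omega -> R, (forall n, C n (g n)) /\
    forall m n, (m <= n)%N -> E (fun w => (g m w - g n w) ^+ 2) <= 8 * dl m.
Proof.
move=> C0 Cd Cb Cc dl0 dld.
pose v (g : Omega -> R) := E (fun w => g w ^+ 2).
have Lsq g h (a b : R) n m : C n g -> C m h -> L1 (fun w => (a * g w + b * h w) ^+ 2).
  move=> /Cb[mg g1] /Cb[mh h1]; apply: (@L1_bounded _ _ _ _ _ ((`|a| + `|b|) ^+ 2)).
    by apply: measurable_funX; apply: measurable_funD; apply: measurable_funM.
  move=> w; rewrite normrX lerXn2r ?nnegrE ?addr_ge0//.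
  apply: le_trans (ler_normD _ _) _; rewrite !normrM lerD// ler_piMr//.
    by rewrite ler_norml; case/andP: (g1 w) => h0 h2; rewrite h2 andbT; lra.
  by rewrite ler_norml; case/andP: (h1 w) => h0 h2; rewrite h2 andbT; lra.
have Lg g n : C n g -> L1 (fun w => g w ^+ 2).
  by move=> Cg; have := Lsq g g 1 0 n n Cg Cg; under eq_fun do rewrite mul1r mul0r addr0.
(* The infima of the second moments increase as the sets shrink, and they are bounded by 1. *)
pose V n := [set v g | g in C n].
pose a n := inf (V n).
have Vinf n : has_inf (V n).
  split; first by have [g Cg] := C0 n; exists (v g), g.
  by exists 0 => _ [g _ <-]; apply: Rintegral_ge0 => w _; exact: sqr_ge0.
have a1 n : a n <= 1.
  have [g Cg] := C0 n; apply: (@le_trans _ _ (v g)).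
    by apply: ge_inf; [exact: (Vinf n).2|exists g].
  rewrite -[leRHS](mean_cst P 1); apply: le_mean; [exact: Lg Cg|exact: L1_cst|] => w.
  by have [_ /(_ w)/andP[g0 g1]] := Cb _ _ Cg; rewrite exprn_ile1.
pose A := range a.
have As : has_sup A by split; [exists (a 0%N), 0%N|exists 1 => _ [n _ <-]].
have and_ m n : (m <= n)%N -> a m <= a n.
  move=> mn; apply: lb_le_inf; first exact: (Vinf n).1.
  by move=> _ [g Cg <-]; apply: ge_inf; [exact: (Vinf m).2|exists g => //; exact: Cd mn _ Cg].
have aA n : a n <= sup A by apply: ub_le_sup; [exact: As.2|exists n].
(* [N] is taken so late that the infimum over [C N] is nearly the supremum [sup A] of all infima;
   this bounds the second moments of midpoints from below. *)
have step k : exists g, exists N, [/\ (k <= N)%N, C N g, sup A - dl k < a N & v g < sup A + dl k].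
  have [_ [N _ <-] hN] := sup_adherent (dl0 k) As.
  have [_ [g Cg <-] hg] := inf_adherent (dl0 k) (Vinf (maxn k N)).
  exists g, (maxn k N); split=> //; first exact: leq_maxl.
    by apply: lt_le_trans hN (and_ _ _ (leq_maxr _ _)).
  by apply: lt_le_trans hg _; rewrite lerD2r aA.
have [g hg] := choice step; have [N {}hg] := choice hg.
exists g; split=> [n|m n mn]; first by case: (hg n) => kN Cg _ _; exact: Cd kN _ Cg.
have [mN Cm am vm] := hg m; have [nN Cn an vn] := hg n.
have dmn := dld _ _ mn.
pose M := minn (N m) (N n).
have CM : C M (fun w => (g m w + g n w) / 2).
  by apply: Cc; [exact: Cd (geq_minl _ _) _ Cm|exact: Cd (geq_minr _ _) _ Cn].
have aM : sup A - dl m < a M.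
  by rewrite /M /minn; case: ifP => _ //; apply: le_lt_trans an; lra.
have vM : a M <= v (fun w => (g m w + g n w) / 2).
  by apply: ge_inf; [exact: (Vinf M).2|exists (fun w => (g m w + g n w) / 2)].
(* Parallelogram identity. The terms sup A cancel and 2 dl m + 2 dl n + 4 dl m remains, at most 8 dl
   m. *)
have -> : E (fun w => (g m w - g n w) ^+ 2) =
    2 * v (g m) + 2 * v (g n) - 4 * v (fun w => (g m w + g n w) / 2).
  have l1 := Lg _ _ Cm; have l2 := Lg _ _ Cn; have l3 := Lg _ _ CM.
  rewrite /v -!meanZ// -meanD; [|exact: L1Z|exact: L1Z].
  rewrite -meanB; [|by apply: L1D; exact: L1Z|exact: L1Z].
  by apply: eq_Rintegral => w _; field.
lra.
Qed.

Lemma probability_chebyshev_sq (f : Omega -> R) (c x : R) : measurable_fun setT f ->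
  L1 (fun w => f w ^+ 2) -> 0 < c -> E (fun w => f w ^+ 2) <= c ^+ 2 * x ->
  (P [set w | (c <= `|f w|)%R] <= x%:E)%E.
Proof.
move=> mf lf c0 Ex; have mA := measurable_ge_norm c mf.
rewrite -[leLHS]fineK ?fin_num_measure// lee_fin -mean_indic//.
rewrite -(ler_pM2l (x := c ^+ 2)) ?exprn_gt0//; apply: le_trans Ex.
have lA : L1 (\1_[set w | c <= `|f w|]) by exact: integrable_indic.
rewrite -meanZ//; apply: le_mean => [||w]; [exact: L1Z|by []|].
rewrite indicE; have [/set_mem/= h|_] := boolP (_ \in _).
  by rewrite mulr1 -[leRHS]real_normK ?num_real// lerXn2r ?nnegrE// ltW.
by rewrite mulr0 sqr_ge0.
Qed.

Lemma NA1_topologically K :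
  (forall k l, K k -> K l -> K (fun w => 2^-1 * k w + 2^-1 * l w)) ->
  NA1 P G K -> topologically_bounded P G (dominated_claims P G K).
Proof.
move=> cK na U [e e0 eU]; apply: contrapT => nU.
set B := dominated_claims P G K in nU.
have BL : B `<=` L0 G := @dominated_claims_L0 K.
have cst c := sub_measurable_cst (R := R) sG c.
(* These sets decrease in [n] because [B] is solid and contain midpoints because [B] does. *)
pose C n := [set g : Omega -> R | [/\ sub_measurable G g, forall w, 0 <= g w <= 1,
   e <= E g & B (fun w => e * n.+1%:R * g w)]].
have L1C n g : C n g -> L1 g.
  move=> [mg g1 _ _]; apply: (@L1_bounded _ _ _ _ _ 1); first exact: L0_measurable.
  by move=> w; case/andP: (g1 w) => g0 ?; rewrite ger0_norm.
have C0 n : C n !=set0.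
  have [xi [Bxi xe]] : exists xi, B xi /\ (e%:E <= P [set w | (e <= `|n.+1%:R^-1 * xi w|)%R])%E.
    apply: contrapT => nH; apply: nU; exists n.+1%:R => // xi Bxi.
    exists (fun w => n.+1%:R^-1 * xi w); last first.
      by apply/funext => w; rewrite mulrA mulfV ?mul1r// pnatr_eq0.
    apply: eU; split; first by apply: (sub_measurableZ sG); exact: BL.
    rewrite ltNge; apply/negP => h; apply: nH; by exists xi.
  have Lx : L0 G (fun w => n.+1%:R^-1 * xi w) by apply: (sub_measurableZ sG); exact: BL.
  pose A := [set w | e <= `|n.+1%:R^-1 * xi w|].
  have GA : G A by apply: (sub_measurable_le sG) => //; exact: (sub_measurable_norm sG).
  have m1 := sub_measurable_indic (R := R) sG GA.
  (* On [A] the claim [xi] is at least e (n+1), so by solidity this multiple of the indicator of [A]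
     lies in [B]. *)
  exists (\1_A); split=> //.
  - by move=> w; rewrite indicE; case: (_ \in _); rewrite /= ?lexx ?ler01.
  - rewrite mean_indic; last exact: Gm.
    by rewrite -lee_fin fineK// fin_num_measure//; exact: Gm.
  - apply: (dominated_claims_solid Bxi); first exact: (sub_measurableZ sG).
    case: Bxi => _ [_]; apply: filterS => w x0.
    rewrite indicE; have [/set_mem/= h|_] := boolP (_ \in _); last by rewrite mulr0 lexx.
    rewrite /A/= ger0_norm ?mulr_ge0 ?invr_ge0// in h.
    by rewrite mulr1 mulr_ge0 ?(ltW e0)//= -ler_pdivlMr// mulrC.
(* The series of the [eta k] sums to e / 4, half of the margin e / 2 available for [g 0] and for its
   level set [A0]. *)
pose eta k : R := e / 8 * 2^-1 ^+ k.
have h20 : 0 < 2^-1 :> R by rewrite invr_gt0.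
have eta0 k : 0 < eta k by rewrite /eta mulr_gt0 ?exprn_gt0// divr_gt0.
(* Then 8 dl k is (eta k)^2 times eta k, and Chebyshev's inequality at level [eta k] bounds the
   probability of [bad k] by [eta k]. *)
pose dl k := eta k ^+ 3 / 8.
have [g [Cg gd]] : exists g : nat -> Omega -> R, (forall n, C n (g n)) /\
    forall m n, (m <= n)%N -> E (fun w => (g m w - g n w) ^+ 2) <= 8 * dl m.
  apply: convex_L2_cauchy => //.
  - move=> m n mn f [mf f1 Ef Bf]; split=> //.
    apply: (dominated_claims_solid Bf); first exact: (sub_measurableZ sG).
    apply: aeW => w; case/andP: (f1 w) => f0 _.
    by rewrite !mulr_ge0 ?(ltW e0)//= ler_wpM2r// ler_wpM2l ?(ltW e0)// ler_nat.
  - by move=> n f [mf f1 _ _]; split=> //; exact: L0_measurable.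
  - move=> n f h Cf Ch; have lf := L1C _ _ Cf; have lh := L1C _ _ Ch.
    case: Cf Ch => mf f1 Ef Bf [mh h1 Eh Bh].
    have cE : (fun w => (f w + h w) / 2) = (fun w => 2^-1 * f w + 2^-1 * h w).
      by apply/funext => w; field.
    split.
    + by rewrite cE; apply: (sub_measurableD sG); exact: (sub_measurableZ sG).
    + by move=> w; case/andP: (f1 w) => ? ?; case/andP: (h1 w) => ? ?; apply/andP; split; lra.
    + by rewrite cE meanD; [rewrite !meanZ//; lra|exact: L1Z|exact: L1Z].
    + rewrite (_ : (fun w => _) = (fun w => 2^-1 * (e * n.+1%:R * f w) + 2^-1 * (e * n.+1%:R *
      h w))).
        exact: (dominated_claims_convex (ltW h20) (ltW h20) cK).
      by apply/funext => w; rewrite (congr1 (@^~ w) cE); ring.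
  - by move=> n; rewrite /dl divr_gt0// exprn_gt0.
  - move=> m n mn; rewrite /dl ler_wpM2r ?invr_ge0// lerXn2r ?nnegrE ?(ltW (eta0 _))//.
    rewrite /eta ler_wpM2l ?divr_ge0 ?(ltW e0)//.
    by rewrite ler_wiXn2l// ?(ltW h20)// invf_le1//; lra.
pose bad k := [set w | eta k <= `|g k w - g k.+1 w|].
have mg k : sub_measurable G (g k) by case: (Cg k).
have Gbad k : G (bad k).
  apply: (sub_measurable_le sG) => //; apply: (sub_measurable_norm sG).
  exact: (sub_measurableB sG).
have Pbad k : (P (bad k) <= (eta k)%:E)%E.
  have mgd : measurable_fun setT (fun w => g k w - g k.+1 w).
    by apply: L0_measurable; exact: (sub_measurableB sG).
  apply: probability_chebyshev_sq => //.
    apply: (@L1_bounded _ _ _ _ _ 1); first exact: measurable_funX.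
    move=> w; case: (Cg k) => _ /(_ w)/andP[? ?] _ _; case: (Cg k.+1) => _ /(_ w)/andP[? ?] _ _.
    rewrite normrX exprn_ile1// ler_norml; apply/andP; split; lra.
  apply: le_trans (gd k k.+1 (leqnSn k)) _.
  by rewrite /dl (_ : 8 * _ = eta k ^+ 2 * eta k)//; field.
have sum_eta n : \sum_(k < n) eta k <= e / 4 - 2 * eta n.
  elim: n => [|n IH]; first by rewrite big_ord0 /eta expr0; lra.
  rewrite big_ord_recr/= (_ : eta n.+1 = eta n / 2); last by rewrite /eta exprSr mulrA.
  by move: IH; set s := \sum_(_ < _) _; lra.
(* Since [g 0] has mean at least e and is at most the indicator of [A0] plus e / 2, the set has
   probability at least e / 2; removing the bad sets costs at most e / 4. *)
pose A0 := [set w | e / 2 <= g 0%N w].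
have GA0 : G A0 by exact: (sub_measurable_le sG).
have mbad : measurable (\bigcup_k bad k) by apply: bigcupT_measurable => k; exact: Gm.
have PA0 : ((e / 2)%:E <= P A0)%E.
  rewrite -[leRHS]fineK ?fin_num_measure ?lee_fin//; last exact: Gm.
  rewrite -mean_indic; last exact: Gm.
  have [_ g1 Eg _] := Cg 0%N; have lg := L1C _ _ (Cg 0%N).
  have lA : L1 (\1_A0) by apply: integrable_indic; exact: Gm.
  have : E (g 0%N) <= E (fun w => \1_A0 w + e / 2).
    apply: le_mean => // [|w]; first by apply: L1D => //; exact: L1_cst.
    rewrite indicE; have [_|nA] := boolP (w \in A0); case/andP: (g1 w) => ? ?.
      by rewrite /=; lra.
    rewrite /= add0r leNgt; apply/negP => h; move/negP: nA; apply; apply/mem_set.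
    by rewrite /A0/= ltW.
  rewrite meanD//; last exact: L1_cst.
  by rewrite mean_cst; lra.
have PU : (P (\bigcup_k bad k) <= (e / 4)%:E)%E.
  apply: le_trans (generalized_Boole_inequality _ _ _) _ => //; first by move=> k; exact: Gm.
  apply: lime_le; first exact: is_cvg_nneseries.
  apply: nearW => n; rewrite big_mkord.
  apply: (@le_trans _ _ (\sum_(k < n) (eta k)%:E)%E); first by apply: lee_sum => k _; exact: Pbad.
  by rewrite sumEFin lee_fin (le_trans (sum_eta n))// lerBlDr lerDl mulr_ge0// ltW.
pose A := A0 `\` \bigcup_k bad k.
have GA : G A.
  rewrite /A setDE setC_bigcup; apply: (sub_sigma_setI sG) => //; apply: (sub_sigma_bigcap sG)
    => k.
  exact: (sub_sigma_setC sG).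
have PA : (0 < P A)%E.
  rewrite lt0e measure_ge0 andbT; apply/eqP => PA0'.
  have : (P A0 <= P A + P (\bigcup_k bad k))%E.
    apply: (@le_trans _ _ (P (A `|` \bigcup_k bad k))).
      apply: le_measure; rewrite ?inE; [exact: Gm|by apply: measurableU => //; exact: Gm|].
      by rewrite /A setDUl setDv setU0 || move=> w wA;
        have [|] := pselect ((\bigcup_k bad k) w); [right|left].
    by apply: measureU2 => //; exact: Gm.
  rewrite PA0' add0e => /(le_trans PA0)/le_trans/(_ PU).
  by rewrite lee_fin; lra.
(* Off the bad sets the sequence moves by less than e / 4 in total from its initial value, which is
   at least e / 2. *)
have gA k w : A w -> e / 4 <= g k w.
  move=> [Aw nb].
  have H n : g 0%N w - \sum_(j < n) eta j <= g n w.
    elim: n => [|n IH]; first by rewrite big_ord0 subr0.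
    have : `|g n w - g n.+1 w| < eta n.
      by rewrite ltNge; apply/negP => h; apply: nb; exists n.
    rewrite big_ord_recr/= ltr_norml => /andP[_ h2].
    by move: IH; set s := \sum_(_ < _) _; lra.
  have := H k; have := sum_eta k; have := eta0 k; rewrite /A0/= in Aw.
  by set s := \sum_(_ < _) _; lra.
have m1A := sub_measurable_indic (R := R) sG GA.
have : (0 < gauge B (\1_A))%E.
  apply: na; split.
    by split=> //; apply: aeW => w; rewrite indicE; case: (_ \in _); rewrite /= ?lexx ?ler01.
  move=> [_ z]; have : P A = 0%E.
    apply: measure_negligible; first exact: Gm.
    by apply: negligibleS z => w Aw /=; rewrite indicE mem_set//= => /eqP; rewrite oner_eq0.
  by move=> PA'; rewrite PA' ltxx in PA.
apply/negP; rewrite -leNgt.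
apply/lee_addgt0Pr => x x0; rewrite add0e.
(* On [A] the claim e (k+1) g_k of [B] is at least [c k], so [B] contains all multiples [c k] of the
   indicator of [A]. As [c k] is unbounded, the gauge of this indicator is 0. *)
pose c k : R := e * k.+1%:R * (e / 4).
have c0 k : 0 < c k by rewrite /c !mulr_gt0// divr_gt0.
have Bc k : B (fun w => c k * \1_A w).
  case: (Cg k) => _ g1 _ Bg; apply: (dominated_claims_solid Bg);
    first exact: (sub_measurableZ sG).
  apply: aeW => w; case/andP: (g1 w) => g0 _.
  rewrite indicE; have [/set_mem wA|_] := boolP (_ \in _);
    last by rewrite mulr0 lexx !mulr_ge0// ltW.
  by rewrite mulr1 (ltW (c0 k))/= /c ler_wpM2l ?mulr_ge0 ?(ltW e0)// gA.
pose k := Num.truncn (x^-1 / (e * (e / 4))).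
have ck : x^-1 <= c k.
  have ee0 : 0 < e * (e / 4) by rewrite mulr_gt0// divr_gt0.
  have := ltW (truncnS_gt (x^-1 / (e * (e / 4)))); rewrite -/k ler_pdivrMr// => /le_trans; apply.
  by rewrite /c le_eqVlt; apply/orP; left; apply/eqP; ring.
apply: (@le_trans _ _ ((c k)^-1)%:E); last first.
  by rewrite lee_fin -[leRHS]invrK lef_pV2 ?posrE// invr_gt0.
apply: ereal_inf_lbound; exists ((c k)^-1) => //; split; first by rewrite invr_gt0.
exists (fun w => c k * \1_A w) => //.
by apply/funext => w; rewrite mulrA mulVf ?mul1r// gt_eqF.
Qed.

End BoundednessInProbability.

(** * The families of terminal values *)

Section AlmostSure.
Context {d : measure_display} {Omega : measurableType d} {R : realType}.
Variables (P : probability Omega R) (F : R -> set (set Omega)).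
Hypothesis hF : filtration F.

(** The whole space is not negligible; this extracts deterministic facts from almost sure ones. *)
Lemma ae_cst (Q : Prop) : {ae P, forall w : Omega, Q} -> Q.
Proof.
move=> nQ; apply: contrapT => q.
have : P.-negligible [set: Omega] by apply: negligibleS nQ => w _.
move=> /(measure_negligible measurableT) P0.
by have := probability_setT P; rewrite P0 => /eqP; rewrite eqe eq_sym oner_eq0.
Qed.

Lemma probability1_ae (A : set Omega) : measurable A -> P A = 1%E ->
  {ae P, forall w, A w}.
Proof.
move=> mA PA; apply/negligibleP; first exact: measurableC.
by have := probability_setC P mA; rewrite PA subee.
Qed.

(** The distribution function of [f] takes only the values 0 and 1, and the constant is the point
    [inf V] where it jumps. No jump at all would force [f] to be infinite a.s. *)
Lemma trivial_measurable_constant (f : Omega -> R) :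
  trivial_sigma_algebra P (F 0) -> sub_measurable (F 0) f ->
  exists c, {ae P, forall w, f w = c}.
Proof.
move=> triv mf; have [s0 m0] := hF.1 _ (lexx 0).
pose A x := [set w | f w <= x].
have FA x : F 0 (A x) by apply: (sub_measurable_le s0) => //; exact: sub_measurable_cst.
have mA x : measurable (A x) by exact: m0.
have A0 x : P (A x) = 0%E -> {ae P, forall w, x < f w}.
  move=> PA; have nA : P.-negligible (A x) by apply/negligibleP.
  by apply: negligibleS nA => w /negP; rewrite -leNgt.
pose V := [set x | P (A x) = 1%E].
have V0 : V !=set0.
  apply: contrapT => nV; apply: ae_cst.
  have : {ae P, forall w, forall n : nat, n%:R < f w}.
    apply: ae_foralln => n; apply: A0; case: (triv _ (FA n%:R)) => // PA.
    by exfalso; apply: nV; exists n%:R.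
  apply: filterS => w /(_ (Num.truncn (f w)).+1) h.
  by have := lt_trans (truncnS_gt (f w)) h; rewrite ltxx.
have Vlb : has_lbound V.
  apply: contrapT => nV; apply: ae_cst.
  have : {ae P, forall w, forall n : nat, f w <= - n%:R}.
    apply: ae_foralln => n.
    have [x [Vx xn]] : exists x, V x /\ x < - n%:R.
      apply: contrapT => nx; apply: nV; exists (- n%:R) => x Vx.
      by rewrite leNgt; apply/negP => xn; apply: nx; exists x.
    by apply: filterS (probability1_ae (mA x) Vx) => w /le_trans; apply; exact: ltW.
  apply: filterS => w /(_ (Num.truncn (- f w)).+1).
  by rewrite lerNr leNgt truncnS_gt.
exists (inf V).
have h1 : {ae P, forall w, forall n : nat, f w <= inf V + n.+1%:R^-1}.
  apply: ae_foralln => n.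
  have n0 : 0 < n.+1%:R^-1 :> R by rewrite invr_gt0.
  have [x Vx xn] := inf_adherent n0 (conj V0 Vlb).
  by apply: filterS (probability1_ae (mA x) Vx) => w /le_trans; apply; exact: ltW.
have h2 : {ae P, forall w, forall n : nat, inf V - n.+1%:R^-1 < f w}.
  apply: ae_foralln => n; apply: A0; case: (triv _ (FA (inf V - n.+1%:R^-1))) => // PA.
  have : inf V <= inf V - n.+1%:R^-1 by apply: ge_inf.
  by rewrite lerBrDl gerDr leNgt invr_gt0 ltr0n.
apply: filterS2 h1 h2 => w f1 f2; apply/eqP; rewrite eq_le; apply/andP; split.
  apply/ler_addgt0Pr => e e0; apply: le_trans (f1 (Num.truncn e^-1)) _.
  by rewrite lerD2l -[leRHS]invrK lef_pV2 ?posrE ?invr_gt0//; exact/ltW/truncnS_gt.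
apply/ler_addgt0Pr => e e0; rewrite -lerBlDr; apply: le_trans (ltW (f2 (Num.truncn e^-1))).
by rewrite lerB// -[leRHS]invrK lef_pV2 ?posrE ?invr_gt0//; exact/ltW/truncnS_gt.
Qed.

End AlmostSure.

(** * The cone property and nonnegative elements of the six families *)

Section Families.
Context {d : measure_display} {Omega : measurableType d} {R : realType}.
Variables (P : probability Omega R) (F : R -> set (set Omega)).
Hypotheses (hF : filtration F) (hU : usual_conditions P F).
Variable I : choiceType.
Implicit Types (X Y : process R Omega) (S delta : I -> process R Omega).

Local Notation P0 := ((fun=> fun=> 0) : process R Omega).

Local Notation elements A := (finmap.enum_fset (fset_set A)).

Lemma investments_lin S (alpha beta x y : R) X X' :
  investments P F S alpha X -> investments P F S beta X' ->
  investments P F S (x * alpha + y * beta) (fun t w => x * X t w + y * X' t w).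
Proof.
move=> [dl [Y [iY XE]]] [dl' [Y' [iY' XE']]].
exists (combine_strategies P x y dl dl'), (fun t w => x * Y t w + y * Y' t w); split.
  exact: strategy_integral_combine.
by apply: filterS2 XE XE' => w h h' t t0; rewrite h// h'//; ring.
Qed.

Lemma sf_portfolios_lin S (alpha beta x y : R) X X' :
  sf_portfolios P F S alpha X -> sf_portfolios P F S beta X' ->
  sf_portfolios P F S (x * alpha + y * beta) (fun t w => x * X t w + y * X' t w).
Proof.
move=> [dl [[Y iY sY] a0 XE]] [dl' [[Y' iY' sY'] b0 XE']].
have pE := portfolio_combine x y S iY.1 iY'.1.
exists (combine_strategies P x y dl dl'); split.
- exists (fun t w => x * Y t w + y * Y' t w); first exact: strategy_integral_combine.
  apply: filterS3 pE sY sY' => w h1 h2 h3 t t0.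
  by rewrite !h1// h2// h3//; ring.
- by apply: filterS3 pE a0 b0 => w h1 h2 h3; rewrite h1// h2 h3.
- by apply: filterS3 pE XE XE' => w h1 h2 h3 t t0; rewrite h1// h2// h3.
Qed.

Lemma bounded_below_lin (a b x y : R) X X' : 0 <= x -> 0 <= y ->
  bounded_below_by P a X -> bounded_below_by P b X' ->
  bounded_below_by P (x * a + y * b) (fun t w => x * X t w + y * X' t w).
Proof.
by move=> x0 y0; apply: filterS2 => w h h' t t0; rewrite lerD// ler_wpM2l ?h ?h'.
Qed.

Lemma admissible_lin (x y : R) X X' : 0 <= x -> 0 <= y ->
  admissible P X -> admissible P X' -> admissible P (fun t w => x * X t w + y * X' t w).
Proof.
move=> x0 y0 [a a0 aX] [b b0 bX]; exists (x * a + y * b).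
  by rewrite addr_ge0// mulr_ge0.
by rewrite opprD -!mulrN; exact: bounded_below_lin.
Qed.

Lemma nonneg_process_lin (x y : R) X X' : 0 <= x -> 0 <= y ->
  nonneg_process P X -> nonneg_process P X' ->
  nonneg_process P (fun t w => x * X t w + y * X' t w).
Proof.
move=> x0 y0 h h'; have := bounded_below_lin x0 y0 h h'.
by rewrite !mulr0 addr0.
Qed.

Lemma nonneg_admissible : nonneg_process P `<=` admissible P.
Proof. by move=> X X0; exists 0 => //; rewrite oppr0. Qed.

Lemma terminal_values_lin T (x y : R) (C C' C'' : set (process R Omega)) xi xi' : 0 <= T ->
  (forall X X', C X -> C' X' -> C'' (fun t w => x * X t w + y * X' t w)) ->
  terminal_values P F T C xi -> terminal_values P F T C' xi' ->
  terminal_values P F T C'' (fun w => x * xi w + y * xi' w).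
Proof.
move=> T0 CC [Lx [X CX xE]] [Lx' [X' CX' xE']]; have sG := (hF.1 _ T0).1.
split; first by apply: (sub_measurableD sG); exact: (sub_measurableZ sG).
exists (fun t w => x * X t w + y * X' t w); first exact: CC.
by apply: filterS2 xE xE' => w -> ->.
Qed.

(** Coefficients x and 0 give scaling, 1/2 and 1/2 give convexity. Nonnegative coefficients preserve
    the bounds from below. *)
Lemma families_cone S T (K : R -> set (Omega -> R)) : 0 <= T ->
  (K = K_I P F S T \/ K = K_I_adm P F S T \/ K = K_I_plus P F S T \/
   K = K_P P F S T \/ K = K_P_adm P F S T \/ K = K_P_plus P F S T) ->
  forall alpha beta x y k l, 0 <= x -> 0 <= y -> K alpha k -> K beta l ->
    K (x * alpha + y * beta) (fun w => x * k w + y * l w).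
Proof.
move=> T0 KE alpha beta x y k l x0 y0.
case: KE => [->|[->|[->|[->|[->|->]]]]]; apply: terminal_values_lin => // X X'.
- exact: investments_lin.
- by move=> [h1 h2] [h3 h4]; split; [exact: investments_lin|exact: admissible_lin].
- by move=> [h1 h2] [h3 h4]; split; [exact: investments_lin|exact: nonneg_process_lin].
- exact: sf_portfolios_lin.
- by move=> [h1 h2] [h3 h4]; split; [exact: sf_portfolios_lin|exact: admissible_lin].
- by move=> [h1 h2] [h3 h4]; split; [exact: sf_portfolios_lin|exact: nonneg_process_lin].
Qed.

Lemma semimartingale_increment (c : R) X : semimartingale P F X ->
  semimartingale P F (fun t w => c * (X t w - X 0 w)).
Proof.
move=> [aX cX [M [A [lM vA M0 A0 XE]]]].
have s0 := (hF.1 _ (lexx 0)).1.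
split.
- move=> t t0; have sG := (hF.1 _ t0).1.
  apply: (sub_measurableZ sG); apply: (sub_measurableB sG); first exact: aX.
  by move=> B mB; apply: hF.2 t0 _ _ => //; exact: aX.
- rewrite (_ : (fun t w => _) = (fun t w => c * X t w + (- c * X 0 w) * 1)).
    apply: (cadlag_lin (fun=> c) (fun w => - c * X 0 w)) => //.
    by move=> w; split=> t t0; [exact: cvg_cst|exact: is_cvg_cst].
  by apply/funext => t; apply/funext => w; ring.
(* The zero second summands give the two-term form of [local_martingale_lin] and
   [finite_variation_lin]. *)
exists (fun t w => c * M t w + 0 * M t w), (fun t w => c * A t w + 0 * A t w); split.
- exact: local_martingale_lin.
- exact: finite_variation_lin.
- by move=> w; rewrite M0 !mulr0 addr0.
- by move=> w; rewrite A0 !mulr0 addr0.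
- by apply: filterS XE => w h t t0; rewrite h//; ring.
Qed.

(** Elementary integrals see only increments of the integrator, so subtracting [X 0] leaves the
    operator unchanged. *)
Lemma integral_operator_increment (c : R) X J : integral_operator P F X J ->
  integral_operator P F (fun t w => c * (X t w - X 0 w)) (fun H t w => c * J H t w + 0 * J H t w).
Proof.
move=> iJ; case: (integral_operator_lin hF c 0 iJ iJ) => j1 j2 j3 j4 j5; split=> //.
move=> f r s r0 rs mf bf; apply: filterS (j3 f r s r0 rs mf bf) => w h t t0.
by rewrite h//; ring.
Qed.

Definition hold (i : I) (c : R) : I -> process R Omega :=
  fun j => if j == i then (fun=> fun=> c) else P0.

Lemma support_hold i c : c != 0 -> strategy_support P (hold i c) = [set i].
Proof.
move=> c0; apply/seteqP; split=> j /=.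
  move=> nj; apply: contrapT => /eqP ji; apply: nj.
  by rewrite /hold (negbTE ji); exact: indist_refl.
move=> ->; rewrite /strategy_support/= /hold eqxx => h.
suff /eqP : c = 0 by rewrite (negbTE c0).
by apply: (ae_cst (P := P)); apply: filterS h => w; apply.
Qed.

Lemma hold_integral S i c J : c != 0 -> semimartingale P F (S i) ->
  integral_operator P F (S i) J ->
  strategy_integral P F S (hold i c) (fun t w => c * (S i t w - S i 0 w)).
Proof.
move=> c0 sS iJ; rewrite /strategy_integral support_hold//; split=> //.
have ph : predictable F (hold i c i) by rewrite /hold eqxx; exact: predictable_cst.
split.
- by move=> j ->.
- exact: semimartingale_increment.
- by apply: aeW => w; rewrite subrr mulr0.
exists (fun=> J), (fun H t w => c * J H t w + 0 * J H t w); split.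
- by move=> j ->.
- exact: integral_operator_increment.
move=> n; rewrite (_ : (fun t w => \sum_(j \in _) _) = J (fun s v
  => c * trunc_indic [set i] (hold i c) n s v)).
  apply: indist_sym.
  have pT : predictable F (trunc_indic [set i] (hold i c) n).
    by apply: predictable_trunc => // j ->.
  apply: filterS (regularZ (integral_regular iJ) c pT (bounded_trunc _ _ _)) => w h t t0.
  by rewrite h//; ring.
apply/funext => t; apply/funext => w; rewrite fsbig_set1.
by rewrite /hold eqxx.
Qed.

Lemma zero_integral S : (exists i, semimartingale P F (S i)) ->
  strategy_integral P F S (fun=> P0) P0.
Proof.
move=> [i sS].
have supp : strategy_support P (fun=> P0 : process R Omega) = set0 :> set I.
  by apply/seteqP; split=> // j; apply; exact: indist_refl.
rewrite /strategy_integral supp; split=> //; split=> //.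
(* The zero process is a semimartingale as a combination of a price process with coefficients 0. *)
- have := semimartingale_lin hF 0 0 sS sS.
  by congr semimartingale; apply/funext => t; apply/funext => w; rewrite !mul0r addr0.
- exact: aeW.
exists (fun=> fun=> P0), (fun=> P0); split=> //.
- have [r1 r2 r3] := regular_operator0 P hF; split=> //.
    by move=> f _ _; exact: indist_refl.
  by move=> f r s _ _ _ _; apply: aeW => w t t0; rewrite subrr mulr0.
- by move=> n; apply: aeW => w t t0; rewrite fsbig_set0.
Qed.

Lemma investments_one S : (exists i, semimartingale P F (S i)) ->
  investments P F S 1 (fun=> fun=> 1).
Proof.
move=> sS; exists (fun=> P0), P0; split; first exact: zero_integral.
by apply: aeW => w t t0; rewrite addr0.
Qed.

(* If some portfolio starts at 1, then one of the assets it holds has a nonzero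
   initial price, which is constant since F_0 is trivial; buying and holding
   that asset gives a nonnegative portfolio with initial value 1. *)
Lemma sf_portfolios_hold S X : trivial_sigma_algebra P (F 0) ->
  (forall i, semimartingale P F (S i)) -> (forall i, bounded_below_by P 0 (S i)) ->
  sf_portfolios P F S 1 X ->
  exists X', [/\ sf_portfolios P F S 1 X', nonneg_process P X' & adapted F X'].
Proof.
move=> triv sS S0 [dl [[Y [fE [pdl _ _ [J [_ [iJ _ _]]]]] _] p1 _]].
set E := strategy_support P dl in fE pdl iJ.
have [i [Ei nSi]] : exists i, E i /\ ~ {ae P, forall w, S i 0 w = 0}.
  apply: contrapT => nE.
  (* The initial values are read as processes constant in time, so that [indist_fsum] applies; the
     result would be initial value 0 instead of 1. *)
  have : indist P (fun t w => \sum_(i \in E) (dl i 0 w * S i 0 w)) (fun t w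
    => \sum_(i <- elements E) 0).
    apply: (indist_fsum (X := fun i t w => dl i 0 w * S i 0 w) (Y := fun=> P0)) => //.
    move=> i Ei; have : {ae P, forall w, S i 0 w = 0}.
      by apply: contrapT => nS; apply: nE; exists i.
    by apply: filterS => w -> t t0; rewrite mulr0.
  move=> h; suff : (1 : R) = 0 by apply/eqP; rewrite oner_eq0.
  apply: (ae_cst (P := P)); apply: filterS2 h p1 => w h p.
  by rewrite -p /portfolio (h 0 (lexx 0)) big1.
have aS : adapted F (S i) by case: (sS i).
have [c Sc] := trivial_measurable_constant hF triv (aS 0 (lexx 0)).
have c0 : c != 0 by apply/eqP => c0; apply: nSi; apply: filterS Sc => w ->.
have c_ge0 : 0 <= c.
  by apply: (ae_cst (P := P)); apply: filterS2 Sc (S0 i) => w <- h; exact: h.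
have pE : portfolio P S (hold i c^-1) = (fun t w => c^-1 * S i t w).
  apply/funext => t; apply/funext => w; rewrite /portfolio support_hold ?invr_eq0//.
  by rewrite fsbig_set1 /hold eqxx.
exists (fun t w => c^-1 * S i t w); split.
- exists (hold i c^-1); split; rewrite ?pE; last exact: indist_refl.
    exists (fun t w => c^-1 * (S i t w - S i 0 w)).
      (* The operator for [S i] is borrowed from the given strategy, which holds asset [i]. *)
      by apply: hold_integral (iJ i Ei) => //; rewrite invr_eq0.
    by rewrite pE; apply: aeW => w t t0; ring.
  by apply: filterS Sc => w ->; rewrite mulVf.
- by apply: filterS (S0 i) => w h t t0; rewrite mulr_ge0 ?invr_ge0// h.
- by move=> t t0; apply: (sub_measurableZ (hF.1 _ t0).1); exact: aS.
Qed.

Lemma families_nonneg S T (K : R -> set (Omega -> R)) : 0 <= T ->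
  trivial_sigma_algebra P (F 0) -> [set: I] !=set0 ->
  (forall i, semimartingale P F (S i)) -> (forall i, bounded_below_by P 0 (S i)) ->
  (K = K_I P F S T \/ K = K_I_adm P F S T \/ K = K_I_plus P F S T \/
   K = K_P P F S T \/ K = K_P_adm P F S T \/ K = K_P_plus P F S T) ->
  K 1 !=set0 -> exists2 k, K 1 k & L0plus P (F T) k.
Proof.
move=> T0 triv [i _] sS S0 KE [k1 Kk1].
have [X [CX X0 LX]] : exists X, [/\ (nonneg_process P X -> K 1 (X T)),
  nonneg_process P X & L0 (F T) (X T)].
  have ae_refl X : {ae P, forall w : Omega, X T w = X T w} by exact: aeW.
  (* Within each group the three families differ only in a bound from below, which a nonnegative
     process meets. *)
  have [EI|EP] : (K = K_I P F S T \/ K = K_I_adm P F S T \/ K = K_I_plus P F S T) \/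
     (K = K_P P F S T \/ K = K_P_adm P F S T \/ K = K_P_plus P F S T) by tauto.
    have one := investments_one (ex_intro _ i (sS i)).
    have L : L0 (F T) ((fun=> 1) : Omega -> R) := sub_measurable_cst (hF.1 _ T0).1 1.
    exists (fun=> fun=> 1); split=> //; last by apply: aeW => w t t0; exact: ler01.
    move=> h; have h' := nonneg_admissible h.
    by case: EI => [->|[->|->]]; (split; first exact: L); exists (fun=> fun=> 1);
      (exact: ae_refl || by []).
  have [X1 CX1] : exists X1, sf_portfolios P F S 1 X1.
    by case: EP Kk1 => [->|[->|->]] [_ [X1 CX1 _]]; [|case: CX1 => ? _|case: CX1 => ? _];
      exists X1.
  have [X' [CX' X'0 aX']] := sf_portfolios_hold triv sS S0 CX1.
  exists X'; split=> //; last exact: aX'.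
  move=> h; have h' := nonneg_admissible h.
  by case: EP => [->|[->|->]]; (split; first exact: aX'); exists X'; (exact: ae_refl || by []).
exists (X T); first exact: CX.
by split=> //; apply: filterS X0 => w; apply.
Qed.

End Families.

Theorem theorem7p25 (R : realType) (d : measure_display)
  (Omega : measurableType d) (P : probability Omega R)
  (F : R -> set (set Omega))
  (F_filtration : filtration F)
  (F_usual : usual_conditions P F)
  (F0_trivial : trivial_sigma_algebra P (F 0))
  (I : choiceType) (I_nonempty : [set: I] !=set0)
  (S : I -> process R Omega)
  (S_semimartingale : forall i, semimartingale P F (S i))
  (S_ge0 : forall i, bounded_below_by P 0 (S i))
  (T : R) (T_gt0 : 0 < T)
  (K : R -> set (Omega -> R))
  (K_family :
     K = K_I P F S T \/ K = K_I_adm P F S T \/ K = K_I_plus P F S T \/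
     K = K_P P F S T \/ K = K_P_adm P F S T \/ K = K_P_plus P F S T) :
  let B := fun alpha : R => dominated_claims P (F T) (K alpha) in
  [/\ NUPBR P (F T) (K 1) <-> NAA1 P (F T) (K 1),
      NAA1 P (F T) (K 1) <-> NA1 P (F T) (K 1) &
      K 1 !=set0 ->
      (NA1 P (F T) (K 1) <->
       \bigcap_(alpha in [set alpha : R | 0 < alpha]) B alpha =
       L0zero P (F T))].
Proof.
move=> B.
have T0 := ltW T_gt0.
have [sG Gm] := F_filtration.1 _ T0.
have cone := families_cone F_filtration F_usual T0 K_family.
have BL0 : dominated_claims P (F T) (K 1) `<=` L0 (F T) := @dominated_claims_L0 _ _ _ P (F T)
  (K 1).
have half k l : K 1 k -> K 1 l -> K 1 (fun w => 2^-1 * k w + 2^-1 * l w).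
  move=> Kk Kl; have := cone 1 1 2^-1 2^-1 k l _ _ Kk Kl.
  by rewrite (_ : 2^-1 * 1 + 2^-1 * 1 = 1 :> R); [apply; rewrite invr_ge0|field].
have top_seq := topologically_sequentially (P := P) sG Gm BL0.
have seq_top := sequentially_topologically (P := P) sG Gm BL0.
have seq_na := sequentially_NA1 (P := P) Gm (K := K 1).
have na_top := NA1_topologically (P := P) sG Gm half.
(* NA_1 leads back to sequential boundedness through topological boundedness. *)
split; [by split|by split=> [|/na_top/top_seq]|].
(* Positive homogeneity of the sets [B alpha], from the cone property with second coefficient 0. *)
have scaleB alpha beta x : 0 < x -> beta = x * alpha -> forall xi, B alpha xi ->
    B beta (fun w => x * xi w).
  move=> x0 -> xi [[k [eta [Kk [Le e0] xE]]] [Lx xi0]]; split; last first.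
    split; first exact: (sub_measurableZ sG).
    by apply: filterS xi0 => w h; rewrite mulr_ge0// ltW.
  exists (fun w => x * k w), (fun w => x * eta w); split.
  - have := cone alpha alpha x 0 k k (ltW x0) (lexx 0) Kk Kk.
    rewrite mul0r addr0; congr (K _ _); apply/funext => w; by rewrite mul0r addr0.
  - split; first exact: (sub_measurableZ sG).
    by apply: filterS e0 => w h; rewrite mulr_ge0// ltW.
  - by apply/funext => w; rewrite xE mulrBr.
move=> K1; split=> [na|capE].
- apply/seteqP; split=> [xi capxi|xi [Lxi xi0] alpha /= a0].
    (* Membership in [B x] for every x > 0 puts xi / x into [B 1], so the gauge of [xi] is at most
       every x. *)
    have [[k [eta [_ _ _]]] L0x] := capxi 1 (@ltr01 R).
    apply: contrapT => nz; have := na xi (conj L0x nz).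
    apply/negP; rewrite -leNgt; apply/lee_addgt0Pr => x x0; rewrite add0e.
    apply: ereal_inf_lbound; exists x => //; split=> //.
    exists (fun w => x^-1 * xi w); last by apply/funext => w; rewrite mulrA mulfV ?mul1r// gt_eqF.
    apply: (scaleB x 1) => //; first by rewrite invr_gt0.
      by rewrite mulVf// gt_eqF.
    exact: capxi.
  (* A null [xi] is written as alpha k - (alpha k - xi); the subtracted term is a.s. nonnegative
     because [k] is. *)
  have [k Kk [Lk k0]] := families_nonneg F_filtration T0 F0_trivial
    I_nonempty S_semimartingale S_ge0 K_family K1.
  split; last by split=> //; apply: filterS xi0 => w ->.
  exists (fun w => alpha * k w), (fun w => alpha * k w - xi w); split.
  + have := cone 1 1 alpha 0 k k (ltW a0) (lexx 0) Kk Kk.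
    rewrite mul0r addr0 mulr1; congr (K _ _); apply/funext => w; by rewrite mul0r addr0.
  + split; first by apply: (sub_measurableB sG) => //; exact: (sub_measurableZ sG).
    by apply: filterS2 k0 xi0 => w h ->; rewrite subr0 mulr_ge0// ltW.
  + by apply/funext => w; ring.
(* If the gauge is not positive, [xi] is a b with b in [B 1] and a below any given alpha. Solidity
   gives (a / alpha) b in [B 1], and scaling by alpha puts [xi] into [B alpha]. *)
- move=> xi [L0x nz]; apply: contrapT => /gauge_not_gt0 g0; apply: nz.
  rewrite -capE => alpha /= a0.
  have [a [apos aa [b Bb xE]]] := g0 alpha a0.
  have b0 : 0 <= a / alpha <= 1 by rewrite divr_ge0 ?(ltW apos) ?(ltW a0)// ler_pdivrMr// mul1r
    ltW.
  have Bxi : B 1 (fun w => a / alpha * b w).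
    apply: (dominated_claims_solid sG Bb); first by apply: (sub_measurableZ sG); exact: BL0.
    case: Bb => _ [_]; apply: filterS => w h; case/andP: b0 => b0 b1.
    by rewrite mulr_ge0//= ler_piMl.
  have := scaleB 1 alpha alpha a0 (esym (mulr1 alpha)) _ Bxi.
  congr (B alpha _); rewrite xE; apply/funext => w.
  by rewrite mulrA mulrC [alpha * _]mulrC divfK ?gt_eqF// mulrC.
Qed.
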